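(* Let $1<p<\infty$, $\eta>-1$, let $\mathcal K$ be a nonzero separable Hilbert space and set $\mathcal H=\mathcal K\oplus\mathcal K$. Choose \[ -(\eta+1)<a<0<b<(p-1)(\eta+1),\qquad t(z)=1-|z|^2 . \] On $\mathcal H$, define \[ C=\begin{pmatrix}I&I\\0&I\end{pmatrix},\qquad D(z)=\begin{pmatrix}t(z)^{a/p}I&0\\0&t(z)^{b/p}I\end{pmatrix},\qquad U(z)=C^*D(z)C,\qquad W(z)=U(z)^p . \] Then $W$ satisfies the standing assumptions and $P_\eta$ is bounded on $L^p(W)$. The values of $W$ at distinct radii do not commute, i.e. $W(z_1)W(z_2)\ne W(z_2)W(z_1)$ whenever $|z_1|\ne|z_2|$. There is no scalar weight $w$ with $c\,w I\le W\le C_0\,wI$ almost everywhere for fixed positive constants $c,C_0$. In particular, this gives an infinite-dimensional example when $\dim\mathcal K=\infty$.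
   Context: Measure. $\mathbb D$ is the open unit disc, $dA$ is area measure normalized so that $A(\mathbb D)=1$, and $d\mu_\eta(z)=(\eta+1)(1-|z|^2)^\eta\,dA(z)$. Put $p'=p/(p-1)$. Standing assumptions on a weight $W$ on a nonzero separable complex Hilbert space $\mathcal H$: for almost every $z\in\mathbb D$, $W(z)$ is a positive, boundedly invertible bounded operator on $\mathcal H$; $z\mapsto W(z)e$ is strongly measurable for every $e\in\mathcal H$; and for every $e\in\mathcal H$, $\int_{\mathbb D}\|W^{1/p}e\|^p\,d\mu_\eta<\infty$ and $\int_{\mathbb D}\|W^{-1/p}e\|^{p'}\,d\mu_\eta<\infty$. $L^p(W)$ is the space of (a.e. classes of) strongly measurable $f:\mathbb D\to\mathcal H$ with $\|f\|_{L^p(W)}^p=\int_{\mathbb D}\|W(z)^{1/p}f(z)\|^p\,d\mu_\eta(z)<\infty$. A scalar weight is a positive measurable function on $\mathbb D$; the operator inequalities are in the sense of quadratic forms. Bergman projection. $P_\eta f(z)=\int_{\mathbb D}\frac{f(\zeta)}{(1-\overline\zeta z)^{\eta+2}}\,d\mu_\eta(\zeta)$, where the power is the analytic branch equal to $1$ at $z=0$, defined as a Bochner integral on the dense subspace $\{W^{-1/p}F: F\text{ a bounded, compactly supported, finite-valued simple }\mathcal H\text{-valued function}\}$ of $L^p(W)$. Boundedness on $L^p(W)$ means that this map extends to a bounded operator on $L^p(W)$. *)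

(* Defs.v *)
From HB Require Import structures.
From mathcomp Require Import all_boot all_order all_algebra complex.
From mathcomp Require Import all_classical all_reals all_analysis.
From mathcomp Require Import measurable_realfun.

Set Implicit Arguments.
Unset Strict Implicit.
Unset Printing Implicit Defensive.
Import Order.TTheory GRing.Theory Num.Theory.
Import numFieldNormedType.Exports.
Local Open Scope classical_set_scope.
Local Open Scope ring_scope.
Local Open Scope complex_scope.


Definition dotnorm (R : realType) (H : lmodType R[i])
    (form : {dot H for (Num.conj : R[i] -> R[i])}) (x : H) : R :=
  Num.sqrt (complex.Re (form x x)).

HB.mixin Record isHilbert (R : realType) H of GRing.Lmodule R[i] H := {
  hdot : {dot H for (Num.conj : R[i] -> R[i])};
  hdot_complete : forall u : nat -> H,
    (forall eps : R, 0 < eps -> exists N, forall m n : nat,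
       (N <= m)%N -> (N <= n)%N -> dotnorm hdot (u m - u n) < eps) ->
    exists l : H, forall eps : R, 0 < eps -> exists N, forall n : nat,
       (N <= n)%N -> dotnorm hdot (u n - l) < eps
}.

#[short(type="hilbertType")]
HB.structure Definition Hilbert (R : realType) :=
  {H of isHilbert R H & GRing.Lmodule R[i] H}.

Definition dot (R : realType) (H : hilbertType R) (x y : H) : R[i] := hdot x y.
Definition hnorm (R : realType) (H : hilbertType R) (x : H) : R :=
  dotnorm hdot x.

Section DirectSum.
Context (R : realType) (K : hilbertType R).

Definition sumdot (x y : K * K) : R[i] := dot x.1 y.1 + dot x.2 y.2.


Lemma sumdot_morphl u' : zmod_morphism (sumdot ^~ u').
Proof.
by move=> x y; rewrite /sumdot /dot /= !linearBl /= opprD addrACA.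
Qed.

Lemma sumdot_morphr u : zmod_morphism (sumdot u).
Proof.
by move=> x y; rewrite /sumdot /dot /= !linearBr /= opprD addrACA.
Qed.

Lemma sumdot_scalel u' : scalable_for *%R (sumdot ^~ u').
Proof.
by move=> c x; rewrite /sumdot /dot /= !linearZl_LR /= mulrDr.
Qed.

Lemma sumdot_scaler u :
  scalable_for ((Num.conj : R[i] -> R[i]) \; *%R) (sumdot u).
Proof.
by move=> c x; rewrite /sumdot /dot /= !linearZr_LR /= mulrDr.
Qed.

HB.instance Definition _ :=
  isBilinear.Build R[i] (K * K)%type (K * K)%type R[i] *%R
    ((Num.conj : R[i] -> R[i]) \; *%R) sumdot
    sumdot_morphl sumdot_morphr sumdot_scalel sumdot_scaler.

Lemma sumdot_herm x y :
  sumdot x y = (-1) ^+ false * (Num.conj : R[i] -> R[i]) (sumdot y x).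
Proof.
rewrite /sumdot /dot (hermitian_subproof x.1 y.1) (hermitian_subproof x.2 y.2).
by rewrite !expr0 !mul1r rmorphD.
Qed.

HB.instance Definition _ :=
  isHermitianSesquilinear.Build R[i] (K * K)%type false
    (Num.conj : R[i] -> R[i]) sumdot sumdot_herm.

Lemma hdot_ge0 (x : K) : 0 <= dot x x.
Proof.
have [->|x0] := eqVneq x 0; first by rewrite /dot linear0l.
exact/ltW/neq0_dnorm_gt0.
Qed.

Lemma sumdot_gt0 (u : K * K) : u != 0 -> 0 < sumdot u u.
Proof.
case: u => x y; rewrite /sumdot /= => xy0.
have [x0|x0] := eqVneq x 0; last first.
  by apply: ltr_pwDl; [exact: neq0_dnorm_gt0|exact: hdot_ge0].
apply: ltr_wpDl; first exact: hdot_ge0.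
apply: neq0_dnorm_gt0; apply: contraNneq xy0 => y0.
by rewrite x0 y0.
Qed.

HB.instance Definition _ :=
  isDotProduct.Build R[i] (K * K)%type sumdot sumdot_gt0.

Let sumform : {dot (K * K)%type for (Num.conj : R[i] -> R[i])} := sumdot.

Lemma Re_hdot_ge0 (x : K) : 0 <= complex.Re (dot x x).
Proof. by have := hdot_ge0 x; rewrite lecE => /andP[]. Qed.

Lemma sumnormE (x : K * K) : dotnorm sumform x =
  Num.sqrt (complex.Re (dot x.1 x.1) + complex.Re (dot x.2 x.2)).
Proof. by rewrite /dotnorm /= /sumdot; case: dot => ? ?; case: dot. Qed.

Lemma sumdot_complete (u : nat -> K * K) :
  (forall eps : R, 0 < eps -> exists N, forall m n : nat,
     (N <= m)%N -> (N <= n)%N -> dotnorm sumform (u m - u n) < eps) ->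
  exists l : K * K, forall eps : R, 0 < eps -> exists N, forall n : nat,
     (N <= n)%N -> dotnorm sumform (u n - l) < eps.
Proof.
move=> cu.
have [|l1 ul1] := hdot_complete (fun n => (u n).1).
  move=> eps /cu[N uN]; exists N => m n Nm Nn.
  apply: le_lt_trans (uN m n Nm Nn); rewrite sumnormE ler_wsqrtr//.
  by rewrite lerDl Re_hdot_ge0.
have [|l2 ul2] := hdot_complete (fun n => (u n).2).
  move=> eps /cu[N uN]; exists N => m n Nm Nn.
  apply: le_lt_trans (uN m n Nm Nn); rewrite sumnormE ler_wsqrtr//.
  by rewrite lerDr Re_hdot_ge0.
exists (l1, l2) => eps eps0.
have e20 : 0 < eps / 2 by rewrite divr_gt0.
have [N1 uN1] := ul1 _ e20; have [N2 uN2] := ul2 _ e20.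
exists (maxn N1 N2) => n; rewrite geq_max => /andP[/uN1 n1 /uN2 n2].
rewrite sumnormE /=.
apply: (@le_lt_trans _ _ (dotnorm hdot ((u n).1 - l1) +
                          dotnorm hdot ((u n).2 - l2))); last first.
  by rewrite (splitr eps) ltrD.
rewrite -(@ler_pXn2r _ 2%N) ?nnegrE ?sqrtr_ge0 ?addr_ge0 ?sqrtr_ge0//.
rewrite sqr_sqrtr ?addr_ge0 ?Re_hdot_ge0// sqrrD /dotnorm.
rewrite !sqr_sqrtr ?Re_hdot_ge0// addrAC lerDl mulrn_wge0// mulr_ge0//;
  exact: sqrtr_ge0.
Qed.

HB.instance Definition _ :=
  isHilbert.Build R (K * K)%type sumdot_complete.

End DirectSum.

Section Operators.
Context (R : realType) (H : hilbertType R).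
Implicit Types A B T : H -> H.

Definition bounded_op A : Prop :=
  linear A /\ exists M : R, forall x, hnorm (A x) <= M * hnorm x.

Definition positive_op A : Prop := forall x, 0 <= dot (A x) x.

Definition boundedly_invertible A : Prop :=
  exists B, [/\ bounded_op B, cancel A B & cancel B A].

Definition op_le A B : Prop := forall x, dot (A x) x <= dot (B x) x.

Definition scalar_op (c : R) : H -> H := fun x => c%:C *: x.

Definition is_adjoint A B : Prop := forall x y, dot (A x) y = dot x (B y).

Definition adjoint A : H -> H := xget (fun=> 0) [set B | is_adjoint A B].

Definition polyop (q : {poly R}) A : H -> H :=
  fun x => \sum_(i < size q) (q`_i)%:C *: iter i A x.

(* [T = A ^ s], the continuous functional calculus of a bounded operator [A]
   with [m I <= A <= M I], [0 < m], at the function [u |-> u ^ s]: whenever a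
   real polynomial [q] is uniformly [eps]-close to [u ^ s] on [[m, M]], [q(A)]
   is [eps]-close to [T] in operator norm.  By density of the polynomials in
   C([m, M]), at most one [T] qualifies, and it does not depend on [m, M]. *)
Definition is_opow A (s : R) T : Prop :=
  bounded_op A /\
  exists m M : R, [/\ 0 < m, op_le (scalar_op m) A, op_le A (scalar_op M) &
    forall (q : {poly R}) (eps : R),
      (forall u, m <= u <= M -> `|q.[u] - u `^ s| <= eps) ->
      forall x, hnorm (polyop q A x - T x) <= eps * hnorm x].

Definition opow A (s : R) : H -> H := xget (fun=> 0) (is_opow A s).

Definition nonzero_space : Prop := exists x : H, x != 0.

Definition separable : Prop :=
  exists e : nat -> H, forall (x : H) (eps : R), 0 < eps ->
    exists n, hnorm (x - e n) < eps.

Definition infinite_dim : Prop :=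
  forall n, exists e : 'I_n -> H, forall c : 'I_n -> R[i],
    \sum_i c i *: e i = 0 -> forall i, c i = 0.

End Operators.
Arguments nonzero_space {R} H.
Arguments separable {R} H.
Arguments infinite_dim {R} H.

Definition blockop (R : realType) (K : hilbertType R) (A B C D : K -> K) :
    K * K -> K * K :=
  fun x => (A x.1 + B x.2, C x.1 + D x.2).

Section Bochner.
Context (R : realType) (H : hilbertType R).
Context d (T : measurableType d) (mu : {measure set T -> \bar R}).
Implicit Types f s : T -> H.

Definition simple_fun s : Prop :=
  finite_set (range s) /\ forall y, measurable (s @^-1` [set y]).

Definition strongly_measurable f : Prop :=
  exists s : nat -> T -> H, (forall n, simple_fun (s n)) /\
    {ae mu, forall x, hnorm (s n x - f x) @[n --> \oo] --> (0 : R)}.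

Definition simple_integrable s : Prop :=
  simple_fun s /\ forall y, y != 0 -> (mu (s @^-1` [set y]) < +oo)%E.

Definition simple_integral s : H :=
  \sum_(y \in range s) (fine (mu (s @^-1` [set y])))%:C *: y.

Definition is_bochner f (I : H) : Prop :=
  exists s : nat -> T -> H,
    [/\ forall n, simple_integrable (s n),
        {ae mu, forall x, hnorm (s n x - f x) @[n --> \oo] --> (0 : R)},
        (\int[mu]_x (hnorm (s n x - f x))%:E)%E @[n --> \oo] --> 0%E &
        hnorm (simple_integral (s n) - I) @[n --> \oo] --> (0 : R)].

Definition bochner_integrable f : Prop := exists I, is_bochner f I.

Definition bochner f : H := xget 0 (is_bochner f).

End Bochner.

(* A point [x + i y] of the plane is the pair [(x, y)]. *)
Section Disc.
Context (R : realType).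
Implicit Types z zeta : R * R.

Definition toC z : R[i] := z.1 +i* z.2.

Definition cabs z : R := Num.sqrt (z.1 ^+ 2 + z.2 ^+ 2).

Definition disc : set (R * R) := [set z | cabs z < 1].

Definition tdisc z : R := 1 - cabs z ^+ 2.

Lemma measurable_cabs : measurable_fun [set: R * R] cabs.
Proof.
apply: measurableT_comp; first by apply: continuous_measurable_fun; exact: sqrt_continuous.
apply: measurable_funD.
- by apply: measurable_funX; exact: measurable_fst.
- by apply: measurable_funX; exact: measurable_snd.
Qed.

Lemma measurable_disc : measurable disc.
Proof.
rewrite -[disc]setTI.
rewrite (_ : disc = (fun z => cabs z < 1) @^-1` [set true]); last first.
  by apply/seteqP; split.
have mlt := measurable_fun_ltr measurable_cabs (measurable_cst (1 : R)).
exact: mlt.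
Qed.

Lemma area_cst_ge0 : 0 <= (pi : R)^-1.
Proof. by rewrite invr_ge0 pi_ge0. Qed.

(* The factor [1 / pi] normalizes [area disc = 1]. *)
Definition area : {measure set (measurableTypeR R * measurableTypeR R) -> \bar R} :=
  mscale (NngNum (area_cst_ge0))
    (mrestr (@lebesgue_measure R \x @lebesgue_measure R)%E measurable_disc).


(* The absolute value is redundant when [-1 < eta]; it makes the density
   nonnegative for every [eta], hence [mu_eta] a measure. *)
Definition density (eta : R) z : R := `|(eta + 1) * tdisc z `^ eta|.

Lemma measurable_density eta :
  measurable_fun [set: R * R] (fun z => (density eta z)%:E).
Proof.
apply/measurable_EFinP; apply: measurableT_comp => //.
apply: measurable_funM => //.
apply: (@measurableT_comp _ _ _ _ _ _ (@powR R ^~ eta)).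
  exact: measurable_powR.
apply: measurable_funB => //.
apply: measurable_funX; exact: measurable_cabs.
Qed.

Section Mu.
Variable eta : R.

Definition mu_eta (A : set (measurableTypeR R * measurableTypeR R)) : \bar R :=
  (\int[area]_(z in A) (density eta z)%:E)%E.

Let mu_eta0 : mu_eta set0 = 0%E.
Proof. exact: integral_set0. Qed.

Let mu_eta_ge0 A : (0 <= mu_eta A)%E.
Proof. by apply: integral_ge0 => z _; rewrite lee_fin normr_ge0. Qed.

Let mu_eta_sigma_additive : semi_sigma_additive mu_eta.
Proof.
apply: semi_sigma_additive_nng_induced; first exact: measurable_density.
by move=> z; rewrite lee_fin normr_ge0.
Qed.

HB.instance Definition _ :=
  isMeasure.Build _ _ _ mu_eta mu_eta0 mu_eta_ge0 mu_eta_sigma_additive.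

End Mu.

(* For [0 < Re w] this is the principal power [exp (s * Log w)], the argument
   of [w] being [atan (Im w / Re w)].  In the Bergman kernel,
   [w = 1 - zeta^* z] has positive real part for [z], [zeta] in the disc, so
   that [cpow w s] is the analytic branch in [z] equal to 1 at [z = 0]. *)
Definition cpow (w : R[i]) (s : R) : R[i] :=
  let r := Num.sqrt (complex.Re w ^+ 2 + complex.Im w ^+ 2) `^ s in
  let theta := s * atan (complex.Im w / complex.Re w) in
  (r * cos theta) +i* (r * sin theta).

Definition bergman_kernel (eta : R) z zeta : R[i] :=
  (cpow (1 - (toC zeta)^* * toC z) (eta + 2))^-1.

End Disc.

Section Weights.
Context (R : realType) (H : hilbertType R).
Variables (p eta : R) (W : R * R -> H -> H).
Implicit Types f g F : R * R -> H.

Definition weight_assumptions : Prop :=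
  [/\ nonzero_space H /\ separable H,
      {ae area R, forall z, disc z ->
        [/\ bounded_op (W z), positive_op (W z) & boundedly_invertible (W z)]},
      forall e : H, strongly_measurable (area R) (fun z => W z e),
      forall e : H,
        (\int[mu_eta eta]_(z in @disc R)
           (hnorm (opow (W z) p^-1 e) `^ p)%:E < +oo)%E &
      forall e : H,
        (\int[mu_eta eta]_(z in @disc R)
           (hnorm (opow (W z) (- p^-1) e) `^ (p / (p - 1)))%:E < +oo)%E].

(* [area] and [mu_eta] do not charge the complement of the disc, so functions
   on the disc are represented by functions on the plane, up to [area]-almost
   everywhere equality. *)
Definition LpW_norm f : \bar R :=
  ((\int[mu_eta eta]_(z in @disc R)
      (hnorm (opow (W z) p^-1 (f z)) `^ p)%:E) `^ p^-1)%E.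

Definition in_LpW f : Prop :=
  strongly_measurable (area R) f /\ (LpW_norm f < +oo)%E.

Definition bergman f (z : R * R) : H :=
  bochner (mu_eta eta) (fun zeta => bergman_kernel eta z zeta *: f zeta).

(* [F] is finite-valued by [simple_fun], hence bounded. *)
Definition bergman_dom f : Prop :=
  exists F, [/\ simple_fun (F : measurableTypeR R * measurableTypeR R -> H),
    exists S : set (R * R),
      [/\ compact S, S `<=` @disc R & forall z, ~ S z -> F z = 0] &
    f = fun z => opow (W z) (- p^-1) (F z)].

Definition eq_ae f g : Prop := {ae area R, forall z, f z = g z}.

(* [P] acts on representatives; compatibility with [eq_ae] makes it an operator
   on classes. *)
Definition bounded_on_LpW (P : (R * R -> H) -> (R * R -> H)) : Prop :=
  [/\ forall f, in_LpW f -> in_LpW (P f),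
      forall f g, in_LpW f -> in_LpW g -> eq_ae f g -> eq_ae (P f) (P g),
      forall (c : R[i]) f g, in_LpW f -> in_LpW g ->
        eq_ae (P (fun z => c *: f z + g z)) (fun z => c *: P f z + P g z) &
      exists M : R, forall f, in_LpW f ->
        (LpW_norm (P f) <= M%:E * LpW_norm f)%E].

Definition bergman_bounded : Prop :=
  exists2 P, bounded_on_LpW P &
    forall f, bergman_dom f ->
      [/\ in_LpW f,
          forall z, disc z -> bochner_integrable (mu_eta eta)
            (fun zeta => bergman_kernel eta z zeta *: f zeta) &
          eq_ae (P f) (bergman f)].

Definition scalar_comparable : Prop :=
  exists w : R * R -> R,
    [/\ measurable_fun (@disc R) w, forall z, disc z -> 0 < w z &
    exists c C0 : R, [/\ 0 < c, 0 < C0 &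
      {ae area R, forall z, disc z ->
        op_le (scalar_op (c * w z)) (W z) /\
        op_le (W z) (scalar_op (C0 * w z))}]].

End Weights.

(* [K (+) K] is [K * K]; [blockop A B C D] is the matrix with rows [A B], [C D]. *)
Section Example.
Context (R : realType) (K : hilbertType R).

Definition opC : K * K -> K * K := blockop id id (fun=> 0) id.

Definition opD (p a b : R) (z : R * R) : K * K -> K * K :=
  blockop (scalar_op (tdisc z `^ (a / p))) (fun=> 0)
          (fun=> 0) (scalar_op (tdisc z `^ (b / p))).

Definition opU (p a b : R) (z : R * R) : K * K -> K * K :=
  adjoint opC \o opD p a b z \o opC.

Definition opW (p a b : R) (z : R * R) : K * K -> K * K := opow (opU p a b z) p.

Lemma adjoint_opC : adjoint opC = blockop id (fun=> 0) id id.
Proof.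
have adjC : is_adjoint opC (blockop id (fun=> 0) id id).
  move=> [x1 x2] [y1 y2]; rewrite /opC /blockop /dot /= /sumdot /dot /=.
  by rewrite addr0 add0r linearDl linearDr addrA.
rewrite /adjoint; case: xgetP => [B _ adjB|/(_ _ adjC)//].
apply/funext => y; apply/eqP; rewrite -subr_eq0.
set u := (X in X == 0); have [//|u0] := eqVneq u 0.
have : 0 < dot u u by exact: neq0_dnorm_gt0.
have -> : dot u u = dot u (B y) - dot u (blockop id (fun=> 0) id id y).
  by rewrite /dot -linearBr.
by rewrite -adjB -adjC subrr ltxx.
Qed.

End Example.

(* Main.v *)
(* On the disc [U] acts by [U x = (t^(a/p) (x1 + x2), t^(a/p) (x1 + x2) + t^(b/p) x2)],
   so the norm of [U x] is comparable to [t^(a/p) |x1 + x2| + t^(b/p) |x2|].  Each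
   summand is a scalar power weight applied to a seminorm of [x] that does not
   depend on the point.  Hence, after pulling the seminorm inside the Bochner
   integral, boundedness of the projection reduces to the boundedness of the
   integral operator with kernel [|1 - w^* z|^-(eta + 2)] on the scalar spaces
   with weights [t^a] and [t^b].  This is a Schur test with a power of [t] as test
   function, its hypotheses being the Forelli-Rudin estimate
     [\int t(w)^c |1 - w^* z|^-(2 + c + d) dA(w) <= C t(z)^-d], [c > -1], [d > 0].

   [U z] has two eigenvalues, so the functional calculus gives [W = U ^ p] as a
   combination [y U + c I] with [y > 0]; two such operators commute only if the
   ratios [t^((a - b)/p)] agree.  The largest eigenvalue of [W z] is at least
   [t^a] and the smallest at most [t^b]; as [t^(a - b)] is unbounded, no scalar
   weight is comparable to [W]. *)

Require Import Defs.
From HB Require Import structures.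
From mathcomp Require Import all_boot all_order all_algebra complex finmap.
From mathcomp Require Import all_classical all_reals all_analysis.
From mathcomp Require Import measurable_realfun ring lra.

Set Implicit Arguments.
Unset Strict Implicit.
Unset Printing Implicit Defensive.
Import Order.TTheory GRing.Theory Num.Theory.
Import numFieldNormedType.Exports.
Local Open Scope classical_set_scope.
Local Open Scope ring_scope.

(** * Uniqueness of the functional calculus *)

(** [opow] and [bochner] are choices ([xget]), so they carry information only once the chosen object
    is unique. For [opow] this needs density of polynomials, obtained from Bernstein polynomials
    because [u ^ s] is Lipschitz on intervals away from 0. For [bochner] it follows from linearity
    and the norm inequality.

    The upper bounds on [a] and [b] place L^p(W) inside L^1(mu_eta). The integral defining the
    projection therefore converges for every element of L^p(W), and the bounded operator is this
    integral itself: no extension from the dense subspace takes place. Strong measurability of its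
    values is a separate matter, settled by continuity on the disc.

    The Forelli-Rudin estimate uses neither polar coordinates nor power series. The kernel is
    dominated by products of a power singularity in one coordinate and a peak in the l1 distance to
    [z]; these are integrated slice by slice, each slice by a dyadic sum.

    Integrands whose measurability is not at hand are compared through lower integrals, as suprema
    over simple functions. *)

Section Bernstein.
Context {R : realType}.
Implicit Types (g h : nat -> R) (x : R).

(* The Bernstein polynomial [\sum_k g k * 'C(n, k) * 'X^k * (1 - 'X)^(n - k)],
   by de Casteljau's recursion, which makes positivity and the moments
   immediate inductions. *)
Fixpoint bernstein (n : nat) g : {poly R} :=
  if n is n'.+1 then 'X * bernstein n' (g \o succn) + (1 - 'X) * bernstein n' g
  else (g 0%N)%:P.

Lemma bernsteinS n g x : (bernstein n.+1 g).[x] =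
  x * (bernstein n (g \o succn)).[x] + (1 - x) * (bernstein n g).[x].
Proof. by rewrite /= !hornerE. Qed.

Lemma ler_bernstein n g h x : 0 <= x <= 1 ->
  (forall k, (k <= n)%N -> g k <= h k) ->
  (bernstein n g).[x] <= (bernstein n h).[x].
Proof.
move=> /andP[x0 x1]; elim: n g h => [|n IHn] g h gh.
  by rewrite !hornerC gh.
rewrite !bernsteinS lerD// ler_wpM2l ?subr_ge0//; apply: IHn => k kn /=.
  exact: gh.
by apply: gh; rewrite (leq_trans kn).
Qed.

Lemma bernstein_cst n x (c : R) : (bernstein n (fun=> c)).[x] = c.
Proof.
elim: n => [|n IHn]; first by rewrite hornerC.
by rewrite bernsteinS {1}/comp !IHn; ring.
Qed.

Lemma bernsteinD n g h x : (bernstein n (fun k => g k + h k)).[x] =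
  (bernstein n g).[x] + (bernstein n h).[x].
Proof.
elim: n g h => [|n IHn] g h; first by rewrite !hornerC.
by rewrite !bernsteinS {1}/comp !IHn; rewrite /comp; ring.
Qed.

Lemma bernsteinZ n g x (c : R) : (bernstein n (fun k => c * g k)).[x] =
  c * (bernstein n g).[x].
Proof.
elim: n g => [|n IHn] g; first by rewrite !hornerC.
by rewrite !bernsteinS {1}/comp !IHn; rewrite /comp; ring.
Qed.

(** The recursion replaces [k] by [k + 1], which shifts [c]; hence the induction for all [c] at
    once. The last term is the binomial variance. *)
Lemma bernstein_sqr n x (c : R) :
  (bernstein n (fun k => (k%:R + c) ^+ 2)).[x] =
  (n%:R * x + c) ^+ 2 + n%:R * x * (1 - x).
Proof.
elim: n c => [|n IHn] c; first by rewrite hornerC; ring.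
rewrite bernsteinS {1}/comp IHn.
under [X in bernstein n X]funext => k do rewrite -natr1 -addrA.
by rewrite IHn -natr1; ring.
Qed.

(** Bernstein's proof in Chebyshev form: the deviation [|k / N - x|] is at most
    [e + (k / N - x)^2 / e], and the average of the square is the variance [x (1 - x) / N]. With
    [N e^2 >= 1] the error is at most [2 L e]. *)
Lemma bernstein_approx (f : R -> R) (L eps : R) : 0 <= L -> 0 < eps ->
  (forall x y, 0 <= x <= 1 -> 0 <= y <= 1 -> `|f x - f y| <= L * `|x - y|) ->
  exists q : {poly R}, forall x, 0 <= x <= 1 -> `|q.[x] - f x| <= eps.
Proof.
move=> L0 eps0 fL.
pose e := eps / (2 * (L + 1)).
have L10 : 0 < 2 * (L + 1) by rewrite mulr_gt0 ?ltr_wpDl.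
have e0 : 0 < e by rewrite divr_gt0.
have epsE : eps = 2 * (L + 1) * e by rewrite /e mulrC divfK// gt_eqF.
clearbody e.
have [n ne] : exists n : nat, (e ^+ 2)^-1 < n.+1%:R.
  exists (Num.truncn (e ^+ 2)^-1); rewrite truncnS_gt//.
pose N : R := n.+1%:R; have NE : n.+1%:R = N by [].
have N0 : 0 < N by rewrite /N.
have Ne : 1 <= N * e ^+ 2.
  by rewrite -ler_pdivrMr ?exprn_gt0// mul1r ltW.
clearbody N.
exists (bernstein n.+1 (fun k => f (k%:R / N))) => x x01.
(* A quadratic majorant of the deviation, so that its Bernstein polynomial is given by
   [bernstein_sqr] with [c = - N x]. *)
pose v (k : nat) := L * e + L / (e * N ^+ 2) * (k%:R - N * x) ^+ 2.
have vB : (bernstein n.+1 v).[x] = L * e + L / (e * N) * (x * (1 - x)).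
  rewrite /v bernsteinD bernstein_cst bernsteinZ bernstein_sqr NE.
  have eN0 : e != 0 by rewrite gt_eqF.
  have NN0 : N != 0 by rewrite gt_eqF.
  by field; rewrite eN0 NN0.
have v_eps : (bernstein n.+1 v).[x] <= eps.
  rewrite vB; case/andP: x01 => x0 x1.
  have xx : x * (1 - x) <= 1 by nra.
  have xx0 : 0 <= x * (1 - x) by nra.
  have : L / (e * N) <= L * e.
    rewrite ler_pdivrMr ?mulr_gt0//.
    have -> : L * e * (e * N) = L * (N * e ^+ 2) by ring.
    by rewrite ler_peMr.
  by nra.
have key k : (k <= n.+1)%N -> `|f (k%:R / N) - f x| <= v k.
  move=> kn; set d := k%:R / N - x.
  have kN : 0 <= k%:R / N <= 1.
    by rewrite ler_pdivrMr// mul1r -NE ler_nat kn andbT divr_ge0.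
  apply: (le_trans (fL _ _ kN x01)); rewrite -/d.
  have -> : v k = L * (e + d ^+ 2 / e).
    by rewrite /v /d; field; rewrite !gt_eqF.
  rewrite ler_wpM2l// -real_normK ?num_real//.
  have := normr_ge0 d; move: `|d| => t t0.
  rewrite -(ler_pM2r e0) mulrDl divfK ?gt_eqF//; nra.
have fE : (bernstein n.+1 (fun=> f x)).[x] = f x by rewrite bernstein_cst.
have subE : (bernstein n.+1 (fun k => f (k%:R / N))).[x] - f x =
    (bernstein n.+1 (fun k => f (k%:R / N) - f x)).[x].
  by rewrite bernsteinD bernstein_cst.
rewrite subE ler_norml; apply/andP; split.
  rewrite lerNl (le_trans _ v_eps)// -mulN1r -bernsteinZ ler_bernstein// => k kn.
  by rewrite mulN1r (le_trans _ (key k kn))// -normrN ler_norm.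
rewrite (le_trans _ v_eps)// ler_bernstein// => k kn.
by rewrite (le_trans _ (key k kn))// ler_norm.
Qed.

Lemma lipschitz_poly_approx (f : R -> R) (m M L eps : R) :
  m < M -> 0 <= L -> 0 < eps ->
  (forall x y, m <= x <= M -> m <= y <= M -> `|f x - f y| <= L * `|x - y|) ->
  exists q : {poly R}, forall x, m <= x <= M -> `|q.[x] - f x| <= eps.
Proof.
move=> mM L0 eps0 fL.
have d0 : 0 < M - m by rewrite subr_gt0.
have [|x y x01 y01|q qf] :=
    @bernstein_approx (fun x => f (m + (M - m) * x)) (L * (M - m)) eps _ eps0.
- by rewrite mulr_ge0// ltW.
- have itv (z : R) : 0 <= z <= 1 -> m <= m + (M - m) * z <= M.
    by move=> /andP[z0 z1]; apply/andP; split; nra.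
  apply: (le_trans (fL _ _ (itv _ x01) (itv _ y01))).
  rewrite -mulrA -[X in _ * (X * _)](ger0_norm (ltW d0)) -normrM.
  by rewrite le_eqVlt; apply/orP; left; apply/eqP; congr (_ * `|_|); ring.
exists (q \Po ((M - m)^-1 *: ('X - m%:P))) => x /andP[mx xM].
rewrite horner_comp !hornerE.
have := qf ((M - m)^-1 * (x - m)).
have -> : m + (M - m) * ((M - m)^-1 * (x - m)) = x.
  by rewrite mulrA divff ?mul1r ?gt_eqF//; ring.
apply; apply/andP; split; first by rewrite mulr_ge0 ?subr_ge0 ?invr_ge0// ltW.
by rewrite mulrC ler_pdivrMr// mul1r lerB.
Qed.

End Bernstein.

(** * Power functions away from zero *)

Section PowrLipschitz.
Context {R : realType}.

Lemma powR_lipschitz (s m M : R) : 0 < m -> m < M ->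
  exists2 L : R, 0 <= L & forall x y, m <= x <= M -> m <= y <= M ->
    `|x `^ s - y `^ s| <= L * `|x - y|.
Proof.
move=> m0 mM.
(* The derivative [s u^(s - 1)] is monotone in absolute value, increasing or decreasing with the
   sign of [s - 1]; the sum of the endpoint values bounds it in both cases. *)
pose L := `|s| * (m `^ (s - 1) + M `^ (s - 1)).
have L0 : 0 <= L by rewrite mulr_ge0// addr_ge0 ?powR_ge0.
exists L => // x y.
have wlog_lt (u v : R) : m <= u -> u < v -> v <= M ->
    `|v `^ s - u `^ s| <= L * `|v - u|.
  move=> mu uv vM.
  have pos (c : R) : m <= c -> 0 < c by exact: lt_le_trans.
  have dpow (c : R) : m <= c -> is_derive c 1 (@powR R ^~ s) (s * c `^ (s - 1)).
    by move=> mc; apply: is_derive1_powR; exact: pos.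
  have [c||c] := @MVT _ (@powR R ^~ s) (fun c => s * c `^ (s - 1)) u v uv.
  - by rewrite in_itv/= => /andP[uc _]; apply: dpow; rewrite (le_trans mu)// ltW.
  - apply: derivable_within_continuous => c; rewrite in_itv/= => /andP[uc _].
    by apply: derivable_powR; rewrite in_itv/= andbT pos// (le_trans mu).
  rewrite in_itv/= => /andP[uc cv] ->.
  rewrite normrM ler_wpM2r// /L normrM ler_wpM2l// ger0_norm ?powR_ge0//.
  have mc : m <= c by rewrite (le_trans mu)// ltW.
  have cM : c <= M by rewrite (le_trans _ vM)// ltW.
  have [s1|s1] := leP 0 (s - 1).
    apply: (@le_trans _ _ (M `^ (s - 1))); last by rewrite lerDr powR_ge0.
    by rewrite ge0_ler_powR// nnegrE ltW// ?pos// (le_trans mc).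
  apply: (@le_trans _ _ (m `^ (s - 1))); last by rewrite lerDl powR_ge0.
  have -> : s - 1 = - (1 - s) by rewrite opprB.
  rewrite !powRN lef_pV2 ?posrE ?powR_gt0 ?pos//.
  rewrite ge0_ler_powR ?nnegrE//; last 2 first.
  - by rewrite ltW.
  - by rewrite ltW// pos.
  by rewrite subr_ge0 -subr_le0 ltW.
move=> /andP[mx xM] /andP[my yM].
have [xy|xy|->] := ltgtP x y; last by rewrite !subrr !normr0 mulr0.
- by rewrite distrC [X in _ * X]distrC; exact: wlog_lt.
- exact: wlog_lt.
Qed.

Lemma powR_poly_approx (s m M eps : R) : 0 < m -> m < M -> 0 < eps ->
  exists q : {poly R}, forall x, m <= x <= M -> `|q.[x] - x `^ s| <= eps.
Proof.
move=> m0 mM eps0; have [L L0 Ls] := powR_lipschitz s m0 mM.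
exact: lipschitz_poly_approx Ls.
Qed.

End PowrLipschitz.

(** * Inner product and norm *)

Section HilbertSpace.
Context {R : realType} {H : hilbertType R}.
Implicit Types (x y z : H) (c : R).
Local Open Scope complex_scope.

(** The underlying real inner product: it gives the same norm and still separates points, and keeps
    the computations in [R]. *)
Definition rdot x y : R := complex.Re (dot x y).

Lemma dotDl x y z : dot (x + y) z = dot x z + dot y z.
Proof. exact: linearDl. Qed.

Lemma dotDr x y z : dot x (y + z) = dot x y + dot x z.
Proof. exact: linearDr. Qed.

Lemma dotZl (k : R[i]) x y : dot (k *: x) y = k * dot x y.
Proof. exact: linearZl_LR. Qed.

Lemma dotZr (k : R[i]) x y : dot x (k *: y) = k^* * dot x y.
Proof. exact: linearZr_LR. Qed.

Lemma dotC x y : dot x y = (dot y x)^*.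
Proof. by rewrite /dot (hermitian_subproof x y) expr0 mul1r. Qed.

Lemma rdotC x y : rdot x y = rdot y x.
Proof. by rewrite /rdot dotC; case: dot. Qed.

Lemma rdotDl x y z : rdot (x + y) z = rdot x z + rdot y z.
Proof. by rewrite /rdot dotDl raddfD. Qed.

Lemma rdotDr x y z : rdot x (y + z) = rdot x y + rdot x z.
Proof. by rewrite /rdot dotDr raddfD. Qed.

Lemma rdotZl c x y : rdot (c%:C *: x) y = c * rdot x y.
Proof. by rewrite /rdot dotZl; case: dot => a b /=; rewrite mul0r subr0. Qed.

Lemma rdotZr c x y : rdot x (c%:C *: y) = c * rdot x y.
Proof. by rewrite rdotC rdotZl rdotC. Qed.

Lemma rdotNl x y : rdot (- x) y = - rdot x y.
Proof. by rewrite /rdot /dot linearNl raddfN. Qed.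

Lemma rdotNr x y : rdot x (- y) = - rdot x y.
Proof. by rewrite rdotC rdotNl rdotC. Qed.

Lemma rdot_ge0 x : 0 <= rdot x x.
Proof. exact: Re_hdot_ge0. Qed.

Lemma dot_norm x : dot x x = (rdot x x)%:C.
Proof.
have := hdot_ge0 x; rewrite /rdot lecE /= => /andP[/eqP Im0 _].
by case: dot Im0 => a b /= ->.
Qed.

Lemma rdot_eq0 x : (rdot x x == 0) = (x == 0).
Proof.
apply/idP/idP => [/eqP x0|/eqP ->]; last by rewrite /rdot /dot linear0l.
apply: contraT => x_neq0.
have : 0 < dot x x by exact: neq0_dnorm_gt0.
by rewrite dot_norm x0 ltxx.
Qed.

Lemma hnormE x : hnorm x = Num.sqrt (rdot x x).
Proof. by []. Qed.

Lemma sqr_hnorm x : hnorm x ^+ 2 = rdot x x.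
Proof. by rewrite sqr_sqrtr ?rdot_ge0. Qed.

Lemma hnorm_ge0 x : 0 <= hnorm x.
Proof. exact: sqrtr_ge0. Qed.

Lemma hnorm_eq0 x : (hnorm x == 0) = (x == 0).
Proof. by rewrite -sqrf_eq0 sqr_hnorm rdot_eq0. Qed.

Lemma hnorm0 : hnorm (0 : H) = 0.
Proof. by apply/eqP; rewrite hnorm_eq0. Qed.

Lemma hnorm_gt0 x : (0 < hnorm x) = (x != 0).
Proof. by rewrite lt_def hnorm_ge0 andbT hnorm_eq0. Qed.

Lemma normcR_ge0 (k : R[i]) : 0 <= ComplexField.Normc.normc k.
Proof. by case: k => a b; rewrite /= sqrtr_ge0. Qed.

Lemma hnormZ (k : R[i]) x : hnorm (k *: x) = ComplexField.Normc.normc k * hnorm x.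
Proof.
rewrite !hnormE; rewrite {1}/rdot dotZl dotZr mulrA dot_norm.
case: k => a b /=.
rewrite -sqrtrM ?addr_ge0 ?sqr_ge0//; congr Num.sqrt.
by rewrite !mulr0 !subr0; ring.
Qed.

Lemma hnormZr c x : hnorm (c%:C *: x) = `|c| * hnorm x.
Proof. by rewrite hnormZ /= expr0n addr0 sqrtr_sqr. Qed.

Lemma hnormN x : hnorm (- x) = hnorm x.
Proof. by rewrite !hnormE rdotNl rdotNr opprK. Qed.

Lemma hnormB x y : hnorm (x - y) = hnorm (y - x).
Proof. by rewrite -hnormN opprB. Qed.

(** Cauchy-Schwarz: the squared norm of [|y| x - |x| y] equals [2 |x| |y| (|x| |y| - rdot x y)]. *)
Lemma rdot_le x y : rdot x y <= hnorm x * hnorm y.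
Proof.
have [->|x0] := eqVneq x 0; first by rewrite hnorm0 mul0r /rdot /dot linear0l.
have [->|y0] := eqVneq y 0; first by rewrite hnorm0 mulr0 /rdot /dot linear0r.
have := rdot_ge0 ((hnorm y)%:C *: x - (hnorm x)%:C *: y).
rewrite !(rdotDl, rdotDr, rdotNl, rdotNr, rdotZl, rdotZr) -!sqr_hnorm (rdotC y x).
rewrite -hnorm_gt0 in x0; rewrite -hnorm_gt0 in y0.
have := mulr_gt0 x0 y0.
move: (hnorm x) (hnorm y) (rdot x y) => u v w uv h.
by rewrite -(ler_pM2l uv); nra.
Qed.

Lemma ler_hnormD x y : hnorm (x + y) <= hnorm x + hnorm y.
Proof.
rewrite -(@ler_pXn2r _ 2%N) ?nnegrE ?addr_ge0 ?hnorm_ge0//.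
rewrite sqr_hnorm rdotDl !rdotDr -!sqr_hnorm (rdotC y x).
by have := rdot_le x y; nra.
Qed.

Lemma ler_hnormB x y z : hnorm (x - z) <= hnorm (x - y) + hnorm (y - z).
Proof. by rewrite (le_trans _ (ler_hnormD _ _))// addrA subrK. Qed.

Lemma ler_dist_hnorm x y : `|hnorm x - hnorm y| <= hnorm (x - y).
Proof.
rewrite ler_norml lerBrDr lerBlDr addrC lerBlDr; apply/andP; split.
  by rewrite addrC -{1}(subrK x y) hnormB (le_trans (ler_hnormD _ _))// hnormB addrC.
by rewrite -{1}(subrK y x) ler_hnormD.
Qed.

End HilbertSpace.

(** * Operators with two spectral values *)

Section TwoPointSpectrum.
Context {R : realType} {H : hilbertType R}.
Implicit Types (A T P Q : H -> H) (l m s c : R).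
Local Open Scope complex_scope.

(** The two witnesses may refer to different spectral intervals. A polynomial close to [u ^ s] on an
    interval containing both makes [q(A)] close to [T] and to [T'] simultaneously. *)
Lemma is_opow_unique A s T T' : is_opow A s T -> is_opow A s T' -> T = T'.
Proof.
move=> [_ [m [M [m0 _ _ AT]]]] [_ [m' [M' [m'0 _ _ AT']]]].
apply/funext => x.
(* [lo + 1] keeps the interval nondegenerate, as the approximation lemma asks. *)
pose lo := Num.min m m'; pose hi := Num.max (lo + 1) (Num.max M M').
have lo0 : 0 < lo by rewrite lt_min m0.
have lohi : lo < hi by rewrite lt_max ltrDl ltr01.
suff : hnorm (T x - T' x) <= 0.
  by rewrite le_eqVlt ltNge hnorm_ge0 orbF hnorm_eq0 subr_eq0 => /eqP.
apply/ler_addgt0Pl => e e0; rewrite addr0.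
pose d := e / (2 * (hnorm x + 1)).
have x10 : 0 < hnorm x + 1 by rewrite ltr_wpDl ?hnorm_ge0.
have d0 : 0 < d by rewrite divr_gt0 ?mulr_gt0.
have [q qs] := powR_poly_approx s lo0 lohi d0.
have q1 : hnorm (polyop q A x - T x) <= d * hnorm x.
  apply: AT => u /andP[mu uM]; apply: qs; rewrite ge_min mu/=.
  by rewrite !le_max uM orbT.
have q2 : hnorm (polyop q A x - T' x) <= d * hnorm x.
  apply: AT' => u /andP[mu uM]; apply: qs; rewrite ge_min mu orbT/=.
  by rewrite !le_max uM !orbT.
apply: (le_trans (ler_hnormB _ (polyop q A x) _)).
rewrite (hnormB (T x)) (le_trans (lerD q1 q2))//.
have := hnorm_ge0 x.
have eE : e = d * (2 * (hnorm x + 1)) by rewrite /d divfK// gt_eqF// mulr_gt0.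
by nra.
Qed.

Lemma opowE A s T : is_opow A s T -> opow A s = T.
Proof.
by move=> AT; rewrite /opow; case: xgetP => [B _ AB|/(_ T)//]; exact: is_opow_unique AT.
Qed.

Section LinearFun.
Variables (H' : lmodType R[i]) (f : H -> H').
Hypothesis linf : linear f.

Lemma lin0 : f 0 = 0.
Proof. by have := linf (-1) 0 0; rewrite scaler0 addr0 scaleN1r addNr. Qed.

Lemma linD x y : f (x + y) = f x + f y.
Proof. by have := linf 1 x y; rewrite !scale1r. Qed.

Lemma linZ k x : f (k *: x) = k *: f x.
Proof. by have := linf k x 0; rewrite lin0 !addr0. Qed.

Lemma linB x y : f (x - y) = f x - f y.
Proof. by rewrite -[- y]scaleN1r linD linZ scaleN1r. Qed.

End LinearFun.

(** Complementary orthogonal projections, with orthogonality of the ranges in place of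
    self-adjointness. Either one may vanish; nonvanishing is stated separately where it matters. *)
Record orth_split P Q : Prop := OrthSplit {
  split_linl : linear P;
  split_linr : linear Q;
  splitD : forall x, P x + Q x = x;
  split_lr : forall x, P (Q x) = 0;
  split_rl : forall x, Q (P x) = 0;
  split_orth : forall x y, dot (P x) (Q y) = 0 }.

Definition spec2 P Q l m : H -> H := fun x => l%:C *: P x + m%:C *: Q x.

Section Split.
Variables (P Q : H -> H).
Hypothesis PQ : orth_split P Q.

Let linP := split_linl PQ.
Let linQ := split_linr PQ.

Lemma split_idl x : P (P x) = P x.
Proof. by have := splitD PQ (P x); rewrite (split_rl PQ) addr0. Qed.

Lemma split_idr x : Q (Q x) = Q x.
Proof. by have := splitD PQ (Q x); rewrite (split_lr PQ) add0r. Qed.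

Lemma split_spec2l l m x : P (spec2 P Q l m x) = l%:C *: P x.
Proof.
by rewrite (linD linP) !(linZ linP) split_idl (split_lr PQ) scaler0 addr0.
Qed.

Lemma split_spec2r l m x : Q (spec2 P Q l m x) = m%:C *: Q x.
Proof.
by rewrite (linD linQ) !(linZ linQ) split_idr (split_rl PQ) scaler0 add0r.
Qed.

Lemma spec2_comp l m l' m' x :
  spec2 P Q l m (spec2 P Q l' m' x) = spec2 P Q (l * l') (m * m') x.
Proof.
by rewrite {1}/spec2 split_spec2l split_spec2r !scalerA /spec2 !rmorphM.
Qed.

Lemma spec2_id x : spec2 P Q 1 1 x = x.
Proof. by rewrite /spec2 !scale1r (splitD PQ). Qed.

Lemma spec2_linear l m : linear (spec2 P Q l m).
Proof.
move=> k x y; rewrite /spec2 linP linQ !scalerDr !scalerA addrACA.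
by rewrite (mulrC _ k) (mulrC m%:C k).
Qed.

Lemma rdot_split x y : rdot x y = rdot (P x) (P y) + rdot (Q x) (Q y).
Proof.
rewrite -{1}(splitD PQ x) -{1}(splitD PQ y) rdotDl !rdotDr (rdotC (Q x) (P y)).
by rewrite /rdot !(split_orth PQ) raddf0 addr0 add0r.
Qed.

Lemma sqr_hnorm_split x : hnorm x ^+ 2 = hnorm (P x) ^+ 2 + hnorm (Q x) ^+ 2.
Proof. by rewrite !sqr_hnorm rdot_split. Qed.

Lemma dot_spec2 l m x :
  dot (spec2 P Q l m x) x = (l * hnorm (P x) ^+ 2 + m * hnorm (Q x) ^+ 2)%:C.
Proof.
have -> : dot (spec2 P Q l m x) x =
    l%:C * dot (P x) (P x) + m%:C * dot (Q x) (Q x).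
  have dP : dot (P x) x = dot (P x) (P x).
    by rewrite -{2}(splitD PQ x) dotDr (split_orth PQ) addr0.
  have dQ : dot (Q x) x = dot (Q x) (Q x).
    by rewrite -{2}(splitD PQ x) dotDr dotC (split_orth PQ) conjc0 add0r.
  by rewrite /spec2 dotDl !dotZl dP dQ.
by rewrite !dot_norm -!sqr_hnorm -!rmorphM -rmorphD.
Qed.

Lemma sqr_hnorm_spec2 l m x : hnorm (spec2 P Q l m x) ^+ 2 =
  l ^+ 2 * hnorm (P x) ^+ 2 + m ^+ 2 * hnorm (Q x) ^+ 2.
Proof.
rewrite sqr_hnorm_split split_spec2l split_spec2r !hnormZr !exprMn.
by rewrite !real_normK ?num_real.
Qed.

Lemma hnorm_spec2_le l m c x : 0 <= c -> `|l| <= c -> `|m| <= c ->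
  hnorm (spec2 P Q l m x) <= c * hnorm x.
Proof.
move=> c0 lc mc.
rewrite -(@ler_pXn2r _ 2%N) ?nnegrE ?mulr_ge0 ?hnorm_ge0//.
rewrite sqr_hnorm_spec2 exprMn (sqr_hnorm_split x) mulrDr.
by rewrite lerD// ler_wpM2r ?sqr_ge0// -real_normK ?num_real// ler_pXn2r ?nnegrE.
Qed.

Lemma spec2_bounded l m : bounded_op (spec2 P Q l m).
Proof.
split; first exact: spec2_linear.
exists (`|l| + `|m|) => x; apply: hnorm_spec2_le; first by rewrite addr_ge0.
  by rewrite lerDl.
by rewrite lerDr.
Qed.

Lemma spec2_boundedly_invertible l m : l != 0 -> m != 0 ->
  boundedly_invertible (spec2 P Q l m).
Proof.
move=> l0 m0; exists (spec2 P Q l^-1 m^-1); split.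
- exact: spec2_bounded.
- by move=> x; rewrite spec2_comp !mulVf ?spec2_id.
- by move=> x; rewrite spec2_comp !mulfV ?spec2_id.
Qed.

Lemma spec2_positive l m : 0 <= l -> 0 <= m -> positive_op (spec2 P Q l m).
Proof.
move=> l0 m0 x; rewrite dot_spec2 lecR.
by rewrite addr_ge0// mulr_ge0// sqr_ge0.
Qed.

(** Powers act separately on the ranges of [P] and [Q], so a polynomial is evaluated at the two
    spectral values. *)
Lemma polyop_spec2 (q : {poly R}) l m x :
  polyop q (spec2 P Q l m) x = spec2 P Q q.[l] q.[m] x.
Proof.
have iterE i : iter i (spec2 P Q l m) x = spec2 P Q (l ^+ i) (m ^+ i) x.
  elim: i => [|i IHi]; first by rewrite /= spec2_id.
  by rewrite iterS IHi spec2_comp -!exprS.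
rewrite /polyop /spec2 !horner_coef !rmorph_sum/= !scaler_suml -big_split/=.
by apply: eq_bigr => i _; rewrite iterE /spec2 scalerDr !scalerA -!rmorphM.
Qed.

Lemma scalar_spec2 c : scalar_op c = spec2 P Q c c.
Proof. by apply/funext => x; rewrite /spec2 -scalerDr (splitD PQ). Qed.

Lemma op_le_spec2 l m l' m' : l <= l' -> m <= m' ->
  op_le (spec2 P Q l m) (spec2 P Q l' m').
Proof.
by move=> ll' mm' x; rewrite !dot_spec2 lecR lerD// ler_wpM2r ?sqr_ge0.
Qed.

(** Testing the forms on a vector of the range of [P] removes the [m] terms, and conversely for
    [Q]. *)
Lemma op_le_spec2_inv l m l' m' : op_le (spec2 P Q l m) (spec2 P Q l' m') ->
  (exists x, P x != 0) -> (exists x, Q x != 0) -> l <= l' /\ m <= m'.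
Proof.
move=> le [x Px] [y Qy]; split.
  have := le (P x); rewrite !dot_spec2 split_idl (split_rl PQ) hnorm0 lecR.
  rewrite expr0n !mulr0 !addr0 ler_pM2r// exprn_gt0//.
  by rewrite hnorm_gt0.
have := le (Q y); rewrite !dot_spec2 split_idr (split_lr PQ) hnorm0 lecR.
rewrite expr0n !mulr0 !add0r ler_pM2r// exprn_gt0//.
by rewrite hnorm_gt0.
Qed.

(** With the interval [[min l m, max l m]], both spectral values are points where [q] is [eps]-close
    to [u ^ s], and an operator [spec2 P Q] is bounded by the larger of its coefficients in absolute
    value. *)
Lemma opow_spec2 l m s : 0 < l -> 0 < m ->
  opow (spec2 P Q l m) s = spec2 P Q (l `^ s) (m `^ s).
Proof.
move=> l0 m0; apply: opowE; split; first exact: spec2_bounded.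
exists (Num.min l m), (Num.max l m); split.
- by rewrite lt_min l0.
- by rewrite scalar_spec2; apply: op_le_spec2; rewrite ge_min lexx ?orbT.
- by rewrite scalar_spec2; apply: op_le_spec2; rewrite le_max lexx ?orbT.
move=> q e qe x; rewrite polyop_spec2.
have -> : spec2 P Q q.[l] q.[m] x - spec2 P Q (l `^ s) (m `^ s) x =
    spec2 P Q (q.[l] - l `^ s) (q.[m] - m `^ s) x.
  by rewrite /spec2 !rmorphB !scalerBl opprD addrACA.
have ql : `|q.[l] - l `^ s| <= e.
  by apply: qe; rewrite ge_min le_max lexx.
apply: hnorm_spec2_le => //; first exact: le_trans ql.
by apply: qe; rewrite ge_min le_max lexx !orbT.
Qed.

End Split.
End TwoPointSpectrum.

(** * The operators U and W *)

Section SymmetricBlock.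
Context {R : realType} {K : hilbertType R}.
Implicit Types (al be u v w : R).
Local Open Scope complex_scope.

Lemma conjCR (c : R) : Num.conj c%:C = c%:C.
Proof. exact: conjc_real. Qed.

Lemma rdot_pair (x y : K * K) : rdot x y = rdot x.1 y.1 + rdot x.2 y.2.
Proof. by rewrite /rdot -raddfD. Qed.

Lemma sqr_hnorm_pair (x : K * K) : hnorm x ^+ 2 = hnorm x.1 ^+ 2 + hnorm x.2 ^+ 2.
Proof. by rewrite !sqr_hnorm rdot_pair. Qed.

Lemma hnorm_fst_le (x : K * K) : hnorm x.1 <= hnorm x.
Proof.
by rewrite -(@ler_pXn2r _ 2%N) ?nnegrE ?hnorm_ge0// sqr_hnorm_pair lerDl sqr_ge0.
Qed.

Lemma hnorm_snd_le (x : K * K) : hnorm x.2 <= hnorm x.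
Proof.
by rewrite -(@ler_pXn2r _ 2%N) ?nnegrE ?hnorm_ge0// sqr_hnorm_pair lerDr sqr_ge0.
Qed.

Lemma hnorm_pair_le (x : K * K) : hnorm x <= hnorm x.1 + hnorm x.2.
Proof.
rewrite -(@ler_pXn2r _ 2%N) ?nnegrE ?addr_ge0 ?hnorm_ge0// sqr_hnorm_pair.
by have := hnorm_ge0 x.1; have := hnorm_ge0 x.2; nra.
Qed.

(** The symmetric matrix with rows [u v] and [v w], real scalars acting on [K]. The operator [U],
    its inverse, its spectral projections and [W] all have this form. *)
Definition symop u v w (x : K * K) : K * K :=
  (u%:C *: x.1 + v%:C *: x.2, v%:C *: x.1 + w%:C *: x.2).

Lemma symop_linear u v w : linear (symop u v w).
Proof.
move=> k [x1 x2] [y1 y2]; rewrite /symop /=; congr pair => /=;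
by rewrite !scalerDr !scalerA !(mulrC k) addrACA.
Qed.

Lemma symop_comp u v w u' v' w' x :
  symop u v w (symop u' v' w' x) =
  ((u * u' + v * v')%:C *: x.1 + (u * v' + v * w')%:C *: x.2,
   (v * u' + w * v')%:C *: x.1 + (v * v' + w * w')%:C *: x.2).
Proof.
rewrite /symop /=; congr pair => /=;
by rewrite !scalerDr !scalerA -!rmorphM addrACA -!scalerDl -!rmorphD.
Qed.

Lemma symop_selfadjoint u v w (x y : K * K) :
  dot (symop u v w x) y = dot x (symop u v w y).
Proof.
rewrite /symop /dot /= /sumdot /= !(dotDl, dotDr, dotZl, dotZr) !conjCR.
by rewrite -!addrA; congr (_ + _); rewrite addrCA.
Qed.

Lemma opUE (p a b : R) (z : R * R) : @opU R K p a b z =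
  symop (tdisc z `^ (a / p)) (tdisc z `^ (a / p))
        (tdisc z `^ (a / p) + tdisc z `^ (b / p)).
Proof.
apply/funext => -[x1 x2]; rewrite /opU adjoint_opC /opC /opD /symop /blockop /=.
rewrite /scalar_op !(addr0, add0r) !scalerDr; congr pair.
by rewrite rmorphD scalerDl addrA.
Qed.

(** The matrix with rows [al, al] and [al, al + be] represents [U]. Its trace is [2 al + be] and its
    determinant [al be], whence the discriminant [4 al^2 + be^2]. *)
Definition eigD al be := Num.sqrt (4 * al ^+ 2 + be ^+ 2).
Definition eigmax al be := (2 * al + be + eigD al be) / 2.
Definition eigmin al be := (2 * al + be - eigD al be) / 2.

Section Eigen.
Variables (al be : R).
Hypotheses (al0 : 0 < al) (be0 : 0 < be).

Let r := eigD al be.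
Let l := eigmax al be.
Let m := eigmin al be.

Let rE : r ^+ 2 = 4 * al ^+ 2 + be ^+ 2.
Proof. by rewrite sqr_sqrtr// addr_ge0 ?sqr_ge0// mulr_ge0 ?sqr_ge0. Qed.

Lemma eigD_gt0 : 0 < eigD al be.
Proof. by rewrite sqrtr_gt0 addr_gt0 ?exprn_gt0// mulr_gt0 ?exprn_gt0. Qed.

Lemma eigmaxBmin : eigmax al be - eigmin al be = eigD al be.
Proof. by rewrite /eigmax /eigmin; field. Qed.

Lemma eigmaxDmin : eigmax al be + eigmin al be = 2 * al + be.
Proof. by rewrite /eigmax /eigmin; field. Qed.

Lemma eigmaxMmin : eigmax al be * eigmin al be = al * be.
Proof.
have -> : eigmax al be * eigmin al be = ((2 * al + be) ^+ 2 - r ^+ 2) / 4.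
  by rewrite /eigmax /eigmin /r; field.
by rewrite rE; field.
Qed.

Lemma eigmax_ge : al <= eigmax al be.
Proof.
have := eigD_gt0; rewrite /eigmax ler_pdivlMr//.
by move: be0 al0; nra.
Qed.

Lemma eigmax_gt0 : 0 < eigmax al be.
Proof. exact: lt_le_trans al0 eigmax_ge. Qed.

Lemma eigmin_gt0 : 0 < eigmin al be.
Proof. by rewrite -(pmulr_rgt0 _ eigmax_gt0) eigmaxMmin mulr_gt0. Qed.

(** The product of the eigenvalues is [al * be], so the lower bound [al] on the larger one bounds
    the smaller one from above. *)
Lemma eigmin_le : eigmin al be <= be.
Proof.
by rewrite -(ler_pM2l eigmax_gt0) eigmaxMmin ler_wpM2r ?eigmax_ge// ltW.
Qed.

Lemma eigmin_lt_max : eigmin al be < eigmax al be.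
Proof. by rewrite -subr_gt0 eigmaxBmin eigD_gt0. Qed.

(** For a matrix [A] with eigenvalues [l > m] the spectral projections are [(A - m) / (l - m)] and
    [(l - A) / (l - m)]. Their product vanishes by Cayley-Hamilton, and symmetry turns this into
    orthogonality of the ranges. *)
Lemma symop_spec2 : nonzero_space K -> exists P Q : K * K -> K * K,
  [/\ orth_split P Q,
      symop al al (al + be) = spec2 P Q l m,
      exists x, P x != 0 & exists x, Q x != 0].
Proof.
move=> [k k0].
have lD := eigmaxDmin; have lM := eigmaxMmin; have lB := eigmaxBmin.
have r0 := eigD_gt0; rewrite -/l -/m -/r in lD lM lB r0.
have rn0 : r != 0 by rewrite gt_eqF.
pose P := symop ((al - m) / r) (al / r) ((al + be - m) / r).
pose Q := symop ((l - al) / r) (- al / r) ((l - (al + be)) / r).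
(* Trace and determinant relations with [be] eliminated: every entry of the products [P Q] and [Q P]
   is then 0 identically or a multiple of the characteristic equation [m_l]. *)
have be_l : be = l + m - 2 * al by rewrite lD; ring.
have m_l : l * m = al * (l + m - 2 * al) by rewrite lM lD; ring.
have PQ0 x : P (Q x) = 0.
  rewrite /P /Q symop_comp.
  have -> : (al - m) / r * ((l - al) / r) + al / r * (- al / r) = 0.
    have -> : (al - m) / r * ((l - al) / r) + al / r * (- al / r) =
              (al * (l + m - 2 * al) - l * m) / r ^+ 2 by field.
    by rewrite m_l subrr mul0r.
  have -> : (al - m) / r * (- al / r) + al / r * ((l - (al + be)) / r) = 0.
    by rewrite be_l; field.
  have -> : al / r * ((l - al) / r) + (al + be - m) / r * (- al / r) = 0.
    by rewrite be_l; field.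
  have -> : al / r * (- al / r) + (al + be - m) / r * ((l - (al + be)) / r) = 0.
    have -> : al / r * (- al / r) + (al + be - m) / r * ((l - (al + be)) / r) =
              (al * (l + m - 2 * al) - l * m) / r ^+ 2.
      by rewrite be_l; field.
    by rewrite m_l subrr mul0r.
  by rewrite !scale0r !addr0.
have QP0 x : Q (P x) = 0.
  rewrite /P /Q symop_comp.
  have -> : (l - al) / r * ((al - m) / r) + - al / r * (al / r) = 0.
    have -> : (l - al) / r * ((al - m) / r) + - al / r * (al / r) =
              (al * (l + m - 2 * al) - l * m) / r ^+ 2 by field.
    by rewrite m_l subrr mul0r.
  have -> : (l - al) / r * (al / r) + - al / r * ((al + be - m) / r) = 0.
    by rewrite be_l; field.
  have -> : - al / r * ((al - m) / r) + (l - (al + be)) / r * (al / r) = 0.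
    by rewrite be_l; field.
  have -> : - al / r * (al / r) + (l - (al + be)) / r * ((al + be - m) / r) = 0.
    have -> : - al / r * (al / r) + (l - (al + be)) / r * ((al + be - m) / r) =
              (al * (l + m - 2 * al) - l * m) / r ^+ 2.
      by rewrite be_l; field.
    by rewrite m_l subrr mul0r.
  by rewrite !scale0r !addr0.
exists P, Q; split.
- split => //.
  + exact: symop_linear.
  + exact: symop_linear.
  + move=> [x1 x2]; rewrite /P /Q /symop /=; congr pair => /=;
      rewrite addrACA -!scalerDl -!rmorphD.
      have -> : (al - m) / r + (l - al) / r = 1 by rewrite -lB; field; rewrite lB.
      by rewrite mulNr subrr scale1r scale0r addr0.
    have -> : (al + be - m) / r + (l - (al + be)) / r = 1.
      by rewrite -lB; field; rewrite lB.
    by rewrite mulNr subrr scale1r scale0r add0r.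
  + by move=> x y; rewrite symop_selfadjoint -/P PQ0 /dot linear0r.
- apply/funext => -[x1 x2]; rewrite /spec2 /P /Q /symop /=; congr pair => /=;
  rewrite !scalerDr !scalerA addrACA -!scalerDl -!rmorphM -!rmorphD.
    congr (_%:C *: _ + _%:C *: _); rewrite -lB in rn0 *; last by field.
    have -> : l * ((al - m) / (l - m)) + m * ((l - al) / (l - m)) = al by field.
    by [].
  congr (_%:C *: _ + _%:C *: _); rewrite -lB in rn0 *; first by field.
  have -> : l * ((al + be - m) / (l - m)) + m * ((l - (al + be)) / (l - m)) = al + be.
    by field.
  by [].
(* The off-diagonal entry [al / r] is nonzero, so the first component of the image of [(0, k)] does
   not vanish; likewise for [Q]. *)
- exists (0, k); apply/eqP => -[+ _]; rewrite scaler0 add0r => /eqP.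
  by rewrite scaler_eq0 (negbTE k0) orbF eq_complex/= eqxx andbT mulf_eq0
    invr_eq0 (negbTE rn0) gt_eqF.
- exists (0, k); apply/eqP => -[+ _]; rewrite scaler0 add0r => /eqP.
  by rewrite scaler_eq0 (negbTE k0) orbF eq_complex/= eqxx andbT mulf_eq0
    invr_eq0 (negbTE rn0) oppr_eq0 gt_eqF.
Qed.

End Eigen.
End SymmetricBlock.

Section SymopCommute.
Context {R : realType} {K : hilbertType R}.
Local Open Scope complex_scope.

(** The multiples of the identity drop out of the commutator, whose upper right entry is
    [y y' (al be' - al' be)]. It is read off on a vector [(0, k)]. *)
Lemma symop_commute (y c al be y' c' al' be' : R) : nonzero_space K ->
  y != 0 -> y' != 0 -> forall W W' : K * K -> K * K,
  W = symop (y * al + c) (y * al) (y * (al + be) + c) ->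
  W' = symop (y' * al' + c') (y' * al') (y' * (al' + be') + c') ->
  W \o W' = W' \o W -> al / be = al' / be' \/ be = 0 \/ be' = 0.
Proof.
move=> [k k0] y0 y'0 W W' -> -> /(congr1 (@^~ (0, k))).
rewrite /comp !symop_comp => -[+ _].
rewrite /= !scaler0 !add0r => /eqP.
rewrite -subr_eq0 -scalerBl scaler_eq0 (negbTE k0) orbF -rmorphB.
rewrite eq_complex/= eqxx andbT.
set u := (X in X == 0).
have -> : u = y * y' * (al * be' - al' * be) by rewrite /u; ring.
rewrite mulf_eq0 mulf_eq0 (negbTE y0) (negbTE y'0)/= subr_eq0.
have [->|be0] := eqVneq be 0; first by right; left.
have [->|be'0] := eqVneq be' 0; first by right; right.
by rewrite -eqr_div// => /eqP; left.
Qed.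

End SymopCommute.

Section Weight.
Context {R : realType} {K : hilbertType R}.
Variables (p a b : R).
Hypotheses (p1 : 1 < p) (K0 : nonzero_space K).
Implicit Types z : R * R.
Local Open Scope complex_scope.

Let p0 : 0 < p. Proof. exact: lt_trans p1. Qed.

Definition wal z := tdisc z `^ (a / p).
Definition wbe z := tdisc z `^ (b / p).

Lemma tdisc_gt0 z : disc z -> 0 < tdisc z.
Proof. by move=> z1; rewrite /tdisc subr_gt0 expr_lt1// sqrtr_ge0. Qed.

Lemma tdisc_le1 z : tdisc z <= 1.
Proof. by rewrite /tdisc gerBl sqr_ge0. Qed.

Lemma tdisc_cabs_inj z1 z2 : tdisc z1 = tdisc z2 -> cabs z1 = cabs z2.
Proof.
have inj (u v : R) : 0 <= u -> 0 <= v -> 1 - u ^+ 2 = 1 - v ^+ 2 -> u = v.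
  by move=> u0 v0 /addrI /oppr_inj /eqP; rewrite eqrXn2// => /eqP.
exact: inj (sqrtr_ge0 _) (sqrtr_ge0 _).
Qed.

Lemma wal_gt0 z : disc z -> 0 < wal z.
Proof. by move=> zD; rewrite powR_gt0// tdisc_gt0. Qed.

Lemma wbe_gt0 z : disc z -> 0 < wbe z.
Proof. by move=> zD; rewrite powR_gt0// tdisc_gt0. Qed.

Lemma wal_div_wbe z : disc z -> wal z / wbe z = (tdisc z `^ ((b - a) / p))^-1.
Proof.
move=> /tdisc_gt0 t0; rewrite /wal /wbe -powRB; last by rewrite (gt_eqF t0) implybT.
by rewrite -powRN; congr powR; rewrite -mulrBl -mulNr opprB.
Qed.

Definition wl z := eigmax (wal z) (wbe z).
Definition wm z := eigmin (wal z) (wbe z).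
(** [wslope] and [wcst] are the slope and intercept of the chord of [u ^ p] through the two
    eigenvalues of [U z]; on this two-point spectrum the chord agrees with the power. *)
Definition wslope z := (wl z `^ p - wm z `^ p) / (wl z - wm z).
Definition wcst z := wl z `^ p - wslope z * wl z.

(** The product of the inverses of [C], [D] and the adjoint of [C], multiplied out. *)
Definition opUinv z : K * K -> K * K :=
  symop ((wal z)^-1 + (wbe z)^-1) (- (wbe z)^-1) (wbe z)^-1.

Section InDisc.
Variable z : R * R.
Hypothesis zD : disc z.

Let al0 := wal_gt0 zD.
Let be0 := wbe_gt0 zD.
Let l0 : 0 < wl z := eigmax_gt0 al0 be0.
Let m0 : 0 < wm z := eigmin_gt0 al0 be0.
Let ml : wm z < wl z := eigmin_lt_max al0 be0.

Lemma opUVK : cancel (opUinv z) (opU p a b z).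
Proof.
move=> [x1 x2]; rewrite opUE /opUinv symop_comp -/(wal z) -/(wbe z) /=.
have a0 : wal z != 0 by rewrite gt_eqF.
have b0 : wbe z != 0 by rewrite gt_eqF.
congr pair.
  transitivity (1%:C *: x1 + 0%:C *: x2); last by rewrite scale1r scale0r addr0.
  by congr (_%:C *: _ + _%:C *: _); field; rewrite ?a0 ?b0.
transitivity (0%:C *: x1 + 1%:C *: x2); last by rewrite scale1r scale0r add0r.
by congr (_%:C *: _ + _%:C *: _); field; rewrite ?a0 ?b0.
Qed.

Lemma opU_spec2 : exists P Q : K * K -> K * K,
  [/\ orth_split P Q, opU p a b z = spec2 P Q (wl z) (wm z),
      exists x, P x != 0 & exists x, Q x != 0].
Proof. by rewrite opUE; exact: symop_spec2. Qed.

Lemma opW_root : opow (@opW R K p a b z) p^-1 = opU p a b z.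
Proof.
have [P [Q [PQ UE _ _]]] := opU_spec2.
have powK (c : R) : 0 < c -> (c `^ p) `^ p^-1 = c.
  by move=> c0; rewrite -powRrM mulfV ?gt_eqF// powRr1 ?ltW.
by rewrite /opW UE !opow_spec2 ?powR_gt0// !powK.
Qed.

Lemma opW_root_inv : opow (@opW R K p a b z) (- p^-1) = opUinv z.
Proof.
have [P [Q [PQ UE _ _]]] := opU_spec2.
have powK (c : R) : 0 < c -> (c `^ p) `^ (- p^-1) = c^-1.
  move=> c0; rewrite -powRrM mulrN mulfV ?gt_eqF//.
  by rewrite powR_inv1 ?ltW.
rewrite /opW UE !opow_spec2 ?powR_gt0// !powK//.
(* With [x = U (opUinv x)], the operator with inverted eigenvalues cancels [U]. *)
apply/funext => x; rewrite -{1}[x]opUVK UE spec2_comp// !mulVf ?gt_eqF//.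
exact: spec2_id.
Qed.

Lemma opW_regular : [/\ bounded_op (@opW R K p a b z),
  positive_op (@opW R K p a b z) & boundedly_invertible (@opW R K p a b z)].
Proof.
have [P [Q [PQ UE _ _]]] := opU_spec2.
rewrite /opW UE opow_spec2//; split.
- exact: spec2_bounded.
- by apply: spec2_positive => //; exact: powR_ge0.
- by apply: spec2_boundedly_invertible => //; rewrite gt_eqF// powR_gt0.
Qed.

Lemma opW_symop : @opW R K p a b z =
  symop (wslope z * wal z + wcst z) (wslope z * wal z)
        (wslope z * (wal z + wbe z) + wcst z).
Proof.
have [P [Q [PQ UE _ _]]] := opU_spec2.
rewrite /opW UE opow_spec2//; apply/funext => x.
have -> : spec2 P Q (wl z `^ p) (wm z `^ p) x =
    (wslope z)%:C *: opU p a b z x + (wcst z)%:C *: x.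
  have -> : (wcst z)%:C *: x = (wcst z)%:C *: P x + (wcst z)%:C *: Q x.
    by rewrite -scalerDr (splitD PQ).
  rewrite UE /spec2 scalerDr !scalerA addrACA -!scalerDl.
  rewrite -!rmorphM -!rmorphD; congr (_%:C *: _ + _%:C *: _).
    by rewrite /wcst addrC subrK.
  have : wslope z * (wl z - wm z) = wl z `^ p - wm z `^ p.
    by rewrite divfK// subr_eq0 gt_eqF.
  by rewrite /wcst; lra.
case: x => x1 x2; rewrite opUE /symop /= -/(wal z) -/(wbe z).
move: (wslope z) (wcst z) => y c.
congr pair; rewrite !(scalerDl, scalerDr, scalerA, rmorphD, rmorphM)/=.
  by rewrite scalerDr !scalerA addrAC.
by rewrite mulrDr scalerDl !scalerDr !scalerA !addrA.
Qed.

Lemma wslope_gt0 : 0 < wslope z.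
Proof.
rewrite divr_gt0 ?subr_gt0// gt0_ltr_powR// nnegrE ltW//.
Qed.

(** The value [w] is eliminated through the extreme eigenvalues [l], [m] of [U z]: [c t^a <= c l^p
    <= c C0 w <= C0 m^p <= C0 t^b]. *)
Lemma scalar_comparable_at (c C0 w : R) : 0 < c -> 0 < C0 ->
  op_le (scalar_op (c * w)) (@opW R K p a b z) ->
  op_le (@opW R K p a b z) (scalar_op (C0 * w)) ->
  c * tdisc z `^ a <= C0 * tdisc z `^ b.
Proof.
move=> c0 C00; have [P [Q [PQ UE P0 Q0]]] := opU_spec2.
rewrite /opW UE opow_spec2// !(scalar_spec2 PQ) => cw wC.
have [_ cwm] := op_le_spec2_inv PQ cw P0 Q0.
have [lwC _] := op_le_spec2_inv PQ wC P0 Q0.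
have alE : tdisc z `^ a = wal z `^ p by rewrite -powRrM divfK ?gt_eqF.
have beE : tdisc z `^ b = wbe z `^ p by rewrite -powRrM divfK ?gt_eqF.
have all : wal z `^ p <= wl z `^ p.
  apply: ge0_ler_powR; rewrite ?nnegrE; do ?exact: ltW.
  exact: eigmax_ge.
have mbe : wm z `^ p <= wbe z `^ p.
  apply: ge0_ler_powR; rewrite ?nnegrE; do ?exact: ltW.
  exact: eigmin_le.
rewrite alE beE; apply: (@le_trans _ _ (c * (C0 * w))).
  by rewrite ler_pM2l// (le_trans all).
by rewrite mulrCA ler_pM2l// (le_trans cwm).
Qed.

End InDisc.

Lemma opW_noncommuting z1 z2 : a < b -> disc z1 -> disc z2 -> cabs z1 <> cabs z2 ->
  @opW R K p a b z1 \o opW p a b z2 <> opW p a b z2 \o opW p a b z1.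
Proof.
move=> ab D1 D2 z12 W12; apply: z12.
have y10 : wslope z1 != 0 by rewrite gt_eqF ?wslope_gt0.
have y20 : wslope z2 != 0 by rewrite gt_eqF ?wslope_gt0.
have := symop_commute K0 y10 y20 (opW_symop D1) (opW_symop D2) W12.
case=> [|[be0|be0]]; last 2 first.
- by have := wbe_gt0 D1; rewrite be0 ltxx.
- by have := wbe_gt0 D2; rewrite be0 ltxx.
rewrite (wal_div_wbe D1) (wal_div_wbe D2) => /invr_inj /powR_injective.
have ba : 0 < (b - a) / p by rewrite divr_gt0 ?subr_gt0.
move=> /(_ ba) inj; have := inj (ltW (tdisc_gt0 D1)) (ltW (tdisc_gt0 D2)).
exact: tdisc_cabs_inj.
Qed.

End Weight.

(** * Bochner integration *)

Section FiniteSimple.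
Context d (T : measurableType d).

(** The condition of [simple_fun] for values in any type. Sums, products and truncations of simple
    functions become a map composed with a tuple of simple functions, some of them boolean or
    scalar. *)
Definition finite_simple (V : Type) (s : T -> V) : Prop :=
  finite_set (range s) /\ forall y, measurable (s @^-1` [set y]).

Lemma finite_simple_preimage (V : Type) (s : T -> V) (A : set V) :
  finite_simple s -> measurable (s @^-1` A).
Proof.
move=> [fs ms]; have -> : s @^-1` A = \bigcup_(y in range s `&` A) s @^-1` [set y].
  apply/seteqP; split => [x Asx|x [y [_ Ay] /= sxy]]; last by rewrite /preimage/= sxy.
  by exists (s x) => //; split => //; exists x.
by apply: fin_bigcup_measurable => //; exact: finite_setIl.
Qed.

Lemma finite_simple_comp (V V' : Type) (g : V -> V') (s : T -> V) :
  finite_simple s -> finite_simple (g \o s).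
Proof.
move=> ss; split; last first.
  by move=> y; rewrite comp_preimage; exact: finite_simple_preimage.
by rewrite -(image_comp s g); apply: finite_image; exact: ss.1.
Qed.

Lemma finite_simple_pair (V V' : Type) (s : T -> V) (t : T -> V') :
  finite_simple s -> finite_simple t -> finite_simple (fun x => (s x, t x)).
Proof.
move=> [fs ms] [ft mt]; split.
  apply: (@sub_finite_set _ _ (range s `*` range t)).
    by move=> _ [x _ <-]; split => /=; exists x.
  exact: finite_setX.
move=> [u v]; have -> : (fun x => (s x, t x)) @^-1` [set (u, v)] =
    s @^-1` [set u] `&` t @^-1` [set v].
  by apply/seteqP; split => x /= [-> ->].
exact: measurableI.
Qed.

Lemma finite_simple_cst (V : Type) (v : V) : finite_simple (fun _ : T => v).
Proof.
split; first by apply: (@sub_finite_set _ _ [set v]) => // _ [x _ <-].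
move=> y; have [->|vy] := pselect (v = y).
  rewrite (_ : _ @^-1` _ = setT) //.
  by apply/seteqP; split.
rewrite (_ : _ @^-1` _ = set0) //.
by apply/seteqP; split.
Qed.

Lemma finite_simple_in (A : set T) : measurable A ->
  finite_simple (fun x => x \in A).
Proof.
move=> mA; split.
  by apply: (@sub_finite_set _ _ [set true; false]) => // _ [x _ <-]; case: (_ \in _); [left|right].
move=> [|].
  rewrite (_ : _ @^-1` _ = A)//; apply/seteqP; split => x /=; [exact: set_mem|exact: mem_set].
rewrite (_ : _ @^-1` _ = ~` A); first exact: measurableC.
apply/seteqP; split => x /=; last exact: memNset.
by move=> xA /mem_set; rewrite xA.
Qed.

Lemma finite_simple_measurable d' (V : measurableType d') (s : T -> V) :
  finite_simple s -> measurable_fun setT s.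
Proof.
by move=> ss _ Y mY; rewrite setTI; exact: finite_simple_preimage.
Qed.

End FiniteSimple.

(** * Integrals of finitely valued functions *)

Section SimpleIntegral.
Context {R : realType} d (T : measurableType d) (mu : {measure set T -> \bar R}).
Hypothesis mufin : (mu setT < +oo)%E.

Lemma finite_mass (A : set T) : measurable A -> mu A \is a fin_num.
Proof.
move=> mA; rewrite ge0_fin_numE// (le_lt_trans _ mufin)//.
by apply: le_measure; [exact: mem_set|exact: mem_set|exact: subsetT].
Qed.

Lemma finite_integrable_indic (A : set T) : measurable A ->
  mu.-integrable setT (fun x => (\1_A x)%:E).
Proof.
move=> mA; apply/integrableP; split; first exact/measurable_EFinP.
under eq_integral do rewrite gee0_abs ?lee_fin//.
by rewrite integral_indic// setIT ltey_eq finite_mass.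
Qed.

(** [G \o s] is a finite combination of indicators of level sets, each integrable because the mass
    is finite; hence [G] is arbitrary, of any sign. *)
Lemma integral_finite_simple (V : choiceType) (s : T -> V) (G : V -> R) :
  finite_simple s ->
  (\int[mu]_x (G (s x))%:E =
   (\sum_(y \in range s) fine (mu (s @^-1` [set y])) * G y)%:E)%E.
Proof.
move=> [fs ms].
have GE x : (G (s x))%:E =
    (\sum_(y <- fset_set (range s)) (G y)%:E * (\1_(s @^-1` [set y]) x)%:E)%E.
  rewrite (bigD1_seq (s x)) ?fset_uniq//=; last first.
    by rewrite in_fset_set// inE; exists x.
  rewrite indicE mem_set// mule1 big1 ?adde0// => y ysx.
  by rewrite indicE memNset ?mule0// => /= sxy; move: ysx; rewrite sxy eqxx.
under eq_integral do rewrite GE.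
rewrite integral_sum//; last first.
  move=> y; apply: integrableZl => //.
  exact: finite_integrable_indic.
rewrite fsbig_finite//= (big_morph _ (@EFinD R) (erefl _)).
apply: eq_bigr => y _.
rewrite integralZl//; last exact: finite_integrable_indic.
by rewrite integral_indic// setIT EFinM fineK ?finite_mass// muleC.
Qed.

End SimpleIntegral.

(** * Comparison of lower integrals *)

Section LowerIntegral.
Local Open Scope ereal_scope.
Context d (T : measurableType d) (R : realType) (mu : {measure set T -> \bar R}).
Import HBNNSimple.

(* The integral of a nonnegative function is the supremum of the integrals of
   the simple functions below it, so no measurability is needed. *)
Lemma ae_le_lower_integral (f g : T -> \bar R) :
  (forall x, 0 <= f x) -> (forall x, 0 <= g x) ->
  {ae mu, forall x, f x <= g x} -> \int[mu]_x f x <= \int[mu]_x g x.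
Proof.
move=> f0 g0 [N [mN N0 Nfg]]; rewrite !ge0_integralTE//.
apply: ge_ereal_sup => _ [h /= hf <-].
(* Cutting [h] off on the null set puts it below [g] everywhere and leaves its integral
   unchanged. *)
pose h' := proj_nnsfun h (measurableC mN).
have h'E x : h' x = (h x * \1_(~` N) x)%R by [].
apply: (@le_trans _ _ (sintegral mu h')); last first.
  apply: ereal_sup_ubound; exists h' => //= x.
  rewrite mindicE; have [xN|] := boolP (x \in ~` N); last by rewrite mulr0.
  rewrite mulr1 (le_trans (hf x))//; apply: contrapT => fg.
  by move: (set_mem xN); apply; exact: Nfg.
have intE (k : {nnsfun T >-> R}) : sintegral mu k = \int[mu]_x (k x)%:E.
  by rewrite integral_nnsfun// patch_setT.
rewrite !intE le_eqVlt; apply/orP; left; apply/eqP.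
apply: ge0_ae_eq_integral => //.
- exact/measurable_EFinP.
- exact/measurable_EFinP.
- by move=> x _; rewrite lee_fin.
- by move=> x _; rewrite lee_fin.
exists N; split => // x /= hh'; apply: contrapT => Nx; apply: hh' => _.
by rewrite mindicE mem_set// mulr1.
Qed.

Lemma ae_eq_lower_integral (f g : T -> \bar R) :
  (forall x, 0 <= f x) -> (forall x, 0 <= g x) ->
  {ae mu, forall x, f x = g x} -> \int[mu]_x f x = \int[mu]_x g x.
Proof.
move=> f0 g0 fg; apply/eqP; rewrite eq_le !ae_le_lower_integral//.
  by apply: filterS fg => x ->.
by apply: filterS fg => x ->.
Qed.

End LowerIntegral.

(** * Strong measurability *)

Section StronglyMeasurable.
Context {R : realType} {H : hilbertType R} d (T : measurableType d).
Implicit Types (f g : T -> H) (N : H -> R).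

(** Convergence at every point, with no reference to a measure: norms of such functions are
    measurable even if the measure is not complete. *)
Definition smeas f : Prop := exists s : nat -> T -> H,
  (forall n, simple_fun (s n)) /\
  forall x, hnorm (s n x - f x) @[n --> \oo] --> (0 : R).

Lemma simple_smeas f : simple_fun f -> smeas f.
Proof.
move=> sf; exists (fun=> f); split => // x.
under eq_fun do rewrite subrr hnorm0.
exact: cvg_cst.
Qed.

(** The function and its approximations are set to 0 on a measurable null set containing all points
    of divergence. *)
Lemma smeas_ae (mu : {measure set T -> \bar R}) f : strongly_measurable mu f ->
  exists2 g, smeas g & {ae mu, forall x, f x = g x}.
Proof.
move=> [s [ss [N [mN N0 Nsf]]]].
exists (fun x => if x \in N then 0 else f x).
  exists (fun n x => if x \in N then 0 else s n x); split => [n|x].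
    apply: (finite_simple_comp (fun u : bool * H => if u.1 then 0 else u.2)
              (s := fun x => (x \in N, s n x))).
    exact: finite_simple_pair (finite_simple_in mN) (ss n).
  have [xN|xN] := boolP (x \in N).
    by under eq_fun do rewrite subrr hnorm0; exact: cvg_cst.
  apply: contrapT => sf; move/negP: xN; apply; apply/mem_set; apply: Nsf.
  exact: sf.
exists N; split => // x /=.
by have [/set_mem //|xN fx] := boolP (x \in N).
Qed.

Lemma smeas_strong (mu : {measure set T -> \bar R}) f g : smeas g ->
  {ae mu, forall x, f x = g x} -> strongly_measurable mu f.
Proof.
move=> [s [ss sg]] fg; exists s; split => //.
by apply: filterS fg => x ->.
Qed.

(* A function with this property is Lipschitz, which makes [N \o f] measurable. *)
Definition dominated N (M : R) : Prop := forall x y, `|N x - N y| <= M * hnorm (x - y).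

Lemma dominated_hnorm : dominated (@hnorm R H) 1.
Proof. by move=> x y; rewrite mul1r; exact: ler_dist_hnorm. Qed.

Lemma dominated_cvg N M (u : nat -> H) l : dominated N M ->
  hnorm (u n - l) @[n --> \oo] --> (0 : R) -> N (u n) @[n --> \oo] --> N l.
Proof.
move=> NM ul; apply/cvgrPdist_le => e e0.
have M0 : 0 < `|M| + 1 by rewrite ltr_wpDl.
have /cvgrPdist_le /(_ (e / (`|M| + 1))) := ul; rewrite divr_gt0// => /(_ isT).
apply: filterS => n; rewrite sub0r normrN ger0_norm ?hnorm_ge0// => ue.
rewrite distrC (le_trans (NM _ _))//.
rewrite (@le_trans _ _ ((`|M| + 1) * hnorm (u n - l)))//.
  rewrite ler_wpM2r ?hnorm_ge0//.
  by rewrite (le_trans (ler_norm _))// lerDl.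
by rewrite mulrC -ler_pdivlMr.
Qed.

Lemma smeas_dominated f N M : dominated N M -> smeas f ->
  measurable_fun setT (fun x => N (f x)).
Proof.
move=> NM [s [ss sf]].
apply: (measurable_fun_cvg (h := fun n x => N (s n x))) => [n|x _].
  by apply: finite_simple_measurable; exact: (finite_simple_comp N (ss n)).
exact: dominated_cvg NM (sf x).
Qed.

Lemma smeas_hnorm f : smeas f -> measurable_fun setT (fun x => hnorm (f x)).
Proof. exact: smeas_dominated dominated_hnorm. Qed.

Lemma smeasD f g : smeas f -> smeas g -> smeas (fun x => f x + g x).
Proof.
move=> [s [ss sf]] [t [tt tg]]; exists (fun n x => s n x + t n x); split => [n|x].
  apply: (finite_simple_comp (fun u : H * H => u.1 + u.2)
    (s := fun x => (s n x, t n x))).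
  exact: finite_simple_pair (ss n) (tt n).
apply: (@squeeze_cvgr _ _ _ _ (fun=> 0)
  (fun n => hnorm (s n x - f x) + hnorm (t n x - g x))).
- apply: nearW => n; rewrite hnorm_ge0/=.
  by rewrite opprD addrACA ler_hnormD.
- exact: cvg_cst.
- by rewrite -[X in _ --> X]addr0; exact: cvgD.
Qed.

End StronglyMeasurable.

Section SmeasMap.
Context {R : realType} {H H' : hilbertType R} d (T : measurableType d).

Lemma smeas_map (f : T -> H) (L : H -> H') (M : R) : linear L ->
  (forall x, hnorm (L x) <= M * hnorm x) -> smeas f -> smeas (L \o f).
Proof.
move=> linL LM [s [ss sf]]; exists (fun n => L \o s n); split => [n|x].
  exact: (finite_simple_comp L (ss n)).
apply: (@squeeze_cvgr _ _ _ _ (fun=> 0) (fun n => M * hnorm (s n x - f x))).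
- apply: nearW => n; rewrite hnorm_ge0/=.
  have -> : L (s n x) - L (f x) = L (s n x - f x).
    by rewrite (linB linL).
  exact: LM.
- exact: cvg_cst.
- by rewrite -[X in _ --> X](mulr0 M); exact: cvgMr.
Qed.

End SmeasMap.

Section SmeasScale.
Context {R : realType} {H : hilbertType R} d (T : measurableType d).
Local Open Scope complex_scope.
Import HBNNSimple.

Lemma measurable_finite_simple_cvg (k : T -> R) : measurable_fun setT k ->
  exists s : nat -> T -> R, (forall n, finite_simple (s n)) /\
    forall x, s n x @[n --> \oo] --> k x.
Proof.
move=> mk.
have mkp : measurable_fun setT (fun x => (Num.max (k x) 0)%:E).
  by apply/measurable_EFinP; exact: measurable_maxr.
have mkm : measurable_fun setT (fun x => (Num.max (- k x) 0)%:E).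
  apply/measurable_EFinP; apply: measurable_maxr => //.
  exact: measurable_funN.
pose u := nnsfun_approx measurableT mkp.
pose v := nnsfun_approx measurableT mkm.
exists (fun n x => u n x - v n x); split.
  move=> n; apply: (finite_simple_comp (fun w : R * R => w.1 - w.2)
    (s := fun x => (u n x, v n x))).
  by apply: finite_simple_pair; split; [exact: fimfunP|move=> y; exact: measurable_sfunP|exact: fimfunP|move=> y; exact: measurable_sfunP].
move=> x; have -> : k x = Num.max (k x) 0 - Num.max (- k x) 0.
  by rewrite /Num.max; case: ltP => ?; case: ltP => ?; lra.
have p0 y : setT y -> (0 <= (Num.max (k y) 0)%:E)%E by rewrite lee_fin le_max lexx orbT.
have m0 y : setT y -> (0 <= (Num.max (- k y) 0)%:E)%E by rewrite lee_fin le_max lexx orbT.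
apply: cvgB.
  exact: (fine_cvg (cvg_nnsfun_approx measurableT mkp p0 I)).
exact: (fine_cvg (cvg_nnsfun_approx measurableT mkm m0 I)).
Qed.

Lemma normc_le_ReIm (k : R[i]) :
  ComplexField.Normc.normc k <= `|complex.Re k| + `|complex.Im k|.
Proof.
case: k => u v /=; rewrite -(@ler_pXn2r _ 2%N) ?nnegrE ?addr_ge0 ?sqrtr_ge0//.
rewrite sqr_sqrtr ?addr_ge0 ?sqr_ge0// sqrrD !real_normK ?num_real//.
by rewrite lerD2r lerDl mulrn_wge0// mulr_ge0.
Qed.

Lemma smeasZ (k : T -> R[i]) (f : T -> H) :
  measurable_fun setT (fun x => complex.Re (k x)) ->
  measurable_fun setT (fun x => complex.Im (k x)) ->
  smeas f -> smeas (fun x => k x *: f x).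
Proof.
move=> /measurable_finite_simple_cvg[u [uu uk]].
move=> /measurable_finite_simple_cvg[v [vv vk]] [s [ss sf]].
exists (fun n x => (u n x +i* v n x) *: s n x); split => [n|x].
  apply: (finite_simple_comp (fun w : R * R * H => (w.1.1 +i* w.1.2) *: w.2)
    (s := fun x => (u n x, v n x, s n x))).
  exact: finite_simple_pair (finite_simple_pair (uu n) (vv n)) (ss n).
apply: (@squeeze_cvgr _ _ _ _ (fun=> 0) (fun n =>
  (`|u n x - complex.Re (k x)| + `|v n x - complex.Im (k x)|) * hnorm (s n x) +
  ComplexField.Normc.normc (k x) * hnorm (s n x - f x))).
- apply: nearW => n; rewrite hnorm_ge0/=.
  have -> : (u n x +i* v n x) *: s n x - k x *: f x =
    ((u n x +i* v n x) - k x) *: s n x + k x *: (s n x - f x).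
    by rewrite scalerBl scalerBr addrA subrK.
  rewrite (le_trans (ler_hnormD _ _))// !hnormZ lerD2r ler_wpM2r ?hnorm_ge0//.
  by rewrite (le_trans (normc_le_ReIm _))//; case: (k x).
- exact: cvg_cst.
have sub0 (w : nat -> R) (l : R) : w n @[n --> \oo] --> l ->
    `|w n - l| @[n --> \oo] --> (0 : R).
  move=> wl; rewrite -(normr0 R) -(subrr l).
  by apply: cvg_norm; apply: cvgB => //; exact: cvg_cst.
have sx : hnorm (s n x) @[n --> \oo] --> hnorm (f x).
  exact: dominated_cvg (@dominated_hnorm R H) (sf x).
have -> : 0 = (0 + 0) * hnorm (f x) + ComplexField.Normc.normc (k x) * 0 :> R.
  by rewrite addr0 mul0r mulr0 addr0.
apply: cvgD; last by apply: cvgMr; exact: sf.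
by apply: cvgM => //; apply: cvgD; exact: sub0.
Qed.

End SmeasScale.

(** * Integrals of simple functions *)

Section BochnerTheory.
Context {R : realType} {H : hilbertType R} d (T : measurableType d).
Variable mu : {measure set T -> \bar R}.
Hypothesis mufin : (mu setT < +oo)%E.
Implicit Types (f g s t : T -> H) (I J : H).
Local Open Scope complex_scope.

Lemma finite_simple_integrable (V : choiceType) (s : T -> V) (G : V -> R) :
  finite_simple s -> mu.-integrable setT (fun x => (G (s x))%:E).
Proof.
move=> ss; apply/integrableP; split.
  apply/measurable_EFinP; apply: finite_simple_measurable.
  exact: (finite_simple_comp G ss).
under eq_integral do rewrite abse_EFin.
by rewrite (integral_finite_simple mufin (fun v => `|G v|) ss) ltry.
Qed.

Lemma simple_fun_integrable s : simple_fun s -> simple_integrable mu s.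
Proof.
move=> ss; split => // y _; rewrite ltey_eq finite_mass//.
exact: ss.2.
Qed.

Lemma rdot_simple_integral s v : simple_fun s ->
  ((rdot (simple_integral mu s) v)%:E = \int[mu]_x (rdot (s x) v)%:E)%E.
Proof.
move=> ss; rewrite (@integral_finite_simple _ _ _ _ mufin _ s (rdot^~ v) ss).
congr EFin; rewrite /simple_integral !fsbig_finite//=; [|exact: ss.1|exact: ss.1].
elim/big_ind2: _ => //; first by rewrite /rdot /dot linear0l.
  by move=> a b c e <- <-; rewrite rdotDl.
by move=> y _; rewrite rdotZl.
Qed.

Lemma rdot_inj (x y : H) : (forall v, rdot x v = rdot y v) -> x = y.
Proof.
move=> xy; apply/eqP; rewrite -subr_eq0 -rdot_eq0 rdotDl rdotNl xy.
by rewrite addrN.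
Qed.

Lemma rdotZlr (k : R[i]) (x v : H) : rdot (k *: x) v = rdot x (Num.conj k *: v).
Proof. by rewrite /rdot dotZl dotZr conjCK. Qed.

(** No common refinement of level sets is formed: paired with any [v], both sides become real
    integrals, where additivity is known. The complex scalar moves to [v] as its conjugate. *)
Lemma simple_integral_linear (k : R[i]) s t : simple_fun s -> simple_fun t ->
  simple_integral mu (fun x => k *: s x + t x) =
  k *: simple_integral mu s + simple_integral mu t.
Proof.
move=> ss st; apply: rdot_inj => v; apply: EFin_inj.
have sst : simple_fun (fun x => k *: s x + t x).
  apply: (finite_simple_comp (fun u : H * H => k *: u.1 + u.2)
    (s := fun x => (s x, t x))).
  exact: finite_simple_pair.
rewrite rdot_simple_integral// rdotDl rdotZlr EFinD !rdot_simple_integral//.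
rewrite -integralD//; last 2 first.
- exact: (finite_simple_integrable (rdot^~ _)).
- exact: (finite_simple_integrable (rdot^~ _)).
by apply: eq_integral => x _; rewrite rdotDl rdotZlr EFinD.
Qed.

(** What the inequality between [N] of an integral and the integral of [N] uses; it is applied to
    the norm and to two seminorms on [K * K]. *)
Definition sublinear (N : H -> R) : Prop :=
  (forall x y, N (x + y) <= N x + N y) /\
  (forall (c : R) x, 0 <= c -> N (c%:C *: x) <= c * N x).

Lemma sublinear_hnorm : sublinear (@hnorm R H).
Proof.
split; first exact: ler_hnormD.
by move=> c x c0; rewrite hnormZr ger0_norm.
Qed.

Lemma sublinear_simple_integral N s : sublinear N -> simple_fun s ->
  ((N (simple_integral mu s))%:E <= \int[mu]_x (N (s x))%:E)%E.
Proof.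
move=> [ND NZ] ss; rewrite (@integral_finite_simple _ _ _ _ mufin _ s N ss) lee_fin.
rewrite /simple_integral !fsbig_finite//=; [|exact: ss.1|exact: ss.1].
have N0 : N 0 <= 0 by have := NZ 0 0 (lexx _); rewrite scaler0 mul0r.
elim/big_ind2: _ => //.
  by move=> a b c e ab ce; rewrite (le_trans (ND _ _))// lerD.
by move=> y _; apply: NZ; exact: fine_ge0.
Qed.

Lemma cvge0_lt (u : nat -> \bar R) (e : R) : 0 < e ->
  u n @[n --> \oo] --> 0%E -> \forall n \near \oo, (u n < e%:E)%E.
Proof.
move=> e0 /fine_cvgP[ufin /cvgrPdist_lt /(_ _ e0)].
apply: filterS2 ufin => n un; rewrite /= sub0r normrN => ue.
by rewrite -(fineK un) lte_fin (le_lt_trans _ ue)// ler_norm.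
Qed.

Lemma integral_hnorm_split f s t : smeas f -> simple_fun s -> simple_fun t ->
  (\int[mu]_x (hnorm (s x - t x))%:E <=
   \int[mu]_x (hnorm (s x - f x))%:E + \int[mu]_x (hnorm (t x - f x))%:E)%E.
Proof.
move=> mf ss st.
have mdiff (g : T -> H) (sg : simple_fun g) :
    measurable_fun setT (fun x => (hnorm (g x - f x))%:E).
  apply/measurable_EFinP; apply: smeas_hnorm.
  have -> : (fun x => g x - f x) = (fun x => (-1 : R[i]) *: f x + g x).
    by apply/funext => x; rewrite scaleN1r addrC.
  by apply: smeasD; [exact: smeasZ|exact: simple_smeas].
rewrite -ge0_integralD//; last 4 first.
- by move=> x _; rewrite lee_fin hnorm_ge0.
- exact: mdiff.
- by move=> x _; rewrite lee_fin hnorm_ge0.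
- exact: mdiff.
apply: ae_le_lower_integral.
- by move=> x; rewrite lee_fin hnorm_ge0.
- by move=> x; rewrite -EFinD lee_fin addr_ge0 ?hnorm_ge0.
apply: aeW => x; rewrite -EFinD lee_fin (hnormB (t x)).
exact: ler_hnormB.
Qed.

End BochnerTheory.

(** * The Bochner integral *)

Section BochnerIntegral.
Context {R : realType} {H : hilbertType R} d (T : measurableType d).
Variable mu : {measure set T -> \bar R}.
Hypothesis mufin : (mu setT < +oo)%E.
Implicit Types (f g s t : T -> H) (I J : H).
Local Open Scope complex_scope.

Lemma smeasB f g : smeas f -> smeas g -> smeas (fun x => f x - g x).
Proof.
move=> mf mg; have -> : (fun x => f x - g x) = (fun x => (-1 : R[i]) *: g x + f x).
  by apply/funext => x; rewrite scaleN1r addrC.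
by apply: smeasD => //; exact: smeasZ.
Qed.

(** A simple value is replaced by 0 wherever its norm exceeds [2 |f|]. If [f x] is nonzero this
    eventually does not happen, since [|s n x|] tends to [|f x| < 2 |f x|]; if [f x = 0] the
    truncated values are all 0. *)
Lemma smeas_dominated_approx f : smeas f -> exists s : nat -> T -> H,
  [/\ forall n, simple_fun (s n),
      forall n x, hnorm (s n x) <= 2 * hnorm (f x) &
      forall x, hnorm (s n x - f x) @[n --> \oo] --> (0 : R)].
Proof.
move=> mf; have [s [ss sf]] := mf.
pose A n := [set x | hnorm (s n x) <= 2 * hnorm (f x)].
have mA n : measurable (A n).
  rewrite -[A n]setTI; apply: measurable_fun_le => //.
    exact: smeas_hnorm (simple_smeas (ss n)).
  by apply: measurable_funM => //; exact: smeas_hnorm.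
exists (fun n x => if x \in A n then s n x else 0); split => [n|n x|x].
- apply: (finite_simple_comp (fun u : bool * H => if u.1 then u.2 else 0)
    (s := fun x => (x \in A n, s n x))).
  exact: finite_simple_pair (finite_simple_in (mA n)) (ss n).
- have [/set_mem//|_] := boolP (x \in A n).
  by rewrite hnorm0 mulr_ge0// hnorm_ge0.
have [fx0|fx0] := eqVneq (f x) 0.
  rewrite (_ : (fun n => _) = fun=> 0); first exact: cvg_cst.
  apply/funext => n; rewrite fx0 subr0; have [/set_mem|_] := boolP (x \in A n).
    rewrite /A/= fx0 hnorm0 mulr0 => sn0; apply/eqP.
    by rewrite eq_le sn0 hnorm_ge0.
  by rewrite hnorm0.
have sx : hnorm (s n x) @[n --> \oo] --> hnorm (f x).
  exact: dominated_cvg (@dominated_hnorm R H) (sf x).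
apply: cvg_trans (sf x); apply: near_eq_cvg.
have : hnorm (f x) < 2 * hnorm (f x).
  by rewrite ltr_pMl ?ltr1n// hnorm_gt0.
move=> /(cvgr_lt _ sx); apply: filterS => n sn.
by rewrite mem_set//= /A/= ltW.
Qed.

(** Dominated convergence with majorant [3 |f|] gives convergence in mean, which makes the integrals
    of the approximations a Cauchy sequence; completeness of [H] supplies the value. *)
Lemma bochner_integrable_smeas f : smeas f ->
  (\int[mu]_x (hnorm (f x))%:E < +oo)%E -> bochner_integrable mu f.
Proof.
move=> mf intf; have [s [ss s2 sf]] := smeas_dominated_approx mf.
have mdiff n : measurable_fun setT (fun x => (hnorm (s n x - f x))%:E).
  apply/measurable_EFinP; apply: smeas_hnorm; apply: smeasB => //.
  exact: simple_smeas.
have mnf : measurable_fun setT (fun x => hnorm (f x)) by exact: smeas_hnorm.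
have s0 : (\int[mu]_x (hnorm (s n x - f x))%:E)%E @[n --> \oo] --> 0%E.
  have := @dominated_convergence _ T R mu setT measurableT
    (fun n x => (hnorm (s n x - f x))%:E) (cst 0%E) (fun x => (3 * hnorm (f x))%:E).
  case=> //.
  - by apply: aeW => x _; apply: cvg_EFin; [exact: nearW|exact: sf].
  - apply/integrableP; split.
      by apply/measurable_EFinP; exact: measurable_funM.
    under eq_integral.
      move=> x _; rewrite gee0_abs; last by rewrite lee_fin mulr_ge0// hnorm_ge0.
      rewrite EFinM; over.
    rewrite ge0_integralZl//; first by rewrite lte_mul_pinfty.
    + exact/measurable_EFinP.
    + by move=> x _; rewrite lee_fin hnorm_ge0.
  - apply: aeW => x n _; rewrite gee0_abs ?lee_fin ?hnorm_ge0//.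
    rewrite (le_trans (ler_hnormD _ _))// hnormN.
    by have := s2 n x; lra.
  by move=> _ _; rewrite integral0.
have Isub m n : ((hnorm (simple_integral mu (s m) - simple_integral mu (s n)))%:E <=
    \int[mu]_x (hnorm (s m x - f x))%:E + \int[mu]_x (hnorm (s n x - f x))%:E)%E.
  have E : simple_integral mu (fun x => (-1 : R[i]) *: s n x + s m x) =
      simple_integral mu (s m) - simple_integral mu (s n).
    by rewrite simple_integral_linear// scaleN1r addrC.
  rewrite -E; apply: (le_trans (sublinear_simple_integral mufin (@sublinear_hnorm _ _) _)).
    apply: (finite_simple_comp (fun u : H * H => (-1 : R[i]) *: u.1 + u.2)
      (s := fun x => (s n x, s m x))).
    exact: finite_simple_pair (ss n) (ss m).
  under eq_integral do rewrite scaleN1r addrC.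
  exact: integral_hnorm_split.
have [e e0|I sI] := @hdot_complete R H (fun n => simple_integral mu (s n)).
  have e2 : 0 < e / 2 by rewrite divr_gt0.
  have [N _ sN] := cvge0_lt e2 s0.
  exists N => m n Nm Nn; rewrite -lte_fin.
  rewrite (le_lt_trans (Isub m n))// (splitr e) EFinD lteD//; exact: sN.
exists I, s; split => //.
- by move=> n; exact: simple_fun_integrable.
- by apply: aeW => x; exact: sf.
apply/cvgrPdist_lt => e e0; have [N sN] := sI _ e0.
exists N => // n /= Nn; rewrite sub0r normrN ger0_norm ?hnorm_ge0//.
exact: sN.
Qed.

Lemma is_bochner_strong f I : is_bochner mu f I -> strongly_measurable mu f.
Proof. by move=> [s [ss sf _ _]]; exists s; split => // n; exact: (ss n).1. Qed.

Lemma is_bochner_ae f g I : {ae mu, forall x, f x = g x} ->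
  is_bochner mu f I -> is_bochner mu g I.
Proof.
move=> fg [s [ss sf s0 sI]]; exists s; split => //.
  by apply: filterS2 fg sf => x ->.
apply: cvg_trans s0; apply: near_eq_cvg; apply: nearW => n.
apply: ae_eq_lower_integral => [x|x|]; rewrite ?lee_fin ?hnorm_ge0//.
by apply: filterS fg => x ->.
Qed.

Lemma bochner_ae f g : {ae mu, forall x, f x = g x} -> bochner mu f = bochner mu g.
Proof.
move=> fg; congr xget; apply/seteqP; split => I; first exact: is_bochner_ae.
by apply: is_bochner_ae; apply: filterS fg => x.
Qed.

(** The inequality holds for simple functions. The Lipschitz bound on [N] controls both errors of
    the passage to the limit, that of the integral and that of the integrand; each is kept below
    [e / 2]. *)
Lemma is_bochner_sublinear_smeas N (M : R) f I : sublinear N -> dominated N M ->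
  (forall x, 0 <= N x) -> smeas f -> is_bochner mu f I ->
  ((N I)%:E <= \int[mu]_x (N (f x))%:E)%E.
Proof.
move=> sN dN N0 mf [s [ss sf s0 sI]].
have M0 : 0 < `|M| + 1 by rewrite ltr_wpDl.
have NM x y : N x <= N y + (`|M| + 1) * hnorm (x - y).
  have := le_trans (ler_norm _) (dN x y); rewrite lerBlDl => /le_trans; apply.
  rewrite lerD2l ler_wpM2r ?hnorm_ge0// (le_trans (ler_norm _))//.
  by rewrite lerDl.
apply/lee_addgt0Pr => e e0.
have d0 : 0 < e / (`|M| + 1) / 2 by rewrite !divr_gt0.
have [n] : exists n, ((\int[mu]_x (hnorm (s n x - f x))%:E <
      (e / (`|M| + 1) / 2)%:E)%E /\
    hnorm (simple_integral mu (s n) - I) < e / (`|M| + 1) / 2).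
  have [A _ sA] := cvge0_lt d0 s0.
  have /cvgrPdist_lt /(_ _ d0) [B _ sB] := sI.
  exists (maxn A B); split; first by apply: sA; rewrite /= leq_maxl.
  have := sB (maxn A B) (leq_maxr _ _).
  by rewrite sub0r normrN ger0_norm ?hnorm_ge0.
move=> [sn In].
have msn : measurable_fun setT (fun x => (hnorm (s n x - f x))%:E).
  apply/measurable_EFinP; apply: smeas_hnorm; apply: smeasB => //.
  exact: simple_smeas (ss n).1.
have mN : measurable_fun setT (fun x => (N (f x))%:E).
  by apply/measurable_EFinP; exact: smeas_dominated dN mf.
have step : (\int[mu]_x (N (s n x))%:E <= \int[mu]_x (N (f x))%:E +
    (`|M| + 1)%:E * \int[mu]_x (hnorm (s n x - f x))%:E)%E.
  rewrite -ge0_integralZl//; last by move=> x _; rewrite lee_fin hnorm_ge0.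
  rewrite -ge0_integralD//; last 3 first.
  - by move=> x _; rewrite lee_fin.
  - by move=> x _; rewrite mule_ge0// lee_fin ?hnorm_ge0// ltW.
  - by apply: measurable_funeM.
  apply: ae_le_lower_integral.
  - by move=> x; rewrite lee_fin.
  - by move=> x; rewrite adde_ge0 ?mule_ge0 ?lee_fin ?hnorm_ge0// ltW.
  by apply: aeW => x; rewrite -EFinM -EFinD lee_fin.
have NI : ((N I)%:E <= (N (simple_integral mu (s n)))%:E + (e / 2)%:E)%E.
  rewrite -EFinD lee_fin (le_trans (NM _ (simple_integral mu (s n))))// lerD2l.
  rewrite hnormB -ler_pdivlMl// mulrC (le_trans (ltW In))//.
  by rewrite mulrAC.
have eE : e%:E = ((e / 2)%:E + (e / 2)%:E)%E by rewrite -EFinD -splitr.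
apply: (le_trans NI); rewrite eE addeA; apply: leeD => //.
apply: (le_trans (sublinear_simple_integral mufin sN (ss n).1)).
apply: (le_trans step); apply: leeD => //.
rewrite -lee_pdivlMl// -EFinM (le_trans (ltW sn))// lee_fin.
by rewrite mulrA (mulrC _ e).
Qed.

Lemma is_bochner_sublinear N (M : R) f I : sublinear N -> dominated N M ->
  (forall x, 0 <= N x) -> is_bochner mu f I ->
  ((N I)%:E <= \int[mu]_x (N (f x))%:E)%E.
Proof.
move=> sN dN N0 fI; have [g mg fg] := smeas_ae (is_bochner_strong fI).
rewrite (@ae_eq_lower_integral _ _ _ _ _ (fun x => (N (g x))%:E)).
- exact: is_bochner_sublinear_smeas dN _ mg (is_bochner_ae fg fI).
- by move=> x; rewrite lee_fin.
- by move=> x; rewrite lee_fin.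
by apply: filterS fg => x ->.
Qed.

Lemma is_bochner_linear (k : R[i]) f g I J : is_bochner mu f I -> is_bochner mu g J ->
  is_bochner mu (fun x => k *: f x + g x) (k *: I + J).
Proof.
move=> fI gJ.
have [f' mf ff] := smeas_ae (is_bochner_strong fI).
have [g' mg gg] := smeas_ae (is_bochner_strong gJ).
apply: (@is_bochner_ae (fun x => k *: f' x + g' x)).
  by apply: filterS2 ff gg => x -> ->.
have [s [ss sf s0 sI]] := is_bochner_ae ff fI.
have [t [st tg t0 tJ]] := is_bochner_ae gg gJ.
have sst n : simple_fun (fun x => k *: s n x + t n x).
  apply: (finite_simple_comp (fun u : H * H => k *: u.1 + u.2)
    (s := fun x => (s n x, t n x))).
  exact: finite_simple_pair (ss n).1 (st n).1.
have dE (x y x' y' : H) : hnorm (k *: x + y - (k *: x' + y')) <=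
    ComplexField.Normc.normc k * hnorm (x - x') + hnorm (y - y').
  have -> : k *: x + y - (k *: x' + y') = k *: (x - x') + (y - y').
    by rewrite scalerBr opprD addrACA.
  by rewrite (le_trans (ler_hnormD _ _))// hnormZ.
have c0 (u v : nat -> R) : u n @[n --> \oo] --> (0 : R) -> v n @[n --> \oo] --> (0 : R) ->
    ComplexField.Normc.normc k * u n + v n @[n --> \oo] --> (0 : R).
  move=> u0 v0; have -> : 0 = ComplexField.Normc.normc k * 0 + 0 :> R.
    by rewrite mulr0 addr0.
  by apply: cvgD => //; exact: cvgMr.
exists (fun n x => k *: s n x + t n x); split.
- by move=> n; exact: simple_fun_integrable.
- apply: filterS2 sf tg => x sx tx.
  apply: (@squeeze_cvgr _ _ _ _ (fun=> 0)); last exact: c0 sx tx.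
    by apply: nearW => n; rewrite hnorm_ge0/=; exact: dE.
  exact: cvg_cst.
- apply: (@squeeze_cvge _ _ _ _ (fun=> 0%E) _ (fun n =>
    (ComplexField.Normc.normc k)%:E * \int[mu]_x (hnorm (s n x - f' x))%:E +
    \int[mu]_x (hnorm (t n x - g' x))%:E)%E).
  + apply: nearW => n; apply/andP; split.
      by apply: integral_ge0 => x _; rewrite lee_fin hnorm_ge0.
    have md (u h : T -> H) : simple_fun u -> smeas h ->
        measurable_fun setT (fun x => (hnorm (u x - h x))%:E).
      move=> su mh; apply/measurable_EFinP; apply: smeas_hnorm; apply: smeasB => //.
      exact: simple_smeas.
    have msf := md _ _ (ss n).1 mf; have mtg := md _ _ (st n).1 mg.
    rewrite -ge0_integralZl//; last 2 first.
    * by move=> x _; rewrite lee_fin hnorm_ge0.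
    * by rewrite lee_fin normcR_ge0.
    rewrite -ge0_integralD//; last 3 first.
    * by move=> x _; rewrite mule_ge0// lee_fin ?hnorm_ge0 ?normcR_ge0.
    * exact: measurable_funeM.
    * by move=> x _; rewrite lee_fin hnorm_ge0.
    apply: ae_le_lower_integral => [x|x|].
    * by rewrite lee_fin hnorm_ge0.
    * by rewrite adde_ge0 ?mule_ge0 ?lee_fin ?hnorm_ge0 ?normcR_ge0.
    by apply: aeW => x; rewrite -EFinM -EFinD lee_fin; exact: dE.
  + exact: cvg_cst.
  have -> : 0%E = ((ComplexField.Normc.normc k)%:E * 0 + 0)%E :> \bar R.
    by rewrite mule0 adde0.
  by apply: cvgeD => //; apply: cvgeZl.
apply: (@squeeze_cvgr _ _ _ _ (fun=> 0)); last exact: c0 sI tJ.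
  apply: nearW => n; rewrite hnorm_ge0/=.
  rewrite (simple_integral_linear mufin k (ss n).1 (st n).1).
  exact: dE.
exact: cvg_cst.
Qed.

(** By linearity [J - I] is an integral of the zero function, and the norm inequality makes it
    vanish. *)
Lemma is_bochner_unique f I J : is_bochner mu f I -> is_bochner mu f J -> I = J.
Proof.
move=> fI fJ; have := is_bochner_linear (-1) fI fJ.
move=> /(is_bochner_sublinear (@sublinear_hnorm _ _) (@dominated_hnorm _ _) (@hnorm_ge0 _ _)).
rewrite integral0_eq; last by move=> x _; rewrite scaleN1r addNr hnorm0.
rewrite lee_fin scaleN1r => h; apply/eqP; rewrite eq_sym -subr_eq0 addrC -hnorm_eq0.
by rewrite eq_le h hnorm_ge0.
Qed.

Lemma bochnerE f I : is_bochner mu f I -> bochner mu f = I.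
Proof.
by move=> fI; rewrite /bochner; case: xgetP => [J _ fJ|/(_ I)//]; exact: is_bochner_unique fI.
Qed.

Lemma bochnerP f : bochner_integrable mu f -> is_bochner mu f (bochner mu f).
Proof. by move=> [I fI]; rewrite (bochnerE fI). Qed.

End BochnerIntegral.

(** * The Forelli-Rudin estimate *)

Section DyadicIntegral.
Context {R : realType}.
Local Notation mu := (@lebesgue_measure R).

(** [f] lies below the sum of [A q1^n] times the indicator of the interval of radius [B q2^n] about
    [s], and the integrals of these terms form a geometric series. Growing intervals ([q2 > 1])
    serve tails, shrinking ones ([q2 < 1]) a singularity at [s], itself a null set. *)
Lemma integral_dyadic_le (f : R -> R) (s A B q1 q2 : R) :
  0 <= A -> 0 <= B -> 0 < q1 -> 0 < q2 -> q1 * q2 < 1 -> (forall y, 0 <= f y) ->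
  (forall y, y <> s -> 0 < f y ->
    exists n, `|y - s| <= B * q2 ^+ n /\ f y <= A * q1 ^+ n) ->
  (\int[mu]_y (f y)%:E <= (2 * A * B / (1 - q1 * q2))%:E)%E.
Proof.
move=> A0 B0 q10 q20 q1q2 f0 fAB.
pose S n : set R := `[s - B * q2 ^+ n, s + B * q2 ^+ n]%classic.
have SE n y : (S n y : Prop) = (`|y - s| <= B * q2 ^+ n : bool).
  by apply/propext; rewrite /S/= in_itv/= ler_distl.
have r0 n : 0 <= B * q2 ^+ n by rewrite mulr_ge0// exprn_ge0// ltW.
have a0 n : 0 <= A * q1 ^+ n by rewrite mulr_ge0// exprn_ge0// ltW.
pose h n y : \bar R := ((A * q1 ^+ n)%:E * (\1_(S n) y)%:E)%E.
have h0 n y : (0 <= h n y)%E by rewrite mule_ge0// lee_fin.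
have mS n : measurable (S n : set (measurableTypeR R)) by exact: measurable_itv.
apply: (@le_trans _ _ (\int[mu]_y (\sum_(n <oo) h n y))%E).
  apply: ae_le_lower_integral.
  - by move=> y; rewrite lee_fin.
  - by move=> y; apply: nneseries_ge0.
  exists [set s]; split; [exact: measurable_set1|exact: lebesgue_measure_set1|].
  move=> y; apply: contra_notP => ys /=.
  have [fy|fy] := ltP 0 (f y); last first.
    by rewrite (@le_trans _ _ 0%E)// nneseries_ge0.
  have [n [yn fn]] := fAB _ ys fy.
  apply: (@le_trans _ _ (\sum_(0 <= k < n.+1) h k y)%E); last exact: nneseries_lim_ge.
  rewrite big_nat_recr//= (@le_trans _ _ (h n y))//; last first.
    by rewrite leeDr// sume_ge0.
  by rewrite /h indicE mem_set ?mule1 ?lee_fin// SE.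
have m1 n : measurable_fun setT (fun y : measurableTypeR R => (\1_(S n) y : R)%:E).
  exact/measurable_EFinP/measurable_indic.
rewrite integral_nneseries//; last by move=> n; exact: measurable_funeM.
apply: lime_le; first by apply: is_cvg_nneseries => n _ _; exact: integral_ge0.
apply: nearW => n.
have intS k : (\int[mu]_y h k y = (2 * A * B * (q1 * q2) ^+ k)%:E)%E.
  rewrite ge0_integralZl//; last by rewrite lee_fin.
  rewrite integral_indic// setIT.
  transitivity ((A * q1 ^+ k)%:E * (B * q2 ^+ k *+ 2)%:E)%E.
    congr (_ * _)%E; rewrite -[LHS]/(mu (S k)).
    rewrite lebesgue_measure_itv/= lte_fin; case: ifPn => [_|].
      by rewrite -EFinB; congr EFin; ring.
    rewrite -leNgt => h1; congr EFin; have := r0 k.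
    by move: (B * q2 ^+ k) h1 => u h1 u0; rewrite mulr2n; lra.
  by rewrite -EFinM exprMn; congr EFin; ring.
under eq_bigr do rewrite intS.
rewrite sumEFin lee_fin.
rewrite (_ : \sum_(0 <= i < n) _ = series (geometric (2 * A * B) (q1 * q2)) n)//.
by rewrite geometric_le_lim ?mulr_ge0 ?mulr_gt0// ger0_norm// mulr_ge0// ltW.
Qed.

End DyadicIntegral.

(** * Peaks and power singularities on the line *)

Section OneDimensional.
Context {R : realType}.
Local Notation mu := (@lebesgue_measure R).
Implicit Types (c e r s t u v x y : R).

Lemma ler_powR_neg u v c : 0 < u -> u <= v -> c <= 0 -> v `^ c <= u `^ c.
Proof.
move=> u0 uv c0; have v0 := lt_le_trans u0 uv.
have -> : c = - (- c) by rewrite opprK.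
move: c0; rewrite -oppr_ge0; move: (- c) => b b0.
rewrite !powRN lef_pV2 ?posrE ?powR_gt0//.
by apply: ge0_ler_powR; rewrite // nnegrE ltW.
Qed.

Lemma powR_exprn u c n : 0 <= u -> (u ^+ n) `^ c = (u `^ c) ^+ n.
Proof.
by move=> u0; rewrite -powR_mulrn// -powRrM mulrC powRrM powR_mulrn// powR_ge0.
Qed.

Lemma powRS u c : 0 < u -> u `^ (c + 1) = u `^ c * u.
Proof.
move=> u0; rewrite powRD; last by rewrite (gt_eqF u0) implybT.
by rewrite powRr1// ltW.
Qed.

Lemma powR_inv u c : 0 <= u -> u^-1 `^ c = u `^ (- c).
Proof. by move=> u0; rewrite -powR_inv1// -powRrM mulN1r. Qed.

Lemma powR_lt1 u c : 1 < u -> c < 0 -> u `^ c < 1.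
Proof.
move=> u1 c0; have u0 : 0 < u by exact: lt_trans u1.
by rewrite /powR (gt_eqF u0) expR_lt1 nmulr_rlt0// ln_gt0.
Qed.

Lemma lt_expr2n (n : nat) : n%:R < 2 ^+ n :> R.
Proof. by rewrite -natrX ltr_nat ltn_expl. Qed.

(** The least [n] with [r <= 2 t 2^n] works: if it is positive, failure at [n - 1] gives
    [t 2^n < r]. *)
Lemma dyadic_up t r : 0 < t -> 0 <= r ->
  exists n, r <= 2 * t * 2 ^+ n /\ t * 2 ^+ n <= t + r.
Proof.
move=> t0 r0; have ex : exists n, r <= 2 * t * 2 ^+ n.
  have rE : r = r / t * t by rewrite divfK ?gt_eqF.
  exists (Num.truncn (r / t)).+1.
  have := lt_trans (truncnS_gt (r / t)) (lt_expr2n _).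
  have x0 : 0 <= r / t by rewrite divr_ge0// ltW.
  by move: (r / t) rE x0 => x -> x0; move: (2 ^+ _) => u xu; nra.
case: (ex_minnP ex) => -[|n] rn nmin; first by exists 0%N; split => //; rewrite expr0 mulr1 lerDl.
exists n.+1; split => //; have : ~~ (r <= 2 * t * 2 ^+ n).
  by apply/negP => /nmin; rewrite ltnn.
by rewrite -ltNge exprS => h; rewrite (@le_trans _ _ r) ?lerDr ?ltW// mulrCA mulrA.
Qed.

Lemma dyadic_down t r : 0 < r -> r < t ->
  exists n, r <= t * 2^-1 ^+ n /\ t / 2 * 2^-1 ^+ n <= r.
Proof.
move=> r0 rt; have t0 : 0 < t by exact: lt_trans rt.
have ex : exists n, t / 2 * 2^-1 ^+ n <= r.
  have tE : t = t / r * r by rewrite divfK ?gt_eqF.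
  exists (Num.truncn (t / r)).+1.
  rewrite exprVn ler_pdivrMr ?exprn_gt0// ler_pdivrMr//.
  have := lt_trans (truncnS_gt (t / r)) (lt_expr2n _).
  have x0 : 0 <= t / r by rewrite divr_ge0// ltW.
  by move: (t / r) tE x0 => x -> x0; move: (2 ^+ _) => u xu; nra.
case: (ex_minnP ex) => -[|n] rn nmin; first by exists 0%N; split => //; rewrite expr0 mulr1 ltW.
exists n.+1; split => //; have : ~~ (t / 2 * 2^-1 ^+ n <= r).
  by apply/negP => /nmin; rewrite ltnn.
by rewrite -ltNge exprS mulrA => /ltW.
Qed.

(** The dyadic bound with [A = t^-(1 + e)], [B = 2 t], [q1 = 2^-(1 + e)], [q2 = 2]. *)
Definition peak_cst e := 4 / (1 - 2 `^ (- e)).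

Lemma peak_cst_ge0 e : 0 < e -> 0 <= peak_cst e.
Proof.
move=> e0; rewrite divr_ge0// subr_ge0 ltW// powR_lt1 ?ltr1n//.
by rewrite oppr_lt0.
Qed.

Lemma integral_peak e t y0 : 0 < e -> 0 < t ->
  (\int[mu]_y ((t + `|y - y0|) `^ (- (1 + e)))%:E <=
   (peak_cst e * t `^ (- e))%:E)%E.
Proof.
move=> e0 t0.
have q : 2 `^ (- (1 + e)) * 2 = 2 `^ (- e) :> R.
  by rewrite -powRS//; congr (_ `^ _); ring.
have q1 : 2 `^ (- e) < 1 :> R by rewrite powR_lt1 ?ltr1n// oppr_lt0.
apply: (@le_trans _ _ (2 * t `^ (- (1 + e)) * (2 * t) / (1 - 2 `^ (- (1 + e)) * 2))%:E).
  apply: (@integral_dyadic_le _ _ y0).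
  - exact: powR_ge0.
  - by rewrite mulr_ge0// ltW.
  - by rewrite powR_gt0.
  - by [].
  - by rewrite q.
  - by move=> y; exact: powR_ge0.
  move=> y _ _; have [n [yn tn]] := dyadic_up t0 (normr_ge0 (y - y0)).
  exists n; split => //.
  rewrite -powR_exprn// -powRM ?exprn_ge0 ?(ltW t0)//.
  apply: ler_powR_neg => //; first by rewrite mulr_gt0 ?exprn_gt0.
  by rewrite oppr_le0 addr_ge0// ltW.
rewrite lee_fin q /peak_cst.
have -> : t `^ (- e) = t `^ (- (1 + e)) * t.
  by rewrite -powRS//; congr (_ `^ _); ring.
rewrite le_eqVlt; apply/orP; left; apply/eqP.
by field; rewrite subr_eq0 gt_eqF.
Qed.

(** The dyadic bound with [A = (t / 2)^c], [B = t], [q1 = 2^-c], [q2 = 1 / 2]; the ratio is below 1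
    exactly when [c > -1]. *)
Definition singular_cst c := 2 * 2 `^ (- c) / (1 - 2 `^ (- c) / 2).

Lemma singular_ratio c : -1 < c -> 2 `^ (- c) * 2^-1 < 1 :> R.
Proof.
move=> c1; have -> : 2 `^ (- c) * 2^-1 = 2 `^ (- (1 + c)) :> R.
  have -> : - c = - (1 + c) + 1 by ring.
  by rewrite powRS// mulfK.
by rewrite powR_lt1 ?ltr1n// oppr_lt0 -ltrBlDl sub0r.
Qed.

Lemma singular_cst_ge0 c : -1 < c -> 0 <= singular_cst c.
Proof.
move=> c1; rewrite divr_ge0 ?mulr_ge0 ?powR_ge0// subr_ge0 ltW//.
exact: singular_ratio.
Qed.

Lemma integral_singularity c t s : -1 < c -> c <= 0 -> 0 < t ->
  (\int[mu]_y (if `|y - s| < t then `|y - s| `^ c else 0)%:E <=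
   (singular_cst c * t `^ (1 + c))%:E)%E.
Proof.
move=> c1 c0 t0.
apply: (@le_trans _ _ (2 * (t / 2) `^ c * t / (1 - 2 `^ (- c) * 2^-1))%:E).
  apply: (@integral_dyadic_le _ _ s).
  - exact: powR_ge0.
  - exact: ltW.
  - by rewrite powR_gt0.
  - by rewrite invr_gt0.
  - exact: singular_ratio.
  - by move=> y; case: ifP => // _; exact: powR_ge0.
  move=> y ys; case: ifP => [yt _|]; last by rewrite ltxx.
  have ys0 : 0 < `|y - s|.
    by rewrite normr_gt0 subr_eq0; apply/eqP.
  have [n [yn tn]] := dyadic_down ys0 yt; exists n; split => //.
  rewrite -powR_inv// -powR_exprn ?invr_ge0// -powRM ?exprn_ge0 ?divr_ge0 ?invr_ge0 ?(ltW t0)//.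
  apply: ler_powR_neg => //.
  by rewrite mulr_gt0 ?divr_gt0 ?exprn_gt0 ?invr_gt0.
rewrite lee_fin /singular_cst.
have -> : t `^ (1 + c) = t `^ c * t.
  by rewrite -powRS// addrC.
have -> : (t / 2) `^ c = t `^ c * 2 `^ (- c).
  by rewrite powRM ?invr_ge0 ?(ltW t0)// powR_inv.
rewrite le_eqVlt; apply/orP; left; apply/eqP.
by field; have := singular_ratio c1; rewrite subr_eq0 => h; apply/eqP; lra.
Qed.

End OneDimensional.

(** * Planar integrals by slices *)

Section TwoDimensional.
Context {R : realType}.
Local Notation mu := (@lebesgue_measure R).
Local Notation mu2 := (@lebesgue_measure R \x @lebesgue_measure R)%E.
Implicit Types (c d s t x y : R).

Definition slice_cst c d := peak_cst (1 + c + d) + singular_cst c.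

Lemma measurable_powR_comp (disp : measure_display) (T : measurableType disp) (f : T -> R) c :
  measurable_fun setT f -> measurable_fun setT (fun u => f u `^ c).
Proof. by move=> mf; apply: (@measurableT_comp _ _ _ _ _ _ (@powR R ^~ c)) => //; exact: measurable_powR. Qed.

Lemma slice_cst_ge0 c d : -1 < c -> 0 < d -> 0 <= slice_cst c d.
Proof.
by move=> c1 d0; rewrite addr_ge0 ?singular_cst_ge0 ?peak_cst_ge0//; lra.
Qed.

(** Where [|y - s| >= t], the singular factor is at most [t^c] and a peak of exponent
    [1 + (1 + c + d)] remains. Where [|y - s| < t], the peak is at most [t^-(2 + c + d)] and the
    singularity integrates to a multiple of [t^(1 + c)]. Both contributions are of order
    [t^-(1 + d)]. *)
Lemma integral_slice c d t s y0 : -1 < c -> c <= 0 -> 0 < d -> 0 < t ->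
  (\int[mu]_y (`|y - s| `^ c * (t + `|y - y0|) `^ (- (2 + c + d)))%:E <=
   (slice_cst c d * t `^ (- (1 + d)))%:E)%E.
Proof.
move=> c1 c0 d0 t0.
have e0 : 0 < 1 + c + d by lra.
pose f1 (y : measurableTypeR R) := (t + `|y - y0|) `^ (- (1 + (1 + c + d))).
pose f2 (y : measurableTypeR R) := if `|y - s| < t then `|y - s| `^ c else 0.
have f20 y : 0 <= f2 y by rewrite /f2; case: ifP => // _; exact: powR_ge0.
have mabs (u : R) : measurable_fun setT (fun y : measurableTypeR R => `|y - u|).
  by apply: measurableT_comp => //; exact: measurable_funB.
have mf1 : measurable_fun setT f1.
  by apply: measurable_powR_comp; exact: measurable_funD.
have mf2 : measurable_fun setT f2.
  apply: measurable_fun_ifT => //; last exact: measurable_powR_comp.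
  exact: measurable_fun_ltr.
apply: (@le_trans _ _ (\int[mu]_y ((t `^ c)%:E * (f1 y)%:E +
    (t `^ (- (2 + c + d)))%:E * (f2 y)%:E))%E).
  apply: ae_le_lower_integral.
  - by move=> y; rewrite lee_fin mulr_ge0// powR_ge0.
  - by move=> y; rewrite adde_ge0// mule_ge0// lee_fin ?powR_ge0.
  apply: aeW => y; rewrite -!EFinM -EFinD lee_fin.
  have -> : f1 y = (t + `|y - y0|) `^ (- (2 + c + d)).
    by rewrite /f1; congr (_ `^ _); ring.
  have [yt|ty] := ltP `|y - s| t; last first.
    rewrite (@le_trans _ _ (t `^ c * (t + `|y - y0|) `^ (- (2 + c + d))))//.
      by rewrite ler_wpM2r ?powR_ge0// ler_powR_neg.
    by rewrite lerDl mulr_ge0// powR_ge0.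
  rewrite (@le_trans _ _ (t `^ (- (2 + c + d)) * f2 y))//; last first.
    by rewrite lerDr mulr_ge0// powR_ge0.
  rewrite /f2 yt mulrC ler_wpM2r ?powR_ge0//.
  by rewrite ler_powR_neg ?lerDl//; lra.
rewrite ge0_integralD//; last 4 first.
- by move=> y _; rewrite mule_ge0// lee_fin ?powR_ge0 ?f20.
- exact/measurable_funeM/measurable_EFinP.
- by move=> y _; rewrite mule_ge0// lee_fin ?powR_ge0 ?f20.
- exact/measurable_funeM/measurable_EFinP.
rewrite ge0_integralZl//; last 3 first.
- exact/measurable_EFinP.
- by move=> y _; rewrite lee_fin powR_ge0.
- by rewrite lee_fin powR_ge0.
rewrite ge0_integralZl//; last 3 first.
- exact/measurable_EFinP.
- by move=> y _; rewrite lee_fin.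
- by rewrite lee_fin powR_ge0.
have -> : (slice_cst c d * t `^ (- (1 + d)))%:E =
    ((t `^ c)%:E * (peak_cst (1 + c + d) * t `^ (- (1 + c + d)))%:E +
     (t `^ (- (2 + c + d)))%:E * (singular_cst c * t `^ (1 + c))%:E)%E.
  rewrite -!EFinM -EFinD mulrCA -powRD; last by rewrite (gt_eqF t0) implybT.
  rewrite (mulrCA _ (singular_cst c)) -powRD; last by rewrite (gt_eqF t0) implybT.
  rewrite (_ : c + _ = - (1 + d)); last by ring.
  rewrite (_ : - (2 + c + d) + _ = - (1 + d)); last by ring.
  by rewrite -mulrDl.
apply: leeD; apply: lee_wpmul2l; rewrite ?lee_fin ?powR_ge0//.
- exact: integral_peak.
- exact: integral_singularity.
Qed.

Definition plane_cst c d := slice_cst c d * peak_cst d.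

Lemma plane_cst_ge0 c d : -1 < c -> 0 < d -> 0 <= plane_cst c d.
Proof. by move=> c1 d0; rewrite mulr_ge0 ?slice_cst_ge0 ?peak_cst_ge0. Qed.

(** The slice bound, with [t + |x - x0|] for [t], is uniform in the place of the singularity, which
    may thus vary with [x]. What remains is a peak of exponent [1 + d] in [x]. *)
Lemma integral_slices c d t x0 y0 (s : R -> R) :
  -1 < c -> c <= 0 -> 0 < d -> 0 < t ->
  (\int[mu]_x \int[mu]_y (`|y - s x| `^ c *
     (t + `|x - x0| + `|y - y0|) `^ (- (2 + c + d)))%:E <=
   (plane_cst c d * t `^ (- d))%:E)%E.
Proof.
move=> c1 c0 d0 t0.
apply: (@le_trans _ _ (\int[mu]_x ((slice_cst c d)%:E *
    ((t + `|x - x0|) `^ (- (1 + d)))%:E))%E).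
  apply: ae_le_lower_integral => [x|x|].
  - by apply: integral_ge0 => y _; rewrite lee_fin mulr_ge0// powR_ge0.
  - by rewrite mule_ge0// lee_fin ?powR_ge0// slice_cst_ge0.
  apply: aeW => x; rewrite -EFinM; apply: integral_slice => //.
  by rewrite ltr_pwDl.
rewrite ge0_integralZl//; last 3 first.
- apply/measurable_EFinP; apply: measurable_powR_comp; apply: measurable_funD => //.
  by apply: measurableT_comp => //; exact: measurable_funB.
- by move=> y _; rewrite lee_fin powR_ge0.
- by rewrite lee_fin slice_cst_ge0.
rewrite /plane_cst -mulrA EFinM; apply: lee_wpmul2l.
  by rewrite lee_fin slice_cst_ge0.
exact: integral_peak.
Qed.

(** A power singularity along [u = v] times a peak of width [t] at [z0]; below, [u] is one
    coordinate of [z] and [v] a function of the other. *)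
Definition bump c d t (z0 z : R * R) (u v : R) :=
  `|u - v| `^ c * (t + `|z.1 - z0.1| + `|z.2 - z0.2|) `^ (- (2 + c + d)).

Lemma measurable_bump c d t z0 (u v : measurableTypeR R * measurableTypeR R -> R) :
  measurable_fun setT u -> measurable_fun setT v ->
  measurable_fun setT (fun z : measurableTypeR R * measurableTypeR R =>
    bump c d t z0 z (u z) (v z)).
Proof.
move=> mu_ mv; apply: measurable_funM.
  apply: measurable_powR_comp; apply: measurableT_comp => //.
  exact: measurable_funB.
apply: measurable_powR_comp; apply: measurable_funD.
  apply: measurable_funD => //; apply: measurableT_comp => //.
  by apply: measurable_funB => //; exact: measurable_fst.
apply: measurableT_comp => //.
by apply: measurable_funB => //; exact: measurable_snd.
Qed.

Lemma bump_ge0 c d t z0 z u v : 0 <= bump c d t z0 z u v.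
Proof. by rewrite mulr_ge0// powR_ge0. Qed.

Lemma integral_bump_snd c d t z0 (s : measurableTypeR R -> R) : measurable_fun setT s ->
  -1 < c -> c <= 0 -> 0 < d -> 0 < t ->
  (\int[mu2]_z (bump c d t z0 z z.2 (s z.1))%:E <= (plane_cst c d * t `^ (- d))%:E)%E.
Proof.
move=> ms c1 c0 d0 t0.
rewrite (fubini_tonelli1 (m1 := mu) (m2 := mu)
  (fun z : measurableTypeR R * measurableTypeR R => (bump c d t z0 z z.2 (s z.1))%:E)).
- rewrite /fubini_F /bump /=.
  exact: (integral_slices z0.1 z0.2 s c1 c0 d0 t0).
- apply/measurable_EFinP; apply: measurable_bump; first exact: measurable_snd.
  by apply: measurableT_comp ms _; exact: measurable_fst.
- by move=> z; rewrite lee_fin bump_ge0.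
Qed.

Lemma integral_bump_fst c d t z0 (s : measurableTypeR R -> R) : measurable_fun setT s ->
  -1 < c -> c <= 0 -> 0 < d -> 0 < t ->
  (\int[mu2]_z (bump c d t z0 z z.1 (s z.2))%:E <= (plane_cst c d * t `^ (- d))%:E)%E.
Proof.
move=> ms c1 c0 d0 t0.
rewrite (fubini_tonelli2 (m1 := mu) (m2 := mu)
  (fun z : measurableTypeR R * measurableTypeR R => (bump c d t z0 z z.1 (s z.2))%:E)).
- rewrite /fubini_G /bump /=.
  under eq_integral do under eq_integral do rewrite addrAC.
  exact: (integral_slices z0.2 z0.1 s c1 c0 d0 t0).
- apply/measurable_EFinP; apply: measurable_bump; first exact: measurable_fst.
  by apply: measurableT_comp ms _; exact: measurable_snd.
- by move=> z; rewrite lee_fin bump_ge0.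
Qed.

End TwoDimensional.

(** * Geometry of the kernel on the disc *)

Section ForelliRudin.
Context {R : realType}.
Local Notation plane := (measurableTypeR R * measurableTypeR R)%type.
Local Notation mu := (@lebesgue_measure R).
Local Notation mu2 := (@lebesgue_measure R \x @lebesgue_measure R)%E.
Implicit Types (c d : R) (z w : R * R).

(** [kre] and [kim] are the real and imaginary parts of [1 - w^* z]. *)
Definition kre z w : R := 1 - (w.1 * z.1 + w.2 * z.2).
Definition kim z w : R := w.2 * z.1 - w.1 * z.2.

(* [cden z w] is [|1 - w^* z|]. *)
Definition cden z w : R := Num.sqrt (kre z w ^+ 2 + kim z w ^+ 2).

Lemma tdiscE z : tdisc z = 1 - (z.1 ^+ 2 + z.2 ^+ 2).
Proof. by rewrite /tdisc sqr_sqrtr// addr_ge0 ?sqr_ge0. Qed.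

(** Twice the right side minus twice the left is [|z - w|^2]. *)
Lemma kre_ge z w : (tdisc z + tdisc w) / 2 <= kre z w.
Proof.
rewrite !tdiscE /kre ler_pdivrMr//.
have := sqr_ge0 (z.1 - w.1); have := sqr_ge0 (z.2 - w.2).
by rewrite !expr2; move: z.1 z.2 w.1 w.2 => u v x y; nra.
Qed.

Lemma cden_ge_kre z w : kre z w <= cden z w.
Proof.
apply: (le_trans (ler_norm _)); rewrite -sqrtr_sqr ler_sqrt ?addr_ge0 ?sqr_ge0//.
by rewrite lerDl sqr_ge0.
Qed.

Lemma sqr_cden z w : cden z w ^+ 2 =
  (w.1 - z.1) ^+ 2 + (w.2 - z.2) ^+ 2 + tdisc z * tdisc w.
Proof.
rewrite sqr_sqrtr ?addr_ge0 ?sqr_ge0// !tdiscE /kre /kim.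
by move: z.1 z.2 w.1 w.2 => u v x y; ring.
Qed.

Section InDisc.
Variables (z w : R * R).
Hypotheses (zD : disc z) (wD : disc w).

Let tz : 0 < tdisc z := tdisc_gt0 zD.
Let tw : 0 < tdisc w := tdisc_gt0 wD.

Lemma kre_gt0 : 0 < kre z w.
Proof. by rewrite (lt_le_trans _ (kre_ge z w))// divr_gt0// addr_gt0. Qed.

Lemma cden_gt0 : 0 < cden z w.
Proof. exact: lt_le_trans kre_gt0 (cden_ge_kre z w). Qed.

Lemma tdisc_le_cden : tdisc z <= 2 * cden z w.
Proof.
have := le_trans (kre_ge z w) (cden_ge_kre z w).
by move: (cden z w) (tdisc z) (tdisc w) tz tw => e u v u0 v0; lra.
Qed.

Lemma dist_le_cden : `|w.1 - z.1| <= cden z w /\ `|w.2 - z.2| <= cden z w.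
Proof.
have c0 := cden_gt0; have := sqr_cden z w.
have tt : 0 < tdisc z * tdisc w by rewrite mulr_gt0.
move: (cden z w) c0 (tdisc z * tdisc w) tt => e e0 p p0 eE.
split; rewrite -(@ler_pXn2r _ 2%N) ?nnegrE ?(ltW e0)// real_normK ?num_real//.
  by have := sqr_ge0 (w.2 - z.2); lra.
by have := sqr_ge0 (w.1 - z.1); lra.
Qed.

(** A lower bound for [4 * cden z w] that, unlike [cden], is a sum of functions of single
    coordinates and so can be integrated by slices. *)
Definition knear : R := tdisc z + `|w.1 - z.1| + `|w.2 - z.2|.

Lemma knear_gt0 : 0 < knear.
Proof. by rewrite ltr_wpDr// ltr_wpDr. Qed.

Lemma knear_le_cden : knear <= 4 * cden z w.
Proof.
rewrite /knear; have [] := dist_le_cden; have := tdisc_le_cden.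
by move: `|_| `|_| (tdisc z) (cden z w) => x y e u; lra.
Qed.

Lemma coord_le1 (v : R * R) : disc v -> `|v.1| <= 1 /\ `|v.2| <= 1.
Proof.
move=> /tdisc_gt0; rewrite tdiscE => v0.
have := sqr_ge0 v.1; have := sqr_ge0 v.2 => h1 h2.
split; rewrite -(@ler_pXn2r _ 2%N) ?nnegrE// real_normK ?num_real// expr1n; lra.
Qed.

Lemma knear_le5 : knear <= 5.
Proof.
have [z1 z2] := coord_le1 zD; have [w1 w2] := coord_le1 wD.
have h1 := ler_normB w.1 z.1; have h2 := ler_normB w.2 z.2.
have := tdisc_le1 z; rewrite /knear => tz1.
by move: (tdisc z) `|z.1| `|z.2| `|w.1| `|w.2| `|w.1 - z.1| `|w.2 - z.2| tz1 z1 z2 w1 w2 h1 h2 => *; lra.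
Qed.

Definition arc (x : R) := Num.sqrt (1 - x ^+ 2).

(* The disc is covered by the square [|w.1|, |w.2| < 1/2], where
   [tdisc >= 1/2], and two regions in each of which [tdisc w] dominates the
   distance of one coordinate to the endpoints of its slice. *)
Lemma powR_tdisc_le c : -1 < c -> c <= 0 -> tdisc w `^ c <=
  2 \/ (tdisc w `^ c <= `|w.2 - arc w.1| `^ c \/
        tdisc w `^ c <= `|w.2 - - arc w.1| `^ c) \/
       (tdisc w `^ c <= `|w.1 - arc w.2| `^ c \/
        tdisc w `^ c <= `|w.1 - - arc w.2| `^ c).
Proof.
move=> c1 c0.
(* Here [1 - x^2 - y^2 = (arc x - |y|) (arc x + |y|)], and the second factor is at least 1 because
   [arc x > |y| >= 1/2]. The nonpositive exponent reverses the inequality. *)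
have key (x y : R) : 0 < 1 - (x ^+ 2 + y ^+ 2) -> 2^-1 <= `|y| ->
    (1 - (x ^+ 2 + y ^+ 2)) `^ c <= `|y - arc x| `^ c \/
    (1 - (x ^+ 2 + y ^+ 2)) `^ c <= `|y - - arc x| `^ c.
  move=> xy0 y2; have x1 : 0 <= 1 - x ^+ 2 by have := sqr_ge0 y; lra.
  have s0 : 0 <= arc x by exact: sqrtr_ge0.
  have sE : arc x ^+ 2 = 1 - x ^+ 2 by rewrite sqr_sqrtr.
  have ys : `|y| < arc x.
    rewrite -(@ltr_pXn2r _ 2%N) ?nnegrE// sE real_normK ?num_real//; lra.
  have tE : 1 - (x ^+ 2 + y ^+ 2) = (arc x - `|y|) * (arc x + `|y|).
    by rewrite -subr_sqr sE real_normK ?num_real//; ring.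
  have tle : arc x - `|y| <= 1 - (x ^+ 2 + y ^+ 2).
    by rewrite tE ler_peMr ?subr_ge0 ?(ltW ys)//; lra.
  have [y0|y0] := leP 0 y; [left|right].
    apply: ler_powR_neg => //.
      by rewrite normr_gt0 subr_eq0 lt_eqF// (le_lt_trans _ ys)// ler_norm.
    rewrite distrC ger0_norm; first by rewrite -{1}(ger0_norm y0).
    by rewrite subr_ge0 ltW// (le_lt_trans _ ys)// ler_norm.
  have yE : `|y| = - y by rewrite ltr0_norm.
  apply: ler_powR_neg => //; rewrite opprK ?normr_gt0.
    by rewrite gt_eqF//; lra.
  by rewrite ger0_norm; lra.
move: tw; rewrite tdiscE => w0.
have [y2|y2] := leP 2^-1 `|w.2|; first by right; left; apply: key.
have [x2|x2] := leP 2^-1 `|w.1|.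
  right; right; rewrite (addrC (w.1 ^+ 2)) in w0 *.
  exact: key.
left; have sq (u : R) : `|u| < 2^-1 -> u ^+ 2 <= 4^-1.
  move=> u2; rewrite -real_normK ?num_real//.
  by have := normr_ge0 u; move: `|u| u2 => v *; nra.
have := sq _ y2; have := sq _ x2 => h1 h2.
apply: (@le_trans _ _ (2^-1 `^ c)).
  by apply: ler_powR_neg; rewrite ?invr_gt0//; lra.
rewrite powR_inv// -[leRHS]powRr1//; apply: ler_powR; first by rewrite ler1n.
lra.
Qed.

End InDisc.
End ForelliRudin.

Section IntegralBounds.
Context d (T : measurableType d) (R : realType) (mu : {measure set T -> \bar R}).
Implicit Types (f g : T -> R) (a b k : R).

Lemma integralD_le f g a b : measurable_fun setT f -> measurable_fun setT g ->
  (forall x, 0 <= f x) -> (forall x, 0 <= g x) ->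
  (\int[mu]_x (f x)%:E <= a%:E)%E -> (\int[mu]_x (g x)%:E <= b%:E)%E ->
  (\int[mu]_x (f x + g x)%:E <= (a + b)%:E)%E.
Proof.
move=> mf mg f0 g0 fa gb; under eq_integral do rewrite EFinD.
rewrite ge0_integralD//.
- by rewrite EFinD; exact: leeD.
- by move=> x _; rewrite lee_fin.
- exact/measurable_EFinP.
- by move=> x _; rewrite lee_fin.
- exact/measurable_EFinP.
Qed.

Lemma integralZ_le f a k : measurable_fun setT f -> (forall x, 0 <= f x) -> 0 <= k ->
  (\int[mu]_x (f x)%:E <= a%:E)%E -> (\int[mu]_x (k * f x)%:E <= (k * a)%:E)%E.
Proof.
move=> mf f0 k0 fa; under eq_integral do rewrite EFinM.
rewrite ge0_integralZl//.
- by rewrite EFinM; exact: lee_wpmul2l.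
- exact/measurable_EFinP.
- by move=> x _; rewrite lee_fin.
Qed.

Lemma integralD5_le (f0 f1 f2 f3 f4 : T -> R) a b :
  [/\ measurable_fun setT f0, measurable_fun setT f1, measurable_fun setT f2,
      measurable_fun setT f3 & measurable_fun setT f4] ->
  (forall x, [/\ 0 <= f0 x, 0 <= f1 x, 0 <= f2 x, 0 <= f3 x & 0 <= f4 x]) ->
  (\int[mu]_x (f0 x)%:E <= a%:E)%E ->
  (\int[mu]_x (f1 x)%:E <= b%:E)%E -> (\int[mu]_x (f2 x)%:E <= b%:E)%E ->
  (\int[mu]_x (f3 x)%:E <= b%:E)%E -> (\int[mu]_x (f4 x)%:E <= b%:E)%E ->
  measurable_fun setT (fun x => f0 x + (f1 x + f2 x) + (f3 x + f4 x)) /\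
  (\int[mu]_x (f0 x + (f1 x + f2 x) + (f3 x + f4 x))%:E <=
   (a + (b + b) + (b + b))%:E)%E.
Proof.
move=> [m0 m1 m2 m3 m4] fge I0 I1 I2 I3 I4.
have m12 : measurable_fun setT (fun x => f1 x + f2 x) by exact: measurable_funD.
have m34 : measurable_fun setT (fun x => f3 x + f4 x) by exact: measurable_funD.
have m012 : measurable_fun setT (fun x => f0 x + (f1 x + f2 x)) by exact: measurable_funD.
split; first exact: measurable_funD.
have [g0 g1 g2 g3 g4] : [/\ forall x, 0 <= f0 x, forall x, 0 <= f1 x,
    forall x, 0 <= f2 x, forall x, 0 <= f3 x & forall x, 0 <= f4 x].
  by split => x; have [] := fge x.
have I12 := integralD_le m1 m2 g1 g2 I1 I2.
have I34 := integralD_le m3 m4 g3 g4 I3 I4.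
have g12 x : 0 <= f1 x + f2 x by rewrite addr_ge0.
have g34 x : 0 <= f3 x + f4 x by rewrite addr_ge0.
have I012 := integralD_le m0 m12 g0 g12 I0 I12.
apply: (integralD_le m012 m34 _ g34 I012 I34) => x.
by rewrite addr_ge0.
Qed.

End IntegralBounds.

(** * The estimate for nonpositive exponents *)

Section ForelliRudinIntegral.
Context {R : realType}.
Local Notation plane := (measurableTypeR R * measurableTypeR R)%type.
Local Notation mu := (@lebesgue_measure R).
Local Notation mu2 := (@lebesgue_measure R \x @lebesgue_measure R)%E.
Implicit Types (c d : R) (z w : R * R).

(** One bump for each alternative of [powR_tdisc_le]. The first has exponent 0, as [tdisc w ^ c] is
    bounded in the central square; the others are singular at the two endpoints of a vertical or
    horizontal slice. *)
Definition bumps c d z w : R :=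
  bump 0 d (tdisc z) z w w.2 0 +
  (bump c d (tdisc z) z w w.2 (arc w.1) + bump c d (tdisc z) z w w.2 (- arc w.1)) +
  (bump c d (tdisc z) z w w.1 (arc w.2) + bump c d (tdisc z) z w w.1 (- arc w.2)).

(** The factor [4^(2 + c + d)] comes from [knear <= 4 cden]. The 10 is [2 * 5]: in the central
    square [tdisc w ^ c <= 2], and passing to the exponent [-(2 + d)] costs [knear^-c <= 5]. *)
Lemma kernel_le_bumps c d z w : -1 < c -> c <= 0 -> 0 < d -> disc z -> disc w ->
  tdisc w `^ c * cden z w `^ (- (2 + c + d)) <=
  10 * 4 `^ (2 + c + d) * bumps c d z w.
Proof.
move=> c1 c0 d0 zD wD; have N0 := knear_gt0 w zD.
have N4 := knear_le_cden zD wD; have N5 := knear_le5 zD wD.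
have e0 := cden_gt0 zD wD; have := powR_tdisc_le wD c1 c0.
rewrite /bumps /bump -/(knear z w) powRr0 mul1r.
move=> tcv; move: (knear z w) (cden z w) N0 N4 N5 e0 => N e N0 N4 N5 e0.
have eN : e `^ (- (2 + c + d)) <= 4 `^ (2 + c + d) * N `^ (- (2 + c + d)).
  have -> : 4 `^ (2 + c + d) = 4^-1 `^ (- (2 + c + d)) :> R.
    by rewrite powR_inv// opprK.
  rewrite -powRM ?invr_ge0 ?(ltW N0)//; apply: ler_powR_neg.
  - by rewrite mulr_gt0 ?invr_gt0.
  - by rewrite mulrC ler_pdivrMr// mulrC.
  - by lra.
have N2 : N `^ (- (2 + c + d)) <= 5 * N `^ (- (2 + 0 + d)).
  have -> : - (2 + c + d) = - c + - (2 + 0 + d) by ring.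
  rewrite powRD ?(gt_eqF N0) ?implybT// ler_wpM2r ?powR_ge0//.
  apply: (@le_trans _ _ (5 `^ (- c))).
    by apply: ge0_ler_powR; rewrite ?nnegrE ?oppr_ge0// ltW.
  by rewrite -[leRHS]powRr1//; apply: ler_powR; [rewrite ler1n|lra].
move: (powR_ge0 `|w.2 - arc w.1| c) (powR_ge0 `|w.2 - - arc w.1| c)
  (powR_ge0 `|w.1 - arc w.2| c) (powR_ge0 `|w.1 - - arc w.2| c)
  (powR_ge0 (tdisc w) c) (powR_ge0 N (- (2 + c + d)))
  (powR_ge0 N (- (2 + 0 + d))) (powR_ge0 4 (2 + c + d)) eN N2 tcv.
move: (`|w.2 - arc w.1| `^ c) (`|w.2 - - arc w.1| `^ c)
  (`|w.1 - arc w.2| `^ c) (`|w.1 - - arc w.2| `^ c) (tdisc w `^ c)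
  (N `^ (- (2 + c + d))) (N `^ (- (2 + 0 + d))) (4 `^ (2 + c + d))
  (e `^ (- (2 + c + d))).
move=> v1 v2 v3 v4 tc Nx Ny k E v10 v20 v30 v40 tc0 Nx0 Ny0 k0 Ek NxNy tcv.
apply: (@le_trans _ _ (tc * (k * Nx))); first by rewrite ler_wpM2l.
rewrite mulrCA (mulrC 10) -mulrA ler_wpM2l//.
have p1 := mulr_ge0 v10 Nx0; have p2 := mulr_ge0 v20 Nx0.
have p3 := mulr_ge0 v30 Nx0; have p4 := mulr_ge0 v40 Nx0.
have le v : tc <= v -> tc * Nx <= v * Nx by move=> ?; rewrite ler_wpM2r.
by case: tcv => [/le|[[/le|/le]|[/le|/le]]] h; lra.
Qed.

Lemma measurable_tdisc : measurable_fun setT (fun z : plane => tdisc z).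
Proof. by apply: measurable_funB => //; apply: measurable_funX; exact: measurable_cabs. Qed.

Lemma measurable_arc : measurable_fun setT (fun x : measurableTypeR R => arc x).
Proof.
rewrite /arc; apply: measurableT_comp; first by apply: continuous_measurable_fun; exact: sqrt_continuous.
by apply: measurable_funB => //; exact: measurable_funX.
Qed.

Definition fr_cst c d : R :=
  10 * 4 `^ (2 + c + d) * (plane_cst 0 d + 4 * plane_cst c d).

Lemma forelli_rudin_neg c d z : -1 < c -> c <= 0 -> 0 < d -> disc z ->
  (\int[mu2]_w (\1_(@disc R) w * (tdisc w `^ c * cden z w `^ (- (2 + c + d))))%:E <=
   (fr_cst c d * tdisc z `^ (- d))%:E)%E.
Proof.
move=> c1 c0 d0 zD; have t0 := tdisc_gt0 zD.
have marc := measurable_arc.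
have marcN : measurable_fun setT (fun x : measurableTypeR R => - arc x).
  exact: measurable_funN.
have m1 : measurable_fun setT (fun w : plane => w.1) by exact: measurable_fst.
have m2 : measurable_fun setT (fun w : plane => w.2) by exact: measurable_snd.
have mcomp (s : measurableTypeR R -> R) (u : plane -> measurableTypeR R) :
    measurable_fun setT s -> measurable_fun setT u ->
    measurable_fun setT (fun w => s (u w)).
  by move=> ms mu_; exact: measurableT_comp ms mu_.
pose B0 (w : plane) := bump 0 d (tdisc z) z w w.2 0.
pose B1 (w : plane) := bump c d (tdisc z) z w w.2 (arc w.1).
pose B2 (w : plane) := bump c d (tdisc z) z w w.2 (- arc w.1).
pose B3 (w : plane) := bump c d (tdisc z) z w w.1 (arc w.2).
pose B4 (w : plane) := bump c d (tdisc z) z w w.1 (- arc w.2).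
have mB0 : measurable_fun setT B0 by exact: measurable_bump.
have mB1 : measurable_fun setT B1.
  by apply: measurable_bump => //; exact: mcomp.
have mB2 : measurable_fun setT B2.
  apply: measurable_bump => //.
  by apply: (mcomp (fun x => - arc x)).
have mB3 : measurable_fun setT B3.
  by apply: measurable_bump => //; exact: mcomp.
have mB4 : measurable_fun setT B4.
  apply: measurable_bump => //.
  by apply: (mcomp (fun x => - arc x)).
have I0 := integral_bump_snd z (measurable_cst (0 : R)) (ltrN10 R) (lexx 0) d0 t0.
have I1 := integral_bump_snd z marc c1 c0 d0 t0.
have I2 := integral_bump_snd z marcN c1 c0 d0 t0.
have I3 := integral_bump_fst z marc c1 c0 d0 t0.
have I4 := integral_bump_fst z marcN c1 c0 d0 t0.
have B_ge0 w : [/\ 0 <= B0 w, 0 <= B1 w, 0 <= B2 w, 0 <= B3 w & 0 <= B4 w].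
  by split; exact: bump_ge0.
have [mS IS] := integralD5_le (And5 mB0 mB1 mB2 mB3 mB4) B_ge0 I0 I1 I2 I3 I4.
clear I0 I1 I2 I3 I4 mB0 mB1 mB2 mB3 mB4 mcomp m1 m2 marc marcN.
have S0 w : 0 <= B0 w + (B1 w + B2 w) + (B3 w + B4 w).
  by have [*] := B_ge0 w; rewrite !addr_ge0.
have k0 : 0 <= 10 * 4 `^ (2 + c + d) :> R by rewrite mulr_ge0// powR_ge0.
have := integralZ_le mS S0 k0 IS.
have -> : fr_cst c d * tdisc z `^ (- d) = 10 * 4 `^ (2 + c + d) *
   (plane_cst 0 d * tdisc z `^ (- d) +
    (plane_cst c d * tdisc z `^ (- d) + plane_cst c d * tdisc z `^ (- d)) +
    (plane_cst c d * tdisc z `^ (- d) + plane_cst c d * tdisc z `^ (- d))).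
  rewrite /fr_cst; move: (plane_cst 0 d) (plane_cst c d) (_ `^ _) (_ `^ _).
  by move=> *; ring.
apply: le_trans; apply: ae_le_lower_integral => [w|w|].
- rewrite lee_fin; apply: mulr_ge0; first by rewrite indicE.
  by apply: mulr_ge0; exact: powR_ge0.
- by rewrite lee_fin; exact: mulr_ge0 k0 (S0 w).
apply: aeW => w; rewrite lee_fin indicE.
have [/set_mem wD|_] := boolP (w \in _).
  by rewrite mul1r; exact: kernel_le_bumps.
by rewrite mul0r; exact: mulr_ge0 k0 (S0 w).
Qed.
End ForelliRudinIntegral.

(** * The measure mu_eta *)

Section Density.
Local Open Scope ereal_scope.
Context d (T : measurableType d) (R : realType).
Variables (m1 m2 : {measure set T -> \bar R}) (w : T -> R).
Hypotheses (mw : measurable_fun setT w) (w0 : forall x, (0 <= w x)%R).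
Hypothesis m1E : forall A, measurable A -> m1 A = \int[m2]_x ((w x)%:E * (\1_A x)%:E).
Import HBNNSimple.

(** Additivity extends the identity from sets to simple functions, monotone convergence to the
    rest. *)
Lemma ge0_integral_density (f : T -> \bar R) : measurable_fun setT f ->
  (forall x, 0 <= f x) ->
  \int[m1]_x f x = \int[m2]_x ((w x)%:E * f x).
Proof.
move=> mf f0.
have mwE : measurable_fun setT (EFin \o w) by exact/measurable_EFinP.
have simpleE (h : {nnsfun T >-> R}) :
    \int[m1]_x (h x)%:E = \int[m2]_x ((w x)%:E * (h x)%:E).
  have hE x : (h x)%:E = \sum_(y \in range h) (y%:E * (\1_(h @^-1` [set y]) x)%:E).
    by rewrite fimfunE -fsumEFin//.
  have term0 y x : 0 <= y%:E * (\1_(h @^-1` [set y]) x)%:E.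
    by rewrite -EFinM; exact: nnfun_muleindic_ge0.
  have mterm y : measurable_fun setT (fun x => y%:E * (\1_(h @^-1` [set y]) x)%:E).
    by apply: measurable_funeM; apply/measurable_EFinP; exact: measurable_indic.
  under eq_integral do rewrite hE.
  rewrite ge0_integral_fsum//.
  under [RHS]eq_integral do rewrite hE ge0_mule_fsumr//.
  rewrite ge0_integral_fsum//; last 2 first.
  - by move=> y; exact: emeasurable_funM.
  - by move=> y x _; rewrite mule_ge0 ?lee_fin//; exact: term0.
  apply: eq_fsbigr => y yh.
  have y0 : 0 <= y%:E by move: yh => /set_mem[x _ <-]; rewrite lee_fin.
  rewrite ge0_integralZl//; last first.
    by apply/measurable_EFinP; exact: measurable_indic.
  under [RHS]eq_integral do rewrite muleCA.
  rewrite ge0_integralZl//; last 2 first.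
  - by apply: emeasurable_funM => //; apply/measurable_EFinP; exact: measurable_indic.
  - by move=> x _; rewrite mule_ge0// lee_fin.
  by rewrite integral_indic// setIT m1E.
pose h := nnsfun_approx measurableT mf.
have hf x : (h n x)%:E @[n --> \oo] --> f x.
  by apply: cvg_nnsfun_approx.
have hnd x : {homo (fun n => (h n x)%:E) : n m / (n <= m)%N >-> n <= m}.
  by move=> n m nm; rewrite lee_fin; exact/lefP/nd_nnsfun_approx.
have L : \int[m1]_x (h n x)%:E @[n --> \oo] --> \int[m1]_x f x.
  rewrite (_ : \int[m1]_x f x = \int[m1]_x limn (fun n => (h n x)%:E)).
    apply: cvg_monotone_convergence => //.
    - by move=> n; apply/measurable_EFinP.
    - by move=> n x _; rewrite lee_fin.
  by apply: eq_integral => x _; apply/esym/cvg_lim.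
have M : \int[m2]_x ((w x)%:E * (h n x)%:E) @[n --> \oo] --> \int[m2]_x ((w x)%:E * f x).
  rewrite (_ : \int[m2]_x _ = \int[m2]_x limn (fun n => (w x)%:E * (h n x)%:E)).
    apply: cvg_monotone_convergence => //.
    - by move=> n; apply: emeasurable_funM => //; exact/measurable_EFinP.
    - by move=> n x _; rewrite mule_ge0// lee_fin.
    - by move=> x _ n m nm; apply: lee_wpmul2l; [rewrite lee_fin|exact: hnd].
  apply: eq_integral => x _; apply/esym/cvg_lim => //.
  exact: cvgeZl.
have L' : \int[m2]_x ((w x)%:E * (h n x)%:E) @[n --> \oo] --> \int[m1]_x f x.
  by under eq_fun do rewrite -simpleE.
exact: (cvg_unique _ L' M).
Qed.

End Density.

Section BergmanMeasure.
Context {R : realType}.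
Local Notation plane := (measurableTypeR R * measurableTypeR R)%type.
Local Notation mu := (@lebesgue_measure R).
Local Notation mu2 := (@lebesgue_measure R \x @lebesgue_measure R)%E.
Implicit Types (c d g eta : R) (z w : R * R).

Lemma measurable_indic_disc : measurable_fun setT (fun w : plane => \1_(@disc R) w : R).
Proof.
have mD : measurable (@disc R : set plane) by exact: measurable_disc.
exact: (@measurable_indic _ _ R).
Qed.

Lemma areaE (A : set plane) :
  area R A = (((pi : R)^-1)%:E * mu2 (A `&` @disc R))%E.
Proof. by []. Qed.

Lemma ge0_integral_area (f : plane -> \bar R) : measurable_fun setT f ->
  (forall w, 0 <= f w)%E ->
  (\int[area R]_w f w = \int[mu2]_w ((pi^-1 * \1_(@disc R) w)%:E * f w))%E.
Proof.
move=> mf f0; apply: ge0_integral_density => //.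
- exact: (measurable_funM _ measurable_indic_disc).
- by move=> w; rewrite mulr_ge0// invr_ge0 pi_ge0.
move=> A mA; rewrite areaE.
under eq_integral do rewrite -EFinM -mulrA EFinM.
rewrite ge0_integralZl//; last 2 first.
- apply/measurable_EFinP; apply: measurable_funM; first exact: measurable_indic_disc.
  exact: measurable_indic.
- by rewrite lee_fin invr_ge0 pi_ge0.
congr (_ * _)%E; rewrite -[LHS]integral_indic//; last exact: measurable_disc.
rewrite integral_mkcond; apply: eq_integral => w _; rewrite patchE !indicE.
by case: ifP => _; rewrite ?mul1r ?mul0r.
Qed.

Lemma measurable_density_real eta :
  measurable_fun setT (fun w : plane => density eta w).
Proof. by apply/measurable_EFinP; exact: (measurable_density eta). Qed.

Definition mu_eta_density eta w : R := pi^-1 * \1_(@disc R) w * density eta w.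

Lemma mu_eta_density_ge0 eta w : 0 <= mu_eta_density eta w.
Proof. by rewrite /mu_eta_density /density mulr_ge0// mulr_ge0// invr_ge0 pi_ge0. Qed.

Lemma measurable_mu_eta_density eta :
  measurable_fun setT (fun w : plane => mu_eta_density eta w).
Proof.
apply: measurable_funM; last exact: measurable_density_real.
exact: (measurable_funM _ measurable_indic_disc).
Qed.

Lemma ge0_integral_mu_eta eta (f : plane -> \bar R) : measurable_fun setT f ->
  (forall w, 0 <= f w)%E ->
  (\int[mu_eta eta]_w f w = \int[mu2]_w ((mu_eta_density eta w)%:E * f w))%E.
Proof.
move=> mf f0; apply: ge0_integral_density => //.
- exact: measurable_mu_eta_density.
- exact: mu_eta_density_ge0.
move=> A mA; rewrite -[LHS]/(\int[area R]_(w in A) (density eta w)%:E)%E.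
rewrite [LHS]integral_mkcond.
transitivity (\int[area R]_w ((density eta w)%:E * (\1_A w)%:E))%E.
  apply: eq_integral => w _; rewrite patchE indicE.
  by case: ifP => _; rewrite ?mule1 ?mule0.
rewrite ge0_integral_area//.
- by apply: eq_integral => w _; rewrite muleA -EFinM.
- apply: emeasurable_funM; first exact: measurable_density.
  by apply/measurable_EFinP; exact: measurable_indic.
- by move=> w; rewrite mule_ge0// lee_fin normr_ge0.
Qed.

Lemma mu_eta_dominates eta (A : set plane) : measurable A -> area R A = 0%E ->
  mu_eta eta A = 0%E.
Proof.
move=> mA A0; rewrite -[LHS]/(\int[area R]_(w in A) (density eta w)%:E)%E.
apply: null_set_integral => //.
exact: measurable_funS (measurable_density eta).
Qed.

Lemma ae_area_mu_eta eta (P : plane -> Prop) :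
  {ae area R, forall w, P w} -> {ae mu_eta eta, forall w, P w}.
Proof.
by move=> [N [mN N0 NP]]; exists N; split => //; exact: mu_eta_dominates.
Qed.

Lemma area_disc : {ae area R, forall w, disc w}.
Proof.
exists (~` @disc R); split => //.
- by apply: measurableC; exact: measurable_disc.
- by rewrite areaE setICl measure0 mule0.
Qed.

Lemma measurable_cden z : measurable_fun setT (fun w : plane => cden z w).
Proof.
have m1 : measurable_fun setT (fun w : plane => w.1) by exact: measurable_fst.
have m2 : measurable_fun setT (fun w : plane => w.2) by exact: measurable_snd.
rewrite /cden; apply: measurableT_comp; first by apply: continuous_measurable_fun; exact: sqrt_continuous.
apply: measurable_funD; apply: measurable_funX.
  apply: measurable_funB => //; apply: measurable_funD; exact: measurable_funM.
by apply: measurable_funB; exact: measurable_funM.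
Qed.

Lemma indic_powR_ge0 (w : plane) (u v c d : R) :
  0 <= \1_(@disc R) w * (u `^ c * v `^ d).
Proof. by apply: mulr_ge0; [rewrite indicE|apply: mulr_ge0; exact: powR_ge0]. Qed.

(** For [c > 0], the inequality [tdisc w <= 2 cden z w] absorbs [tdisc w ^ c] into the kernel, at
    the price [2^c], and leaves the case [c = 0]. *)
Lemma forelli_rudin c d : -1 < c -> 0 < d -> exists2 C : R, 0 <= C &
  forall z, disc z ->
  (\int[mu2]_w (\1_(@disc R) w * (tdisc w `^ c * cden z w `^ (- (2 + c + d))))%:E <=
   (C * tdisc z `^ (- d))%:E)%E.
Proof.
move=> c1 d0; have fr0 (k : R) : -1 < k -> 0 <= fr_cst k d.
  move=> k1; apply: mulr_ge0; first by apply: mulr_ge0 => //; exact: powR_ge0.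
  apply: addr_ge0; first by apply: plane_cst_ge0 => //; exact: ltrN10.
  by apply: mulr_ge0 => //; exact: plane_cst_ge0.
have [c0|c0] := leP c 0.
  by exists (fr_cst c d); [exact: fr0|move=> z; exact: forelli_rudin_neg].
exists (2 `^ c * fr_cst 0 d).
  by apply: mulr_ge0; [exact: powR_ge0|apply: fr0; exact: ltrN10].
move=> z zD; have := forelli_rudin_neg (ltrN10 R) (lexx 0) d0 zD.
set f := (fun w : plane => \1_(@disc R) w * (tdisc w `^ 0 * cden z w `^ (- (2 + 0 + d)))) => fle.
have f0 w : 0 <= f w by exact: indic_powR_ge0.
have mf : measurable_fun setT f.
  apply: measurable_funM; first exact: measurable_indic_disc.
  apply: measurable_funM; apply: measurable_powR_comp; first exact: measurable_tdisc.
  exact: measurable_cden.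
have := integralZ_le mf f0 (powR_ge0 2 c) fle; rewrite mulrA; apply: le_trans.
apply: ae_le_lower_integral => [w|w|].
- by rewrite lee_fin indic_powR_ge0.
- by rewrite lee_fin; apply: mulr_ge0 => //; exact: powR_ge0.
apply: aeW => w; rewrite lee_fin /f indicE.
have [/set_mem wD|_] := boolP (w \in _); last by rewrite !mul0r mulr0.
have e0 := cden_gt0 zD wD.
have twe : tdisc w <= 2 * cden z w.
  have := le_trans (kre_ge z w) (cden_ge_kre z w).
  have := tdisc_gt0 zD; move: (tdisc z) (tdisc w) (cden z w) => u v x *; lra.
have tw := ltW (tdisc_gt0 wD).
rewrite !mul1r powRr0 mul1r.
have -> : - (2 + 0 + d) = - (2 + c + d) + c by ring.
rewrite [X in _ <= _ * X]powRD; last by rewrite (gt_eqF e0) implybT.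
rewrite mulrCA mulrC ler_wpM2l ?powR_ge0// -powRM ?(ltW e0)//.
by apply: ge0_ler_powR; rewrite ?nnegrE ?(ltW c0)// mulr_ge0// ltW.
Qed.

(** Forelli-Rudin with [c = eta + g] and [d = - g]: then [2 + c + d = eta + 2], and the two bounds
    on [g] are [c > -1] and [d > 0]. *)
Lemma kernel_estimate eta g : -1 < eta -> - (eta + 1) < g -> g < 0 ->
  exists2 C : R, 0 <= C & forall z, disc z ->
  (\int[mu_eta eta]_w
     (\1_(@disc R) w * (tdisc w `^ g * cden z w `^ (- (eta + 2))))%:E <=
   (C * tdisc z `^ g)%:E)%E.
Proof.
move=> eta1 g1 g0; have c1 : -1 < eta + g by lra.
have d0 : 0 < - g by rewrite oppr_gt0.
have [C C0 fr] := forelli_rudin c1 d0.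
pose k : R := pi^-1 * (eta + 1).
have k0 : 0 <= k by rewrite mulr_ge0 ?invr_ge0 ?pi_ge0//; lra.
exists (k * C); first by rewrite mulr_ge0.
move=> z zD; have := fr z zD; rewrite opprK.
set f := (fun w : plane => \1_(@disc R) w * (tdisc w `^ (eta + g) * cden z w `^ (- (2 + (eta + g) - g)))) => fle.
have f0 w : 0 <= f w by exact: indic_powR_ge0.
have mt := measurable_tdisc; have mc := measurable_cden z.
have mf : measurable_fun setT f.
  apply: measurable_funM; first exact: measurable_indic_disc.
  by apply: measurable_funM; apply: measurable_powR_comp.
rewrite ge0_integral_mu_eta; last 2 first.
- apply/measurable_EFinP; apply: measurable_funM; first exact: measurable_indic_disc.
  by apply: measurable_funM; apply: measurable_powR_comp.
- by move=> w; rewrite lee_fin indic_powR_ge0.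
have := integralZ_le mf f0 k0 fle; rewrite -mulrA; apply: le_trans.
apply: ae_le_lower_integral => [w|w|].
- by rewrite mule_ge0// lee_fin ?mu_eta_density_ge0// indic_powR_ge0.
- by rewrite lee_fin; apply: mulr_ge0 => //; exact: powR_ge0.
apply: aeW => w; rewrite -EFinM lee_fin /f /mu_eta_density indicE.
have [/set_mem wD|_] := boolP (w \in _); last by rewrite !(mulr0, mul0r).
have tw := tdisc_gt0 wD; rewrite /density ger0_norm; last first.
  by rewrite mulr_ge0 ?powR_ge0//; lra.
rewrite powRD; last by rewrite (gt_eqF tw) implybT.
have -> : - (2 + (eta + g) - g) = - (eta + 2) by ring.
rewrite /k !mulr1 !mul1r; move: (tdisc w `^ eta) (tdisc w `^ g) (cden z w `^ _).
by move=> u v y; rewrite le_eqVlt; apply/orP; left; apply/eqP; ring.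
Qed.

(** Forelli-Rudin at [z = 0], where the kernel is 1; the choice [d = 1] is arbitrary. *)
Lemma mu_eta_finite eta : -1 < eta -> (mu_eta eta setT < +oo)%E.
Proof.
move=> eta1; have [C C0 fr] := forelli_rudin eta1 ltr01.
have zD : disc (0 : R, 0 : R) by rewrite /disc/= /cabs/= expr0n/= addr0 sqrtr0.
have {fr} := fr _ zD.
set f := (fun w : plane =>
  \1_(@disc R) w * (tdisc w `^ eta * cden (0, 0) w `^ (- (2 + eta + 1)))) => fle.
have cden0 w : cden (0, 0) w = 1.
  by rewrite /cden /kre /kim/= !mulr0 !subr0 addr0 subr0 expr0n/= addr0 expr1n sqrtr1.
have mt := measurable_tdisc; have mc := measurable_cden (0, 0).
rewrite -[X in mu_eta eta X]/(setT : set plane) -[ltLHS]mul1e -integral_cst//.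
rewrite ge0_integral_mu_eta//.
pose k : R := pi^-1 * (eta + 1).
have k0 : 0 <= k by rewrite mulr_ge0 ?invr_ge0 ?pi_ge0//; lra.
have f0 w : 0 <= f w by exact: indic_powR_ge0.
have mf : measurable_fun setT f.
  apply: measurable_funM; first exact: measurable_indic_disc.
  by apply: measurable_funM; apply: measurable_powR_comp.
apply: le_lt_trans (ltry (k * (C * tdisc (0, 0) `^ (- 1)))).
apply: le_trans (integralZ_le mf f0 k0 fle).
apply: ae_le_lower_integral => [w|w|].
- by rewrite mule_ge0// lee_fin mu_eta_density_ge0.
- by rewrite lee_fin; exact: mulr_ge0.
apply: aeW => w; rewrite /= mule1 lee_fin /f /mu_eta_density indicE.
have [/set_mem wD|_] := boolP (w \in _); last by rewrite !(mulr0, mul0r).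
rewrite cden0 powR1 /density ger0_norm; last first.
  by rewrite mulr_ge0 ?powR_ge0//; lra.
by rewrite /k !mulr1 mul1r mulrA.
Qed.

End BergmanMeasure.

(** * Schur test *)

Section Schur.
Local Open Scope ereal_scope.
Context d (T : measurableType d) (R : realType).

Lemma hoelder_integral (mu : {measure set T -> \bar R}) (f g : T -> R) (p q : R) :
  measurable_fun setT f -> measurable_fun setT g ->
  (forall x, (0 <= f x)%R) -> (forall x, (0 <= g x)%R) ->
  (0 < p)%R -> (0 < q)%R -> (p^-1 + q^-1 = 1)%R ->
  (\int[mu]_x (f x * g x)%:E) `^ p <=
  (\int[mu]_x (f x `^ q)%:E) `^ (p / q) * \int[mu]_x (g x `^ p)%:E.
Proof.
move=> mf mg f0 g0 p0 q0 pq.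
have normE (r : R) (h : T -> R) : (forall x, (0 <= h x)%R) -> (0 < r)%R ->
    Lnorm mu r%:E (EFin \o h) `^ r = \int[mu]_x (h x `^ r)%:E.
  move=> h0 r0; have rn0 : (r != 0)%R by rewrite (gt_eqF r0).
  rewrite (poweR_Lnorm _ _ rn0); apply: eq_integral => x _.
  by rewrite /= ger0_norm ?poweR_EFin.
have qp : (q^-1 + p^-1 = 1)%R by rewrite addrC.
have := hoelder mu mf mg q0 p0 qp; rewrite Lnorm1 => H.
have : (\int[mu]_x `|(EFin \o (f \* g)%R) x|) `^ p <=
    (Lnorm mu q%:E (EFin \o f) * Lnorm mu p%:E (EFin \o g)) `^ p.
  apply: gt0_ler_poweR => //; first exact: ltW.
  - by rewrite in_itv/= leey andbT integral_ge0// => x _; exact: abse_ge0.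
  - by rewrite in_itv/= leey andbT mule_ge0// Lnorm_ge0.
rewrite poweRM ?Lnorm_ge0// normE// (_ : _ `^ p = (\int[mu]_x (f x * g x)%:E) `^ p); last first.
  congr (_ `^ _); apply: eq_integral => x _.
  by rewrite /= ger0_norm// mulr_ge0.
move=> /le_trans; apply; rewrite le_eqVlt; apply/orP; left; apply/eqP; congr (_ * _).
by rewrite -normE// -poweRrM mulrCA mulfV ?gt_eqF// mulr1.
Qed.

Variable mu : {sigma_finite_measure set T -> \bar R}.

(** Hoelder's inequality for [k f = (k^(1/q) h) (k^(1/p) f / h)] bounds the inner integral; the
    first hypothesis evaluates one factor, and Tonelli followed by the second hypothesis the
    other. *)
Lemma schur_test (k : T * T -> R) (h : T -> R) (p q C1 C2 : R) :
  (0 < p)%R -> (0 < q)%R -> (p^-1 + q^-1 = 1)%R ->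
  measurable_fun setT k -> measurable_fun setT h ->
  (forall u, (0 <= k u)%R) -> (forall x, (0 < h x)%R) ->
  (0 <= C1)%R -> (0 <= C2)%R ->
  (forall x, \int[mu]_y (k (x, y) * h y `^ q)%:E <= (C1 * h x `^ q)%:E) ->
  (forall y, \int[mu]_x (k (x, y) * h x `^ p)%:E <= (C2 * h y `^ p)%:E) ->
  forall f : T -> R, measurable_fun setT f -> (forall x, (0 <= f x)%R) ->
  \int[mu]_x (\int[mu]_y (k (x, y) * f y)%:E) `^ p <=
  (C1 `^ (p / q) * C2)%:E * \int[mu]_x (f x `^ p)%:E.
Proof.
move=> p0 q0 pq mk mh k0 h0 C10 C20 H1 H2 f mf f0.
have mkx x : measurable_fun setT (fun y => k (x, y)) by exact: measurableT_comp.
have mky y : measurable_fun setT (fun x => k (x, y)) by exact: measurableT_comp.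
have mhV : measurable_fun setT (fun y => (h y)^-1%R).
  have -> : (fun y => (h y)^-1%R) = (fun y => h y `^ (-1))%R.
    by apply/funext => y; rewrite powR_inv1// ltW.
  exact: measurable_powR_comp.
(* This is [(f / h)^p]; the factor [h^p] appearing in [G] is what the first hypothesis leaves
   outside the inner integral. *)
pose g y := (h y `^ (- p) * f y `^ p)%R.
have g0 y : (0 <= g y)%R by rewrite mulr_ge0 ?powR_ge0.
have mg : measurable_fun setT g by apply: measurable_funM; exact: measurable_powR_comp.
pose G (u : T * T) := (h u.1 `^ p * (k u * g u.2))%R.
have G0 u : (0 <= G u)%R by rewrite !mulr_ge0 ?powR_ge0.
have mG : measurable_fun setT (EFin \o G).
  apply/measurable_EFinP; apply: measurable_funM.
    by apply: measurable_powR_comp; exact: measurableT_comp.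
  by apply: measurable_funM => //; exact: measurableT_comp.
have step1 x : (\int[mu]_y (k (x, y) * f y)%:E) `^ p <=
    (C1 `^ (p / q))%:E * \int[mu]_y (G (x, y))%:E.
  have -> : \int[mu]_y (k (x, y) * f y)%:E = \int[mu]_y
      ((k (x, y) `^ q^-1 * h y) * (k (x, y) `^ p^-1 * ((h y)^-1 * f y)))%:E.
    apply: eq_integral => y _; congr EFin.
    rewrite mulrACA -powRD; last by rewrite addrC pq oner_eq0.
    by rewrite (addrC (q^-1)%R) pq powRr1// mulVKf// gt_eqF.
  apply: le_trans.
    apply: (@hoelder_integral mu (fun y => (k (x, y) `^ q^-1 * h y)%R)
      (fun y => (k (x, y) `^ p^-1 * ((h y)^-1 * f y))%R) p q) => //.
    - by apply: measurable_funM => //; exact: measurable_powR_comp.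
    - apply: measurable_funM; first exact: measurable_powR_comp.
      exact: measurable_funM.
    - by move=> y; rewrite mulr_ge0 ?powR_ge0// ltW.
    - by move=> y; rewrite !mulr_ge0 ?powR_ge0 ?invr_ge0// ltW.
  have -> : \int[mu]_y ((k (x, y) `^ q^-1 * h y) `^ q)%:E =
      \int[mu]_y (k (x, y) * h y `^ q)%:E.
    apply: eq_integral => y _; rewrite powRM ?powR_ge0 ?(ltW (h0 y))//.
    by rewrite -powRrM mulVf ?gt_eqF// powRr1.
  have -> : \int[mu]_y ((k (x, y) `^ p^-1 * ((h y)^-1 * f y)) `^ p)%:E =
      \int[mu]_y (k (x, y) * g y)%:E.
    apply: eq_integral => y _; rewrite powRM ?powR_ge0//; last first.
      by rewrite mulr_ge0// invr_ge0 ltW.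
    rewrite -powRrM mulVf ?gt_eqF// powRr1// powRM ?invr_ge0 ?(ltW (h0 y))//.
    by rewrite powR_inv ?(ltW (h0 y)).
  have -> : \int[mu]_y (G (x, y))%:E = (h x `^ p)%:E * \int[mu]_y (k (x, y) * g y)%:E.
    rewrite -ge0_integralZl//.
    - exact/measurable_EFinP/measurable_funM.
    - by move=> y _; rewrite lee_fin mulr_ge0.
    - by rewrite lee_fin powR_ge0.
  rewrite muleA; apply: lee_wpmul2r.
    by apply: integral_ge0 => y _; rewrite lee_fin mulr_ge0.
  have -> : (C1 `^ (p / q))%:E * (h x `^ p)%:E = (C1 * h x `^ q)%:E `^ (p / q).
    rewrite poweR_EFin powRM ?powR_ge0// EFinM -(powRrM (h x)).
    by rewrite (mulrC p) mulrA mulfV ?gt_eqF// mul1r.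
  apply: gt0_ler_poweR; last exact: H1.
  - by rewrite divr_ge0// ltW.
  - rewrite in_itv/= leey andbT; apply: integral_ge0 => y _.
    by rewrite lee_fin mulr_ge0// powR_ge0.
  - by rewrite in_itv/= leey andbT lee_fin mulr_ge0// powR_ge0.
apply: (@le_trans _ _ (\int[mu]_x ((C1 `^ (p / q))%:E * \int[mu]_y (G (x, y))%:E))).
  apply: ae_le_lower_integral => [x|x|].
  - exact: poweR_ge0.
  - rewrite mule_ge0//; first by rewrite lee_fin powR_ge0.
    by apply: integral_ge0 => y _; rewrite lee_fin.
  by apply: aeW => x; exact: step1.
rewrite ge0_integralZl//; last 3 first.
- exact: (measurable_fun_fubini_tonelli_F (m2 := mu) (EFin \o G)).
- by move=> x _; apply: integral_ge0 => y _; rewrite lee_fin.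
- by rewrite lee_fin powR_ge0.
rewrite EFinM -muleA; apply: lee_wpmul2l; first by rewrite lee_fin powR_ge0.
rewrite (fubini_tonelli (m1 := mu) (m2 := mu) (EFin \o G))//.
rewrite -ge0_integralZl//; last 2 first.
- exact/measurable_EFinP/measurable_powR_comp.
- by move=> y _; rewrite lee_fin powR_ge0.
apply: ae_le_lower_integral => [y|y|].
- by apply: integral_ge0 => x _; rewrite lee_fin.
- by rewrite mule_ge0// lee_fin ?powR_ge0.
apply: aeW => y.
have -> : \int[mu]_x (EFin \o G) (x, y) =
    (g y)%:E * \int[mu]_x (k (x, y) * h x `^ p)%:E.
  rewrite -ge0_integralZl//.
  - by apply: eq_integral => x _; rewrite /= /G -EFinM; congr EFin => /=; ring.
  - by apply/measurable_EFinP; apply: measurable_funM => //; exact: measurable_powR_comp.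
  - by move=> x _; rewrite lee_fin mulr_ge0// powR_ge0.
  - by rewrite lee_fin.
apply: (@le_trans _ _ ((g y)%:E * (C2 * h y `^ p)%:E)).
  by apply: lee_wpmul2l; [rewrite lee_fin|exact: H2].
rewrite -!EFinM lee_fin /g powRN le_eqVlt; apply/orP; left; apply/eqP.
by field; rewrite gt_eqF// powR_gt0.
Qed.

End Schur.

(** * The Schur test for the Bergman kernel *)

Section BergmanSchur.
Context {R : realType}.
Local Notation plane := (measurableTypeR R * measurableTypeR R)%type.
Implicit Types (z w : R * R).

(** Tonelli takes a bundled sigma-finite measure, and finiteness of [mu_eta] depends on [-1 < eta];
    hence a separate bundled object with the same values. *)
Lemma mu_eta_sigma_finite (eta : R) : -1 < eta ->
  exists m : {sigma_finite_measure set plane -> \bar R},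
    (m : set plane -> \bar R) = mu_eta eta.
Proof.
move=> eta1.
pose M : {measure set plane -> \bar R} := mu_eta eta.
have sf : sigma_finite setT M.
  apply: (@fin_num_fun_sigma_finite _ plane R M); first by rewrite measure0.
  by move=> A mA; exact: (finite_mass (mu_eta_finite eta1) mA).
pose mM := Measure_isSigmaFinite.Build _ plane R M sf.
pose m : {sigma_finite_measure set plane -> \bar R} := HB.pack (mu_eta eta) mM.
by exists m.
Qed.

Lemma cdenC z w : cden z w = cden w z.
Proof.
congr Num.sqrt; rewrite /kre /kim; congr (_ + _); last by rewrite -sqrrN; congr (_ ^+ 2); ring.
by congr (_ ^+ 2); ring.
Qed.

Lemma measurable_cden2 : measurable_fun setT (fun u : plane * plane => cden u.1 u.2).
Proof.
have m1 : measurable_fun setT (fun u : plane * plane => u.1) by exact: measurable_fst.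
have m2 : measurable_fun setT (fun u : plane * plane => u.2) by exact: measurable_snd.
have m11 : measurable_fun setT (fun u : plane * plane => u.1.1) by exact: measurableT_comp.
have m12 : measurable_fun setT (fun u : plane * plane => u.1.2) by exact: measurableT_comp.
have m21 : measurable_fun setT (fun u : plane * plane => u.2.1) by exact: measurableT_comp.
have m22 : measurable_fun setT (fun u : plane * plane => u.2.2) by exact: measurableT_comp.
rewrite /cden; apply: measurableT_comp; first by apply: continuous_measurable_fun; exact: sqrt_continuous.
apply: measurable_funD; apply: measurable_funX.
  apply: measurable_funB => //; apply: measurable_funD; exact: measurable_funM.
by apply: measurable_funB; exact: measurable_funM.
Qed.

(* [tdisc] made positive off the disc, where [powR] would meet the base 0. *)
Definition tpos z : R := if 0 < tdisc z then tdisc z else 1.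

Lemma tpos_gt0 z : 0 < tpos z.
Proof. by rewrite /tpos; case: ifP. Qed.

Lemma tposE z : disc z -> tpos z = tdisc z.
Proof. by move=> zD; rewrite /tpos tdisc_gt0. Qed.

Lemma measurable_tpos : measurable_fun setT (fun z : plane => tpos z).
Proof.
have mt := @measurable_tdisc R.
by apply: measurable_fun_ifT => //; exact: measurable_fun_ltr.
Qed.

Definition kabs (eta : R) z w : R := \1_(@disc R) w * cden z w `^ (- (eta + 2)).

Lemma kabs_ge0 eta z w : 0 <= kabs eta z w.
Proof. by rewrite mulr_ge0 ?powR_ge0. Qed.

(** These are the ranges required by [kernel_estimate] in the two Schur conditions for the test
    function [t^-s]. With [A = al / p] and [S = s p] they read
    [-A (p - 1) < S < (eta + 1 - A) (p - 1)] and [A < S < eta + 1 + A]. The crosswise comparisons of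
    endpoints are the two bounds on [al]; the others follow from [eta > -1]. *)
Lemma schur_exponent (p eta al : R) : 1 < p -> -1 < eta ->
  - (eta + 1) < al -> al < (p - 1) * (eta + 1) ->
  exists s : R, [/\ - (eta + 1) < - (al / p) - s * (p / (p - 1)),
    - (al / p) - s * (p / (p - 1)) < 0,
    - (eta + 1) < al / p - s * p & al / p - s * p < 0].
Proof.
move=> p1 eta1 al1 al2; have p0 : 0 < p by lra.
have pn0 : p != 0 by rewrite gt_eqF.
have p10 : 0 < p - 1 by lra.
have p1n0 : p - 1 != 0 by rewrite gt_eqF.
pose A := al / p; have alE : al = A * p by rewrite /A divfK.
rewrite -/A; clearbody A; subst al.
(* multiplying the first two conditions by [p - 1] clears denominators *)
pose lo := Num.max (- A * (p - 1)) A; pose hi := Num.min ((eta + 1 - A) * (p - 1)) (eta + 1 + A).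
have lohi : lo < hi.
  rewrite gt_max !lt_min; apply/andP; split; apply/andP; split; nra.
exists ((lo + hi) / 2 / p).
have h1 : - A * (p - 1) <= lo by rewrite le_max lexx.
have h2 : A <= lo by rewrite le_max lexx orbT.
have h3 : hi <= (eta + 1 - A) * (p - 1) by rewrite ge_min lexx.
have h4 : hi <= eta + 1 + A by rewrite ge_min lexx orbT.
have E1 : - A - (lo + hi) / 2 / p * (p / (p - 1)) =
    (- A * (p - 1) - (lo + hi) / 2) / (p - 1) by field; rewrite pn0 p1n0.
have E2 : A - (lo + hi) / 2 / p * p = A - (lo + hi) / 2 by field.
rewrite E1 E2; split; [|by rewrite pmulr_llt0 ?invr_gt0//; lra|lra|lra].
by rewrite ltr_pdivlMr//; lra.
Qed.

Lemma bergman_abs_bound (p eta al : R) : 1 < p -> -1 < eta ->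
  - (eta + 1) < al -> al < (p - 1) * (eta + 1) ->
  exists2 C : R, 0 <= C & forall f : plane -> R,
  measurable_fun setT f -> (forall w, 0 <= f w) ->
  (\int[mu_eta eta]_z ((\1_(@disc R) z * tpos z `^ (al / p))%:E *
      \int[mu_eta eta]_w (kabs eta z w * f w)%:E) `^ p <=
   C%:E * \int[mu_eta eta]_w (\1_(@disc R) w * (tpos w `^ (al / p) * f w) `^ p)%:E)%E.
Proof.
move=> p1 eta1 al1 al2; have [s [s1 s2 s3 s4]] := schur_exponent p1 eta1 al1 al2.
pose q := p / (p - 1).
have p0 : 0 < p by lra.
have p10 : 0 < p - 1 by lra.
have q0 : 0 < q by rewrite divr_gt0.
have pq : p^-1 + q^-1 = 1.
  by rewrite /q; field; rewrite !gt_eqF.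
have [m mE] := mu_eta_sigma_finite eta1.
have [C1 C10 K1] := kernel_estimate eta1 s1 s2.
have [C2 C20 K2] := kernel_estimate eta1 s3 s4.
rewrite -mE in K1 K2 *.
have mD := @measurable_indic_disc R; have mtp := measurable_tpos.
have fst_m (g : plane -> R) : measurable_fun setT g -> measurable_fun setT (fun u : plane * plane => g u.1).
  by move=> mg; apply: measurableT_comp mg _; exact: measurable_fst.
have snd_m (g : plane -> R) : measurable_fun setT g -> measurable_fun setT (fun u : plane * plane => g u.2).
  by move=> mg; apply: measurableT_comp mg _; exact: measurable_snd.
(* Conjugation by [t^(al / p)] moves the weight into the kernel, so that the test runs on the
   unweighted space. *)
pose k (u : plane * plane) := (\1_(@disc R) u.1 * tpos u.1 `^ (al / p)) *
  (\1_(@disc R) u.2 * tpos u.2 `^ (- (al / p))) * cden u.1 u.2 `^ (- (eta + 2)).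
pose h (z : plane) := tpos z `^ (- s).
have mk : measurable_fun setT k.
  apply: measurable_funM; last by apply: measurable_powR_comp; exact: measurable_cden2.
  apply: measurable_funM.
    apply: (fst_m (fun z => \1_(@disc R) z * tpos z `^ (al / p))).
    by apply: measurable_funM => //; exact: measurable_powR_comp.
  apply: (snd_m (fun z => \1_(@disc R) z * tpos z `^ (- (al / p)))).
  by apply: measurable_funM => //; exact: measurable_powR_comp.
have mh : measurable_fun setT h by exact: measurable_powR_comp.
have i0 (z : plane) : 0 <= \1_(@disc R) z :> R by rewrite indicE.
have k0 u : 0 <= k u.
  apply: mulr_ge0; last exact: powR_ge0.
  by apply: mulr_ge0; apply: mulr_ge0 => //; exact: powR_ge0.
have h0 z : 0 < h z by apply: powR_gt0; exact: tpos_gt0.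
have powD (x y : R) z : tpos z `^ x * tpos z `^ y = tpos z `^ (x + y).
  by rewrite powRD// (gt_eqF (tpos_gt0 z)) implybT.
have H1 z : (\int[m]_w (k (z, w) * h w `^ q)%:E <= (C1 * h z `^ q)%:E)%E.
  have [zD|zD] := pselect (disc z); last first.
    rewrite integral0_eq; first by rewrite lee_fin mulr_ge0 ?powR_ge0.
    by move=> w _; rewrite /k/= indicE memNset// !mul0r.
  have -> : (\int[m]_w (k (z, w) * h w `^ q)%:E)%E = ((tpos z `^ (al / p))%:E *
      \int[m]_w (\1_(@disc R) w * (tdisc w `^ (- (al / p) - s * q) *
        cden z w `^ (- (eta + 2))))%:E)%E.
    rewrite -ge0_integralZl//.
    - apply: eq_integral => w _; rewrite -EFinM; congr EFin.
      rewrite /k/= indicE mem_set// mul1r indicE.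
      have [/set_mem wD|_] := boolP (w \in _); last by rewrite !mul0r !mulr0 !mul0r.
      rewrite !mul1r /h -powRrM -(tposE wD) mulNr -powD.
      by move: (tpos z `^ _) (tpos w `^ _) (tpos w `^ _) (cden z w `^ _) => *; ring.
    - apply/measurable_EFinP; apply: measurable_funM; first exact: measurable_indic_disc.
      apply: measurable_funM; apply: measurable_powR_comp; first exact: measurable_tdisc.
      exact: measurable_cden.
    - by move=> w _; rewrite lee_fin indic_powR_ge0.
    - by rewrite lee_fin powR_ge0.
  apply: (@le_trans _ _ ((tpos z `^ (al / p))%:E * (C1 * tdisc z `^ (- (al / p) - s * q))%:E)%E).
    by apply: lee_wpmul2l; [rewrite lee_fin powR_ge0|exact: K1].
  rewrite -EFinM lee_fin mulrCA -(tposE zD) powD /h -powRrM.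
  by rewrite (_ : al / p + _ = - s * q)//; ring.
have H2 w : (\int[m]_z (k (z, w) * h z `^ p)%:E <= (C2 * h w `^ p)%:E)%E.
  have [wD|wD] := pselect (disc w); last first.
    rewrite integral0_eq; first by rewrite lee_fin mulr_ge0 ?powR_ge0.
    by move=> z _; rewrite /k/= !indicE [w \in _]memNset// mul0r mulr0 !mul0r.
  have -> : (\int[m]_z (k (z, w) * h z `^ p)%:E)%E = ((tpos w `^ (- (al / p)))%:E *
      \int[m]_z (\1_(@disc R) z * (tdisc z `^ (al / p - s * p) *
        cden w z `^ (- (eta + 2))))%:E)%E.
    rewrite -ge0_integralZl//.
    - apply: eq_integral => z _; rewrite -EFinM; congr EFin.
      rewrite /k/= !indicE [w \in _]mem_set// cdenC.
      have [/set_mem zD|_] := boolP (z \in _); last by rewrite !(mul0r, mulr0).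
      rewrite !mul1r /h -powRrM -(tposE zD) mulNr -powD.
      by move: (tpos z `^ _) (tpos z `^ _) (tpos w `^ _) (cden w z `^ _) => *; ring.
    - apply/measurable_EFinP; apply: measurable_funM; first exact: measurable_indic_disc.
      apply: measurable_funM; apply: measurable_powR_comp; first exact: measurable_tdisc.
      exact: measurable_cden.
    - by move=> z _; rewrite lee_fin indic_powR_ge0.
    - by rewrite lee_fin powR_ge0.
  apply: (@le_trans _ _ ((tpos w `^ (- (al / p)))%:E * (C2 * tdisc w `^ (al / p - s * p))%:E)%E).
    by apply: lee_wpmul2l; [rewrite lee_fin powR_ge0|exact: K2].
  rewrite -EFinM lee_fin mulrCA -(tposE wD) powD /h -powRrM.
  by rewrite (_ : - (al / p) + _ = - s * p)//; ring.
exists (C1 `^ (p / q) * C2); first by apply: mulr_ge0 => //; exact: powR_ge0.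
move=> f mf f0.
have mg : measurable_fun setT (fun w : plane => \1_(@disc R) w * (tpos w `^ (al / p) * f w)).
  by apply: measurable_funM => //; apply: measurable_funM => //; exact: measurable_powR_comp.
have g0 (w : plane) : 0 <= \1_(@disc R) w * (tpos w `^ (al / p) * f w).
  by apply: mulr_ge0 => //; apply: mulr_ge0 => //; exact: powR_ge0.
have := schur_test p0 q0 pq mk mh k0 h0 C10 C20 H1 H2 mg g0.
have -> : (\int[m]_x ((\1_(@disc R) x * (tpos x `^ (al / p) * f x)) `^ p)%:E =
    \int[m]_w (\1_(@disc R) w * (tpos w `^ (al / p) * f w) `^ p)%:E)%E.
  apply: eq_integral => w _; rewrite indicE; case: (w \in _); first by rewrite !mul1r.
  by rewrite !mul0r powR0// gt_eqF.
have -> // : (\int[m]_x (\int[m]_y (k (x, y) * (\1_(@disc R) y * (tpos y `^ (al / p) * f y)))%:E) `^ p =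
  \int[m]_z ((\1_(@disc R) z * tpos z `^ (al / p))%:E *
      \int[m]_w (kabs eta z w * f w)%:E) `^ p)%E.
apply: eq_integral => z _; congr (_ `^ p)%E.
rewrite -ge0_integralZl//.
- apply: eq_integral => w _; rewrite -EFinM; congr EFin; rewrite /k /kabs /= !indicE.
  have [_|_] := boolP (w \in _); last by rewrite !(mul0r, mulr0).
  rewrite !mul1r; have := powD (- (al / p)) (al / p) w; rewrite addNr powRr0.
  move: (tpos z `^ (al / p)) (tpos w `^ (- (al / p))) (tpos w `^ (al / p))
    (cden z w `^ _) (_%:R) (f w) => x y y' c i v yy.
  by rewrite -[RHS]mul1r -yy; ring.
- apply/measurable_EFinP; apply: measurable_funM => //; apply: measurable_funM => //.
  by apply: measurable_powR_comp; exact: measurable_cden.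
- by move=> w _; rewrite lee_fin mulr_ge0// kabs_ge0.
- by rewrite lee_fin; apply: mulr_ge0 => //; exact: powR_ge0.
Qed.

End BergmanSchur.

(** * Direct sums and scalar comparability *)

Section DirectSumFacts.
Context {R : realType} {K : hilbertType R}.
Local Open Scope complex_scope.

Lemma nonzero_space_pair : nonzero_space K -> nonzero_space (K * K)%type.
Proof. by move=> [k k0]; exists (k, 0); apply: contraNneq k0 => -[->]. Qed.

(** Pairs from the dense sequence, enumerated through the countable encoding of [nat * nat]; a
    number encoding no pair is sent to 0. *)
Lemma separable_pair : separable K -> separable (K * K)%type.
Proof.
move=> [e esep]; exists (fun n => if @choice.unpickle (nat * nat)%type n is Some (i, j) then (e i, e j) else 0).
move=> [x y] eps eps0; have e2 : 0 < eps / 2 by rewrite divr_gt0.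
have [i xi] := esep x _ e2; have [j yj] := esep y _ e2.
exists (choice.pickle (i, j)); rewrite choice.pickleK.
rewrite (le_lt_trans (hnorm_pair_le _))//=.
by rewrite (splitr eps) ltrD.
Qed.

Lemma infinite_dim_pair : infinite_dim K -> infinite_dim (K * K)%type.
Proof.
move=> Kinf n; have [e efree] := Kinf n.
exists (fun i => (e i, 0)) => c ce0; apply: efree.
have sum1 (I : Type) (r : seq I) (F : I -> K * K) : (\sum_(i <- r) F i).1 = \sum_(i <- r) (F i).1.
  by elim/big_rec2: _ => // i x y _ <-.
by have := congr1 fst ce0; rewrite sum1.
Qed.

End DirectSumFacts.

(** * Failure of scalar comparability *)

Section NotComparable.
Context {R : realType} {K : hilbertType R}.
Local Notation plane := (measurableTypeR R * measurableTypeR R)%type.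
Local Notation mu := (@lebesgue_measure R).

(** A rectangle close to the boundary point [(1, 0)]: its area is a product of lengths, hence
    positive. *)
Definition rim (r : R) : set plane := `]1 - 2 * r, 1 - r[%classic `*` `]- r, r[%classic.

Lemma rim_sub (r : R) z : 0 < r -> r <= 4^-1 -> rim r z ->
  disc z /\ tdisc z <= 4 * r.
Proof.
move=> r0 r4 [/=]; rewrite !in_itv/= => /andP[x1 x2] /andP[y1 y2].
have t0 : 0 < tdisc z.
  by rewrite tdiscE; move: z.1 z.2 x1 x2 y1 y2 => x y *; nra.
split; last first.
  by rewrite tdiscE; move: z.1 z.2 x1 x2 y1 y2 => x y *; nra.
rewrite /disc/= -(@ltr_pXn2r _ 2%N) ?nnegrE ?sqrtr_ge0// expr1n.
by rewrite -subr_gt0.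
Qed.

Lemma rim_area (r : R) : 0 < r -> r <= 4^-1 -> (0 < area R (rim r))%E.
Proof.
move=> r0 r4; rewrite areaE setIidl; last by move=> z /rim_sub[].
rewrite mule_gt0//; first by rewrite lte_fin invr_gt0 pi_gt0.
rewrite product_measure1E; [|exact: measurable_itv|exact: measurable_itv].
have len (x y : R) : x < y -> (0 < mu `]x, y[%classic)%E.
  by move=> xy; rewrite lebesgue_measure_itv/= lte_fin xy lte_fin subr_gt0.
by apply: mule_gt0; apply: len; lra.
Qed.

Lemma not_scalar_comparable (p a b : R) : 1 < p -> nonzero_space K -> a < b ->
  ~ scalar_comparable (@opW R K p a b).
Proof.
move=> p1 K0 ab [w [_ _ [c [C0 [c0 C00 [N [mN N0 Nw]]]]]]].
(* Chosen so that [t <= u] forces [t^(b - a) <= c / (2 C0)], which contradicts [c t^a <= C0 t^b]. As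
   [tdisc <= 4 r] on the rim, [r] is at most [u / 4]. *)
pose u := (c / C0 / 2) `^ (b - a)^-1.
have cC : 0 < c / C0 / 2 by rewrite !divr_gt0.
have u0 : 0 < u by exact: powR_gt0.
pose r := Num.min 1 u / 4.
have r0 : 0 < r by rewrite divr_gt0// lt_min ltr01.
have r4 : r <= 4^-1 by rewrite ler_pdivrMr// mulVf// ge_min lexx.
(* The comparison holds off a null set, which cannot contain a rim of positive area. *)
have [z zr zN] : exists2 z, rim r z & ~ N z.
  apply: contrapT => h; have sub : rim r `<=` N.
    by move=> z zr; apply: contrapT => zN; apply: h; exists z.
  have := rim_area r0 r4; rewrite ltNge => /negP; apply.
  rewrite -N0; apply: le_measure; rewrite ?inE//.
  by apply: measurableX; exact: measurable_itv.
have [zD t4] := rim_sub r0 r4 zr; have t0 := tdisc_gt0 zD.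
have [cw wC] : op_le (scalar_op (c * w z)) (@opW R K p a b z) /\
    op_le (@opW R K p a b z) (scalar_op (C0 * w z)).
  by apply: contrapT => h; apply: zN; apply: Nw => /(_ zD).
have := scalar_comparable_at p1 K0 zD c0 C00 cw wC.
have -> : tdisc z `^ b = tdisc z `^ a * tdisc z `^ (b - a).
  by rewrite -powRD ?(gt_eqF t0) ?implybT//; congr (_ `^ _); ring.
have ta : 0 < tdisc z `^ a by exact: powR_gt0.
have tu : tdisc z `^ (b - a) <= c / C0 / 2.
  have -> : c / C0 / 2 = u `^ (b - a).
    by rewrite -powRrM mulVf ?powRr1 ?ltW// subr_eq0 gt_eqF.
  apply: ge0_ler_powR; rewrite ?nnegrE ?(ltW u0) ?(ltW t0) ?subr_ge0 ?(ltW ab)//.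
  by rewrite (le_trans t4)// mulrC divfK// ge_min lexx orbT.
move: (tdisc z `^ (b - a)) tu => v vu.
rewrite mulrCA mulrC ler_pM2l// => cv.
have : C0 * v <= c / 2.
  apply: (le_trans (_ : _ <= C0 * (c / C0 / 2))); first by rewrite ler_pM2l.
  by rewrite mulrA mulrCA mulfV ?gt_eqF// mulr1.
lra.
Qed.

End NotComparable.

(** * The Bergman kernel *)

Section KernelRegularity.
Context {R : realType}.
Local Open Scope complex_scope.
Implicit Types z w : R * R.
Local Notation plane := (measurableTypeR R * measurableTypeR R)%type.
Local Notation normc := ComplexField.Normc.normc.

Lemma powR_continuous (s x : R) : 0 < x -> {for x, continuous (@powR R ^~ s)}.
Proof.
move=> x0; apply: differentiable_continuous; apply/derivable1_diffP.
by have [] := is_derive1_powR s x0.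
Qed.

(** The argument of [(1 - w^* z)^(eta + 2)]. The quotient is written with the power -1, equal to the
    inverse since [kre > 0] on the disc, so that measurability and continuity of powers apply. *)
Definition kang (eta : R) z w : R := (eta + 2) * atan (kim z w * kre z w `^ (-1)).

(* The kernel on the disc, in polar form and extended by zero. *)
Definition kfun (eta : R) z w : R[i] :=
  (kabs eta z w * cos (kang eta z w)) +i* (- (kabs eta z w * sin (kang eta z w))).

Lemma kernel_argE z w : 1 - (toC w)^* * toC z = kre z w +i* kim z w.
Proof.
rewrite /toC /kre /kim; case: z w => [x y] [u v] /=; apply/eqP.
by rewrite eq_complex /=; apply/andP; split; apply/eqP; ring.
Qed.

Lemma kfunE eta z w : disc z -> disc w -> bergman_kernel eta z w = kfun eta z w.
Proof.
move=> zD wD; rewrite /bergman_kernel kernel_argE /cpow /=.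
have k0 := kre_gt0 zD wD; have c0 := cden_gt0 zD wD.
rewrite /kfun /kang /kabs indicE mem_set// mul1r powR_inv1 ?(ltW k0)//.
rewrite powRN -/(cden z w).
move: (powR_gt0 (eta + 2) c0) (_ * atan _); move: (cden z w `^ (eta + 2)) => r r0 t.
apply: (mulIf (x := (r * cos t) +i* (r * sin t))).
  rewrite eq_complex /= !mulf_eq0 (gt_eqF r0) /=; apply/negP => /andP[/eqP ct /eqP st].
  have := cos2Dsin2 t; rewrite ct st expr0n /= addr0 => /eqP.
  by rewrite eq_sym oner_eq0.
rewrite mulVf; last first.
  rewrite eq_complex /= !mulf_eq0 (gt_eqF r0) /=; apply/negP => /andP[/eqP ct /eqP st].
  have := cos2Dsin2 t; rewrite ct st expr0n /= addr0 => /eqP.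
  by rewrite eq_sym oner_eq0.
have rr : r^-1 * r = 1 by rewrite mulVf// gt_eqF.
apply/eqP; rewrite eq_complex /=; apply/andP; split; apply/eqP.
  have -> : r^-1 * cos t * (r * cos t) - - (r^-1 * sin t) * (r * sin t) =
    (r^-1 * r) * (cos t ^+ 2 + sin t ^+ 2) by ring.
  by rewrite rr cos2Dsin2 mulr1.
by ring.
Qed.

Lemma normc_kfun eta z w : normc (kfun eta z w) = kabs eta z w.
Proof.
rewrite /kfun /=; have := kabs_ge0 eta z w; move: (kabs eta z w) (kang eta z w) => r t r0.
rewrite sqrrN !exprMn -mulrDr cos2Dsin2 mulr1.
by rewrite sqrtr_sqr ger0_norm.
Qed.

Lemma measurable_kabs eta z : measurable_fun setT (fun w : plane => kabs eta z w).
Proof.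
apply: measurable_funM; first exact: measurable_indic_disc.
by apply: measurable_powR_comp; exact: measurable_cden.
Qed.

Lemma measurable_kang eta z : measurable_fun setT (fun w : plane => kang eta z w).
Proof.
have m1 : measurable_fun setT (fun w : plane => w.1) by exact: measurable_fst.
have m2 : measurable_fun setT (fun w : plane => w.2) by exact: measurable_snd.
apply: measurable_funM; first exact: measurable_cst.
apply: measurableT_comp.
  by apply: continuous_measurable_fun => x; exact: continuous_atan.
apply: measurable_funM.
  by apply: measurable_funB; apply: measurable_funM.
apply: measurable_powR_comp; apply: measurable_funB; first exact: measurable_cst.
by apply: measurable_funD; apply: measurable_funM.
Qed.

Lemma measurable_Re_kfun eta z :
  measurable_fun setT (fun w : plane => complex.Re (kfun eta z w)).
Proof.
apply: measurable_funM; first exact: measurable_kabs.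
apply: measurableT_comp; last exact: measurable_kang.
by apply: continuous_measurable_fun; exact: continuous_cos.
Qed.

Lemma measurable_Im_kfun eta z :
  measurable_fun setT (fun w : plane => complex.Im (kfun eta z w)).
Proof.
apply: measurableT_comp => //.
apply: measurable_funM; first exact: measurable_kabs.
apply: measurableT_comp; last exact: measurable_kang.
by apply: continuous_measurable_fun; exact: continuous_sin.
Qed.

(** For fixed [z] the kernel is bounded in [w], so integrability against it reduces to integrability
    of the function. *)
Lemma kabs_le eta z w : -1 < eta -> disc z -> kabs eta z w <= (tdisc z / 2) `^ (- (eta + 2)).
Proof.
move=> eta1 zD; rewrite /kabs indicE; have [/set_mem wD|_] := boolP (w \in _); last first.
  by rewrite mul0r powR_ge0.
rewrite mul1r; apply: ler_powR_neg.
- by rewrite divr_gt0// tdisc_gt0.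
- by have := tdisc_le_cden zD wD; move: (tdisc z) (cden z w) => x y; lra.
- by lra.
Qed.

Lemma kfun_cvg eta (u : nat -> R * R) z w : disc z -> 
  (u n).1 @[n --> \oo] --> z.1 -> (u n).2 @[n --> \oo] --> z.2 ->
  complex.Re (kfun eta (u n) w) @[n --> \oo] --> complex.Re (kfun eta z w) /\
  complex.Im (kfun eta (u n) w) @[n --> \oo] --> complex.Im (kfun eta z w).
Proof.
move=> zD u1 u2; have [wD|wD] := pselect (disc w); last first.
  have k0 x : kabs eta x w = 0 by rewrite /kabs indicE memNset// mul0r.
  rewrite /kfun /= !k0 !mul0r; split.
    by under eq_cvg do rewrite k0 mul0r; exact: cvg_cst.
  by under eq_cvg do rewrite k0 mul0r; exact: cvg_cst.
have re : kre (u n) w @[n --> \oo] --> kre z w.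
  by apply: cvgB; [exact: cvg_cst|apply: cvgD; apply: cvgMr].
have im : kim (u n) w @[n --> \oo] --> kim z w by apply: cvgB; apply: cvgMr.
have cd : cden (u n) w @[n --> \oo] --> cden z w.
  apply: (@continuous_cvg _ _ _ _ _ _ (@Num.sqrt R)); first exact: sqrt_continuous.
  by rewrite !expr2; apply: cvgD; apply: cvgM.
have ka : kabs eta (u n) w @[n --> \oo] --> kabs eta z w.
  apply: cvgMr; apply: (@continuous_cvg _ _ _ _ _ _ (@powR R ^~ (- (eta + 2)))) => //.
  exact/powR_continuous/cden_gt0.
have kg : kang eta (u n) w @[n --> \oo] --> kang eta z w.
  apply: cvgMr; apply: (@continuous_cvg _ _ _ _ _ _ (@atan R)); first exact: continuous_atan.
  apply: cvgM => //; apply: (@continuous_cvg _ _ _ _ _ _ (@powR R ^~ (-1))) => //.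
  exact/powR_continuous/kre_gt0.
split=> /=; last apply: cvgN.
  by apply: cvgM => //; apply: (@continuous_cvg _ _ _ _ _ _ (@cos R)) => //; exact: continuous_cos.
by apply: cvgM => //; apply: (@continuous_cvg _ _ _ _ _ _ (@sin R)) => //; exact: continuous_sin.
Qed.

End KernelRegularity.

(** * The weighted space *)

Section PowerIntegrals.
Context {R : realType}.
Local Notation plane := (measurableTypeR R * measurableTypeR R)%type.

(** Up to the constant [k], [t^g d mu_eta] is [d mu_(eta + g)], a finite measure. *)
Lemma integral_tpos_powR (eta g : R) : -1 < eta -> -1 < eta + g ->
  (\int[mu_eta eta]_z (tpos z `^ g)%:E < +oo)%E.
Proof.
move=> eta1 etag; have mt := measurable_tpos (R := R).
rewrite ge0_integral_mu_eta; first last.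
- by move=> z; rewrite lee_fin powR_ge0.
- by apply/measurable_EFinP; exact: measurable_powR_comp.
pose k := (eta + 1) / (eta + g + 1).
have k0 : 0 <= k by rewrite divr_ge0//; lra.
have := mu_eta_finite etag.
rewrite -[X in mu_eta _ X]/(setT : set plane) -[ltLHS]mul1e -integral_cst//.
rewrite ge0_integral_mu_eta// => fin.
have dens w : ((mu_eta_density eta w)%:E * (tpos w `^ g)%:E)%E =
    (k%:E * ((mu_eta_density (eta + g) w)%:E * cst 1 w))%E.
  rewrite mule1 -!EFinM; congr EFin; rewrite /mu_eta_density indicE.
  have [/set_mem wD|_] := boolP (w \in _); last by rewrite !(mulr0, mul0r).
  have t0 := tdisc_gt0 wD; rewrite tposE// /density.
  rewrite !ger0_norm; [|by apply: mulr_ge0; [lra|exact: powR_ge0]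
    |by apply: mulr_ge0; [lra|exact: powR_ge0]].
  rewrite powRD ?(gt_eqF t0) ?implybT// /k; move: (_ `^ _) (_ `^ _) (pi^-1) => x y c.
  by field; rewrite gt_eqF//; lra.
under eq_integral do rewrite dens.
rewrite ge0_integralZl//.
- by rewrite lte_mul_pinfty.
- apply: emeasurable_funM => //; apply/measurable_EFinP.
  exact: measurable_mu_eta_density.
- by move=> w _; rewrite mule1 lee_fin mu_eta_density_ge0.
Qed.

(* Hoelder's inequality against [tpos ^ (- al / p)]. *)
Lemma integral_weighted_lty (p eta al : R) (g : plane -> R) : 1 < p -> -1 < eta ->
  al < (p - 1) * (eta + 1) -> measurable_fun setT g -> (forall z, 0 <= g z) ->
  (\int[mu_eta eta]_z ((tpos z `^ (al / p) * g z) `^ p)%:E < +oo)%E ->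
  (\int[mu_eta eta]_z (g z)%:E < +oo)%E.
Proof.
move=> p1 eta1 alp mg g0 fin; have mt := measurable_tpos (R := R).
have p0 : 0 < p by lra.
pose q := p / (p - 1).
have q0 : 0 < q by rewrite divr_gt0//; lra.
have pq : p^-1 + q^-1 = 1 by rewrite /q; field; lra.
have := @hoelder_integral _ _ _ (mu_eta eta) (fun z => tpos z `^ (- (al / p)))
  (fun z => tpos z `^ (al / p) * g z) p q.
have -> : (\int[mu_eta eta]_x (tpos x `^ (- (al / p)) * (tpos x `^ (al / p) * g x))%:E)%E =
    (\int[mu_eta eta]_x (g x)%:E)%E.
  apply: eq_integral => z _; congr EFin; rewrite mulrA -powRD.
    by rewrite addNr powRr0 mul1r.
  by rewrite (gt_eqF (tpos_gt0 z)) implybT.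
have e z : (tpos z `^ (- (al / p))) `^ q = tpos z `^ (- (al / (p - 1))).
  by rewrite -powRrM; congr powR; rewrite /q; field; lra.
under [in X in (X `^ (p / q))%E]eq_integral do rewrite e.
have := @integral_tpos_powR eta (- (al / (p - 1))) eta1.
(* The upper bound on [al] is exactly integrability of the dual power of [t]. *)
have -> : -1 < eta - al / (p - 1).
  have : al / (p - 1) < eta + 1 by rewrite ltr_pdivrMr; lra.
  by move: (al / _) => x; lra.
move=> /(_ isT) fin1 H.
have {H} := H _ _ _ _ p0 q0 pq.
rewrite /= => H.
apply: (@lty_poweRy _ _ p); first by rewrite gt_eqF.
apply: le_lt_trans (H _ _ _ _) _.
- exact: measurable_powR_comp.
- by apply: measurable_funM => //; exact: measurable_powR_comp.
- by move=> z; exact: powR_ge0.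
- by move=> z; apply: mulr_ge0 => //; exact: powR_ge0.
apply: lte_mul_pinfty; [exact: poweR_ge0| |exact: fin].
by rewrite ge0_fin_numE ?poweR_ge0// poweR_lty.
Qed.

End PowerIntegrals.

(** * The weighted norm and its two seminorms *)

Section WeightedNorm.
Context {R : realType} {K : hilbertType R}.
Local Open Scope complex_scope.
Local Notation plane := (measurableTypeR R * measurableTypeR R)%type.
Variables p a b : R.
Implicit Types x : K * K.

(* [opU], with [tdisc] replaced by a function positive on the whole plane. *)
Definition opUx (z : R * R) : K * K -> K * K :=
  symop (tpos z `^ (a / p)) (tpos z `^ (a / p)) (tpos z `^ (a / p) + tpos z `^ (b / p)).

Lemma opUxE z : disc z -> opUx z = opU p a b z.
Proof. by move=> zD; rewrite opUE /opUx tposE. Qed.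

(** [hsum] and [hsnd] are the norms of the two components of [C x], on which [D] acts diagonally. *)
Definition hsum x : R := hnorm (x.1 + x.2).
Definition hsnd x : R := hnorm x.2.

Lemma hsum_ge0 x : 0 <= hsum x. Proof. exact: hnorm_ge0. Qed.
Lemma hsnd_ge0 x : 0 <= hsnd x. Proof. exact: hnorm_ge0. Qed.

Lemma sublinear_hsum : sublinear hsum.
Proof.
split=> [x y|c x c0]; first by rewrite /hsum /= addrACA ler_hnormD.
by rewrite /hsum /= -scalerDr hnormZr ger0_norm.
Qed.

Lemma sublinear_hsnd : sublinear hsnd.
Proof.
split=> [x y|c x c0]; first by rewrite /hsnd /= ler_hnormD.
by rewrite /hsnd /= hnormZr ger0_norm.
Qed.

Lemma dominated_hsum : dominated hsum 2.
Proof.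
move=> x y; rewrite (le_trans (ler_dist_hnorm _ _))//.
rewrite opprD addrACA (le_trans (ler_hnormD _ _))//.
by rewrite mulr_natl mulr2n lerD// (hnorm_fst_le (x - y), hnorm_snd_le (x - y)).
Qed.

Lemma dominated_hsnd : dominated hsnd 1.
Proof.
move=> x y; rewrite mul1r (le_trans (ler_dist_hnorm _ _))//.
exact: (hnorm_snd_le (x - y)).
Qed.

Lemma hnorm_le_hsum_hsnd x : hnorm x <= hsum x + 2 * hsnd x.
Proof.
have : hnorm x.1 <= hsum x + hsnd x.
  by have := ler_hnormD (x.1 + x.2) (- x.2); rewrite addrK hnormN.
by have := hnorm_pair_le x; rewrite /hsnd; move: (hsum x) => s; lra.
Qed.

Lemma opUx_fst z x : (opUx z x).1 = (tpos z `^ (a / p))%:C *: (x.1 + x.2).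
Proof. by rewrite scalerDr. Qed.

Lemma opUx_snd z x : (opUx z x).2 = (opUx z x).1 + (tpos z `^ (b / p))%:C *: x.2.
Proof. by rewrite /opUx /symop /= raddfD scalerDl addrA. Qed.

Lemma hsum_le_opUx z x : tpos z `^ (a / p) * hsum x <= hnorm (opUx z x).
Proof.
by rewrite (le_trans _ (hnorm_fst_le _))// opUx_fst hnormZr ger0_norm ?powR_ge0.
Qed.

(** The difference of the two components of [U x] is [t^(b / p) x.2]. *)
Lemma hsnd_le_opUx z x : tpos z `^ (b / p) * hsnd x <= 2 * hnorm (opUx z x).
Proof.
have -> : tpos z `^ (b / p) * hsnd x = hnorm ((opUx z x).2 - (opUx z x).1).
  by rewrite opUx_snd addrAC subrr add0r hnormZr ger0_norm ?powR_ge0.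
have := ler_hnormD (opUx z x).2 (- (opUx z x).1); rewrite hnormN.
by have := hnorm_fst_le (opUx z x); have := hnorm_snd_le (opUx z x); lra.
Qed.

Lemma opUx_le z x : hnorm (opUx z x) <=
  2 * (tpos z `^ (a / p) * hsum x) + tpos z `^ (b / p) * hsnd x.
Proof.
have := ler_hnormD (opUx z x).1 ((tpos z `^ (b / p))%:C *: x.2).
rewrite -opUx_snd opUx_fst !hnormZr !ger0_norm ?powR_ge0//.
by have := hnorm_pair_le (opUx z x); rewrite opUx_fst hnormZr ger0_norm ?powR_ge0// /hsum /hsnd; lra.
Qed.

(** The matrix is a sum of scalar functions times fixed bounded maps: [place i j] takes one
    component and puts it into one slot. *)
Lemma smeas_symop (u v w : plane -> R) (f : plane -> K * K) :
  measurable_fun setT u -> measurable_fun setT v -> measurable_fun setT w ->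
  smeas f -> smeas (fun z => symop (u z) (v z) (w z) (f z)).
Proof.
move=> mu mv mw mf.
pose place (i j : bool) (x : K * K) : K * K :=
  let y := if i then x.1 else x.2 in if j then (y, 0) else (0, y).
have placed (i j : bool) (k : plane -> R) : measurable_fun setT k ->
    smeas (fun z => (k z)%:C *: place i j (f z)).
  move=> mk; apply: smeasZ => //.
  apply: (@smeas_map _ _ _ _ _ _ (place i j) 1) => //.
    move=> c [x1 x2] [y1 y2]; rewrite /place /=; case: i; case: j; congr pair => //=;
    by rewrite scaler0 addr0.
  move=> x; rewrite mul1r /place; case: i; case: j;
    rewrite (le_trans (hnorm_pair_le _))//= hnorm0 ?addr0 ?add0r;
    by rewrite ?hnorm_fst_le ?hnorm_snd_le.
have -> : (fun z => symop (u z) (v z) (w z) (f z)) = (fun z =>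
    ((u z)%:C *: ((f z).1, 0) + (v z)%:C *: ((f z).2, 0)) +
    ((v z)%:C *: (0, (f z).1) + (w z)%:C *: (0, (f z).2))).
  apply/funext => z; rewrite /symop; congr pair => /=.
    by rewrite !scaler0 !addr0.
  by rewrite !scaler0 !add0r.
apply: smeasD; apply: smeasD.
- exact: (placed true true).
- exact: (placed false true).
- exact: (placed true false).
- exact: (placed false false).
Qed.

Lemma smeas_opUx (f : plane -> K * K) : smeas f -> smeas (fun z => opUx z (f z)).
Proof.
have mt := measurable_tpos (R := R).
move=> mf; apply: smeas_symop => //; try exact: measurable_powR_comp.
by apply: measurable_funD; exact: measurable_powR_comp.
Qed.

End WeightedNorm.

Section AlmostEverywhere.
Context d (T : measurableType d) (R : realType) (m : {measure set T -> \bar R}).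
Implicit Types P Q S : T -> Prop.

Lemma ae_imply P Q : (forall x, P x -> Q x) ->
  {ae m, forall x, P x} -> {ae m, forall x, Q x}.
Proof. exact: filterS. Qed.

Lemma ae_imply2 P Q S : (forall x, P x -> Q x -> S x) ->
  {ae m, forall x, P x} -> {ae m, forall x, Q x} -> {ae m, forall x, S x}.
Proof. exact: filterS2. Qed.

End AlmostEverywhere.

Section BergmanOnLpW.
Context {R : realType} {K : hilbertType R}.
Local Open Scope complex_scope.
Local Notation plane := (measurableTypeR R * measurableTypeR R)%type.
Variables p eta a b : R.
Hypotheses (p1 : 1 < p) (eta1 : -1 < eta) (K0 : nonzero_space K).
Hypotheses (ha0 : a < 0) (hb : b < (p - 1) * (eta + 1)).
Implicit Types f g : plane -> K * K.
Local Notation W := (@opW R K p a b).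
Local Notation mu := (mu_eta eta).
Local Notation normc := ComplexField.Normc.normc.

Let p0 : 0 < p. Proof. by apply: lt_trans p1. Qed.
Let eta0 : 0 < eta + 1. Proof. by rewrite -ltrBlDr sub0r. Qed.
Let pm0 : 0 < (p - 1) * (eta + 1). Proof. by rewrite mulr_gt0// subr_gt0. Qed.

(** The p-th power of the norm of L^p(W), with [opUx] for the root of [W] so that the integrand
    makes sense, and is measurable, on the whole plane. *)
Definition wint g : \bar R := (\int[mu]_z (hnorm (opUx p a b z (g z)) `^ p)%:E)%E.

Lemma LpW_normE f g : {ae area R, forall z, f z = g z} ->
  LpW_norm p eta W f = ((wint g) `^ p^-1)%E.
Proof.
move=> fg; rewrite /LpW_norm integral_mkcond; apply: (congr1 (fun x => x `^ p^-1)%E).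
apply: ae_eq_lower_integral => [z|z|].
- rewrite /patch; case: ifP => // _; by rewrite lee_fin powR_ge0.
- by rewrite lee_fin powR_ge0.
apply: ae_area_mu_eta; apply: (ae_imply2 _ (@area_disc R) fg) => z zD fgz.
rewrite /patch (mem_set zD) fgz (opW_root a b p1 K0 zD).
by rewrite (opUxE p a b (K := K) zD).
Qed.

Lemma in_LpW_smeas f : in_LpW p eta W f ->
  exists g, [/\ smeas g, {ae area R, forall z, f z = g z} & (wint g < +oo)%E].
Proof.
move=> [/smeas_ae [g mg fg] fin]; exists g; split => //.
move: fin; rewrite (LpW_normE fg); apply: lty_poweRy.
by rewrite invr_eq0 gt_eqF.
Qed.

Lemma smeas_in_LpW f g : smeas g -> {ae area R, forall z, f z = g z} ->
  (wint g < +oo)%E -> in_LpW p eta W f.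
Proof.
move=> mg fg fin; split; first exact: smeas_strong fg.
by rewrite (LpW_normE fg); exact: poweR_lty.
Qed.

Section Components.
Variable g : plane -> K * K.
Hypothesis mg : smeas g.

Lemma measurable_hsum : measurable_fun setT (fun z => hsum (g z)).
Proof. exact: smeas_dominated (@dominated_hsum _ _) mg. Qed.

Lemma measurable_hsnd : measurable_fun setT (fun z => hsnd (g z)).
Proof. exact: smeas_dominated (@dominated_hsnd _ _) mg. Qed.

Lemma measurable_wint :
  measurable_fun setT (fun z => (hnorm (opUx p a b z (g z)) `^ p)%:E).
Proof.
apply/measurable_EFinP; apply: measurable_powR_comp.
by apply: smeas_hnorm; exact: smeas_opUx.
Qed.

Lemma integral_hsum_le :
  (\int[mu]_z ((tpos z `^ (a / p) * hsum (g z)) `^ p)%:E <= wint g)%E.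
Proof.
apply: ae_le_lower_integral => [z|z|]; rewrite ?lee_fin ?powR_ge0//.
apply: aeW => z; rewrite lee_fin; apply: ge0_ler_powR; first exact: ltW.
- by rewrite nnegrE mulr_ge0 ?powR_ge0 ?hsum_ge0.
- by rewrite nnegrE hnorm_ge0.
- exact: hsum_le_opUx.
Qed.

Lemma integral_hsnd_le :
  (\int[mu]_z ((tpos z `^ (b / p) * hsnd (g z)) `^ p)%:E <= (2 `^ p)%:E * wint g)%E.
Proof.
rewrite /wint -ge0_integralZl//; first last.
- by move=> z _; rewrite lee_fin powR_ge0.
- exact: measurable_wint.
apply: ae_le_lower_integral => [z|z|]; rewrite ?lee_fin ?mulr_ge0 ?powR_ge0//.
apply: aeW => z; rewrite -EFinM lee_fin -powRM ?hnorm_ge0//.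
apply: ge0_ler_powR; first exact: ltW.
- by rewrite nnegrE mulr_ge0 ?powR_ge0 ?hsnd_ge0.
- by rewrite nnegrE mulr_ge0 ?hnorm_ge0.
- exact: hsnd_le_opUx.
Qed.

(** The inclusion of L^p(W) in L^1(mu_eta): Hoelder's inequality is applied to [hsum] with exponent
    [a] and to [hsnd] with exponent [b]. *)
Lemma integral_hnorm_lty : (wint g < +oo)%E -> (\int[mu]_z (hnorm (g z))%:E < +oo)%E.
Proof.
move=> fin.
have fin1 : (\int[mu]_z (hsum (g z))%:E < +oo)%E.
  apply: (integral_weighted_lty p1 eta1 (lt_trans ha0 pm0)).
  - exact: measurable_hsum.
  - by move=> z; exact: hsum_ge0.
  - exact: le_lt_trans integral_hsum_le fin.
have fin2 : (\int[mu]_z (hsnd (g z))%:E < +oo)%E.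
  apply: (integral_weighted_lty p1 eta1 hb).
  - exact: measurable_hsnd.
  - by move=> z; exact: hsnd_ge0.
  - apply: le_lt_trans integral_hsnd_le _; apply: lte_mul_pinfty => //.
have m1 := measurable_hsum; have m2 := measurable_hsnd.
apply: (@le_lt_trans _ _ (\int[mu]_z ((hsum (g z))%:E + 2%:E * (hsnd (g z))%:E))%E).
  apply: ae_le_lower_integral => [z|z|].
  - by rewrite lee_fin hnorm_ge0.
  - by rewrite -EFinM lee_fin addr_ge0 ?mulr_ge0 ?hsum_ge0 ?hsnd_ge0.
  - by apply: aeW => z; rewrite -EFinM lee_fin hnorm_le_hsum_hsnd.
rewrite ge0_integralD//.
- rewrite ge0_integralZl//.
  + by rewrite lte_add_pinfty// lte_mul_pinfty.
  + exact/measurable_EFinP.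
  + by move=> z _; rewrite lee_fin hsnd_ge0.
- by move=> z _; rewrite lee_fin hsum_ge0.
- exact/measurable_EFinP.
- by move=> z _; rewrite -EFinM lee_fin mulr_ge0 ?hsnd_ge0.
- by apply: emeasurable_funM => //; exact/measurable_EFinP.
Qed.

Hypothesis fin : (wint g < +oo)%E.

Lemma smeas_kfun z : smeas (fun w => kfun eta z w *: g w).
Proof.
apply: smeasZ => //; [exact: measurable_Re_kfun|exact: measurable_Im_kfun].
Qed.

Lemma bochner_integrable_kfun z : disc z ->
  bochner_integrable mu (fun w => kfun eta z w *: g w).
Proof.
move=> zD; apply: bochner_integrable_smeas; [exact: mu_eta_finite|exact: smeas_kfun|].
pose c := (tdisc z / 2) `^ (- (eta + 2)).
have c0 : (0 <= c%:E)%E by rewrite lee_fin powR_ge0.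
apply: (@le_lt_trans _ _ (\int[mu]_w (c%:E * (hnorm (g w))%:E))%E); last first.
  rewrite ge0_integralZl//.
  - by apply: lte_mul_pinfty => //; exact: integral_hnorm_lty.
  - by apply/measurable_EFinP; exact: smeas_hnorm.
  - by move=> w _; rewrite lee_fin hnorm_ge0.
apply: ae_le_lower_integral => [w|w|].
- by rewrite lee_fin hnorm_ge0.
- by rewrite mule_ge0// lee_fin hnorm_ge0.
apply: aeW => w; rewrite -EFinM lee_fin hnormZ normc_kfun.
by apply: ler_wpM2r; [exact: hnorm_ge0|exact: kabs_le].
Qed.

End Components.

Lemma kernel_ae f g z : {ae area R, forall w, f w = g w} -> disc z ->
  {ae mu, forall w, kfun eta z w *: g w = bergman_kernel eta z w *: f w}.
Proof.
move=> fg zD; apply: ae_area_mu_eta; apply: (ae_imply2 _ (@area_disc R) fg) => w wD ->.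
by rewrite kfunE.
Qed.

Lemma bergmanE f g z : smeas g -> (wint g < +oo)%E ->
  {ae area R, forall w, f w = g w} -> disc z ->
  is_bochner mu (fun w => bergman_kernel eta z w *: f w) (bergman eta f z) /\
  is_bochner mu (fun w => kfun eta z w *: g w) (bergman eta f z).
Proof.
move=> mg fin fg zD; have kb := kernel_ae fg zD.
have : is_bochner mu (fun w => kfun eta z w *: g w) (bergman eta f z).
  rewrite /bergman -(bochner_ae kb); apply: bochnerP; first exact: mu_eta_finite.
  exact: bochner_integrable_kfun.
by move=> h; split; [exact: is_bochner_ae kb h|exact: h].
Qed.

End BergmanOnLpW.

(** * Boundedness of the projection *)

Section BergmanBound.
Context {R : realType} {K : hilbertType R}.
Local Open Scope complex_scope.
Local Notation plane := (measurableTypeR R * measurableTypeR R)%type.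
Local Notation normc := ComplexField.Normc.normc.

Definition kint (eta : R) (h : plane -> R) (z : R * R) : \bar R :=
  (\int[mu_eta eta]_w (kabs eta z w * h w)%:E)%E.

Lemma kint_ge0 eta h z : (forall w, 0 <= h w) -> (0 <= kint eta h z)%E.
Proof.
move=> h0; apply: integral_ge0 => w _; rewrite lee_fin; apply: mulr_ge0 => //.
exact: kabs_ge0.
Qed.

Lemma measurable_kint eta (h : plane -> R) : -1 < eta -> measurable_fun setT h ->
  (forall w, 0 <= h w) -> measurable_fun setT (fun z : plane => kint eta h z).
Proof.
move=> eta1 mh h0; have [m mE] := mu_eta_sigma_finite eta1.
have -> : (fun z : plane => kint eta h z) =
    fubini_F m (fun u : plane * plane => (kabs eta u.1 u.2 * h u.2)%:E).
  apply/funext => z; rewrite /kint /fubini_F; apply: eq_measure_integral => A _ _.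
  by rewrite -[RHS]/((m : set plane -> \bar R) A) mE.
apply: measurable_fun_fubini_tonelli_F.
  apply/measurable_EFinP; apply: measurable_funM; last exact: measurableT_comp.
  apply: measurable_funM.
    exact: (measurableT_comp (@measurable_indic_disc R) measurable_snd).
  by apply: measurable_powR_comp; exact: measurable_cden2.
by move=> u; rewrite lee_fin; apply: mulr_ge0 => //; exact: kabs_ge0.
Qed.

(** [2 A + B] is at most three times the larger of [A] and [B]. *)
Lemma powR_add_le (p A B : R) : 0 < p -> 0 <= A -> 0 <= B ->
  (2 * A + B) `^ p <= 3 `^ p * (A `^ p + B `^ p).
Proof.
move=> p0 A0 B0; wlog AB : A B A0 B0 / A <= B => [h|].
  have [/h|/ltW BA] := leP A B; first exact.
  apply: (@le_trans _ _ ((3 * A) `^ p)).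
    by apply: ge0_ler_powR; rewrite ?nnegrE ?(ltW p0)//; lra.
  by rewrite powRM// ler_wpM2l ?powR_ge0// lerDl powR_ge0.
apply: (@le_trans _ _ ((3 * B) `^ p)).
  by apply: ge0_ler_powR; rewrite ?nnegrE ?(ltW p0)//; lra.
by rewrite powRM// ler_wpM2l ?powR_ge0// lerDr powR_ge0.
Qed.

Variables p eta a b : R.
Hypotheses (p1 : 1 < p) (eta1 : -1 < eta).
Hypotheses (ha : - (eta + 1) < a) (ha0 : a < 0).
Hypotheses (hb0 : 0 < b) (hb : b < (p - 1) * (eta + 1)).
Implicit Types f g : plane -> K * K.
Local Notation mu := (mu_eta eta).

Let p0 : 0 < p. Proof. by apply: lt_trans p1. Qed.
Let eta0 : 0 < eta + 1. Proof. by rewrite -ltrBlDr sub0r. Qed.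
Let pm0 : 0 < (p - 1) * (eta + 1). Proof. by rewrite mulr_gt0// subr_gt0. Qed.

Lemma bergman_sublinear_le (N : K * K -> R) M f g z : sublinear N -> dominated N M ->
  (forall x, 0 <= N x) -> (forall k x, N (k *: x) = normc k * N x) ->
  smeas g -> (wint p eta a b g < +oo)%E -> {ae area R, forall w, f w = g w} -> disc z ->
  ((N (bergman eta f z))%:E <= kint eta (fun w => N (g w)) z)%E.
Proof.
move=> sN dN N0 NZ mg fin fg zD.
have [_ h] := bergmanE p1 eta1 ha0 hb mg fin fg zD.
have := is_bochner_sublinear (mu_eta_finite eta1) sN dN N0 h.
move=> /le_trans; apply; rewrite /kint.
apply: ae_le_lower_integral => [w|w|].
- by rewrite lee_fin; exact: N0.
- by rewrite lee_fin; apply: mulr_ge0; [exact: kabs_ge0|exact: N0].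
by apply: aeW => w; rewrite NZ normc_kfun.
Qed.

Definition wkint (al : R) (h : plane -> R) (z : plane) : \bar R :=
  (((\1_(@disc R) z * tpos z `^ (al / p))%:E * kint eta h z) `^ p)%E.

Lemma measurable_wkint (al : R) (h : plane -> R) : measurable_fun setT h -> (forall w, 0 <= h w) ->
  measurable_fun setT (wkint al h).
Proof.
move=> mh h0; apply: (measurableT_comp (measurable_poweR p)).
apply: emeasurable_funM; last exact: measurable_kint.
apply/measurable_EFinP; apply: measurable_funM; first exact: measurable_indic_disc.
by apply: measurable_powR_comp; exact: measurable_tpos.
Qed.

Lemma wkint_ge0 (al : R) (h : plane -> R) z : (0 <= wkint al h z)%E.
Proof. exact: poweR_ge0. Qed.

Lemma le_wkint (al : R) (h : plane -> R) z (x : R) : disc z -> 0 <= x -> (forall w, 0 <= h w) ->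
  (x%:E <= kint eta h z)%E -> (((tpos z `^ (al / p) * x) `^ p)%:E <= wkint al h z)%E.
Proof.
move=> zD x0 h0 xh; rewrite /wkint -poweR_EFin.
have t0 := powR_ge0 (tpos z) (al / p).
apply: gt0_ler_poweR; first exact: ltW.
- by rewrite in_itv/= leey andbT lee_fin mulr_ge0.
- rewrite in_itv/= leey andbT; apply: mule_ge0; last exact: kint_ge0.
  by rewrite lee_fin; apply: mulr_ge0.
by rewrite indicE mem_set// mul1r EFinM; apply: lee_wpmul2l.
Qed.

Lemma wint_bergman_le f g : smeas g -> (wint p eta a b g < +oo)%E ->
  {ae area R, forall w, f w = g w} ->
  (wint p eta a b (bergman eta f) <= (3 `^ p)%:E *
     (\int[mu]_z wkint a (fun w => hsum (g w)) z +
      \int[mu]_z wkint b (fun w => hsnd (g w)) z))%E.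
Proof.
move=> mg fin fg.
have ms := measurable_wkint a (measurable_hsum mg) (fun w => hsum_ge0 (g w)).
have mn := measurable_wkint b (measurable_hsnd mg) (fun w => hsnd_ge0 (g w)).
have s0 z : (0 <= wkint a (fun w => hsum (g w)) z)%E by exact: wkint_ge0.
have n0 z : (0 <= wkint b (fun w => hsnd (g w)) z)%E by exact: wkint_ge0.
rewrite -ge0_integralD; [|exact: measurableT|by move=> z _; exact: s0|exact: ms
  |by move=> z _; exact: n0|exact: mn].
rewrite -ge0_integralZl; [|exact: measurableT|exact: emeasurable_funD
  |by move=> z _; exact: adde_ge0|by rewrite lee_fin powR_ge0].
apply: ae_le_lower_integral => [z|z|].
- by rewrite lee_fin powR_ge0.
- by apply: mule_ge0; [rewrite lee_fin powR_ge0|exact: adde_ge0].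
apply: ae_area_mu_eta; apply: ae_imply (@area_disc R) => z zD.
set x := bergman eta f z.
have hs : ((hsum x)%:E <= kint eta (fun w => hsum (g w)) z)%E.
  apply: bergman_sublinear_le fg zD => //.
  - exact: sublinear_hsum.
  - exact: dominated_hsum.
  - exact: hsum_ge0.
  - by move=> k y; rewrite /hsum /= -scalerDr hnormZ.
have hn : ((hsnd x)%:E <= kint eta (fun w => hsnd (g w)) z)%E.
  apply: bergman_sublinear_le fg zD => //.
  - exact: sublinear_hsnd.
  - exact: dominated_hsnd.
  - exact: hsnd_ge0.
  - by move=> k y; rewrite /hsnd /= hnormZ.
have Hs := le_wkint a zD (hsum_ge0 x) (fun w => hsum_ge0 (g w)) hs.
have Hn := le_wkint b zD (hsnd_ge0 x) (fun w => hsnd_ge0 (g w)) hn.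
have A0 : 0 <= tpos z `^ (a / p) * hsum x by rewrite mulr_ge0 ?powR_ge0 ?hsum_ge0.
have B0 : 0 <= tpos z `^ (b / p) * hsnd x by rewrite mulr_ge0 ?powR_ge0 ?hsnd_ge0.
apply: le_trans (lee_wpmul2l _ (leeD Hs Hn)); last by rewrite lee_fin powR_ge0.
rewrite -EFinD -EFinM lee_fin; apply: le_trans (powR_add_le p0 A0 B0).
apply: ge0_ler_powR; first exact: ltW.
- by rewrite nnegrE hnorm_ge0.
- by rewrite nnegrE addr_ge0// mulr_ge0.
- exact: opUx_le.
Qed.

Lemma wint_bergman : exists2 C : R, 0 <= C & forall f g, smeas g ->
  (wint p eta a b g < +oo)%E -> {ae area R, forall w, f w = g w} ->
  (wint p eta a b (bergman eta f) <= C%:E * wint p eta a b g)%E.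
Proof.
have [Ca Ca0 Ba] := bergman_abs_bound p1 eta1 ha (lt_trans ha0 pm0).
have hb' : - (eta + 1) < b by apply: lt_trans hb0; rewrite oppr_lt0.
have [Cb Cb0 Bb] := bergman_abs_bound p1 eta1 hb' hb.
(* [3^p] comes from splitting the norm into two seminorms, [2^p] from bounding [hsnd] back by the
   norm; [Ca] and [Cb] are the scalar operator bounds. *)
exists (3 `^ p * (Ca + Cb * 2 `^ p)).
  by rewrite mulr_ge0 ?addr_ge0 ?mulr_ge0 ?powR_ge0.
move=> f g mg fin fg; apply: le_trans (wint_bergman_le mg fin fg) _.
have indic_le (F : plane -> R) : (forall z, 0 <= F z) ->
    (\int[mu]_z (\1_(@disc R) z * F z)%:E <= \int[mu]_z (F z)%:E)%E.
  move=> F0; apply: ae_le_lower_integral => [z|z|].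
  - by rewrite lee_fin mulr_ge0.
  - by rewrite lee_fin.
  - by apply: aeW => z; rewrite lee_fin indicE; case: (_ \in _); rewrite ?mul1r ?mul0r.
have Ia : (\int[mu]_z wkint a (fun w => hsum (g w)) z <= Ca%:E * wint p eta a b g)%E.
  apply: le_trans (Ba _ (measurable_hsum mg) (fun w => hsum_ge0 (g w))) _.
  apply: lee_wpmul2l; first by rewrite lee_fin.
  apply: le_trans (integral_hsum_le eta a b p1 g).
  by apply: indic_le => z; exact: powR_ge0.
have Ib : (\int[mu]_z wkint b (fun w => hsnd (g w)) z <=
    (Cb * 2 `^ p)%:E * wint p eta a b g)%E.
  apply: le_trans (Bb _ (measurable_hsnd mg) (fun w => hsnd_ge0 (g w))) _.
  rewrite EFinM -muleA; apply: lee_wpmul2l; first by rewrite lee_fin.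
  apply: le_trans (integral_hsnd_le eta a b p1 mg).
  by apply: indic_le => z; exact: powR_ge0.
rewrite EFinM -muleA; apply: lee_wpmul2l; first by rewrite lee_fin powR_ge0.
rewrite EFinD ge0_muleDl ?lee_fin ?mulr_ge0 ?powR_ge0//.
exact: leeD.
Qed.

End BergmanBound.

(** * Continuity and measurability of the projection *)

Section BergmanMeasurable.
Context {R : realType} {K : hilbertType R}.
Local Open Scope complex_scope.
Local Notation plane := (measurableTypeR R * measurableTypeR R)%type.
Local Notation normc := ComplexField.Normc.normc.

Lemma disc_tdisc (z : R * R) : 0 < tdisc z -> disc z.
Proof.
rewrite /tdisc subr_gt0 => z1.
by rewrite /disc/= -(@ltr_pXn2r _ 2%N) ?nnegrE ?sqrtr_ge0// expr1n.
Qed.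

Lemma cvg_sqr (u : nat -> R) (l : R) : u n @[n --> \oo] --> l ->
  u n ^+ 2 @[n --> \oo] --> l ^+ 2.
Proof. by move=> ul; rewrite expr2; apply: cvgM. Qed.

Lemma tdisc_cvg (u : nat -> R * R) z :
  (u n).1 @[n --> \oo] --> z.1 -> (u n).2 @[n --> \oo] --> z.2 ->
  tdisc (u n) @[n --> \oo] --> tdisc z.
Proof.
move=> u1 u2; rewrite tdiscE; under eq_cvg do rewrite tdiscE.
by apply: cvgB; [exact: cvg_cst|apply: cvgD; exact: cvg_sqr].
Qed.

Variables p eta a b : R.
Hypotheses (p1 : 1 < p) (eta1 : -1 < eta).
Hypotheses (ha0 : a < 0) (hb : b < (p - 1) * (eta + 1)).
Local Notation mu := (mu_eta eta).
Variable g : plane -> K * K.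
Hypotheses (mg : smeas g) (fin : (wint p eta a b g < +oo)%E).

(** The projection with the everywhere measurable kernel [kfun]; on the disc it agrees with
    [bergman] of any function equal to [g] almost everywhere. *)
Definition Pg (z : R * R) : K * K := bochner mu (fun w => kfun eta z w *: g w).

Lemma Pg_is_bochner z : disc z -> is_bochner mu (fun w => kfun eta z w *: g w) (Pg z).
Proof.
move=> zD; apply: bochnerP; first exact: mu_eta_finite.
exact: (bochner_integrable_kfun p1 eta1 ha0 hb mg fin zD).
Qed.

Lemma hnorm_PgB y z : disc y -> disc z ->
  ((hnorm (Pg y - Pg z))%:E <=
   \int[mu]_w (hnorm (kfun eta y w *: g w - kfun eta z w *: g w))%:E)%E.
Proof.
move=> yD zD.
have := is_bochner_linear (mu_eta_finite eta1) (-1) (Pg_is_bochner zD) (Pg_is_bochner yD).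
move=> /(is_bochner_sublinear (mu_eta_finite eta1) (@sublinear_hnorm _ _)
  (@dominated_hnorm _ _) (@hnorm_ge0 _ _)).
rewrite scaleN1r addrC => /le_trans; apply; rewrite le_eqVlt; apply/orP; left; apply/eqP.
by apply: eq_integral => w _; rewrite scaleN1r addrC.
Qed.

(** Points with [tdisc] at least half of [tdisc z] share one bound [c] for the kernel, so [2 c |g|]
    is an integrable majorant for dominated convergence. *)
Lemma Pg_cvg_bounded (u : nat -> R * R) z : disc z ->
  (forall n, tdisc z / 2 <= tdisc (u n)) ->
  (u n).1 @[n --> \oo] --> z.1 -> (u n).2 @[n --> \oo] --> z.2 ->
  hnorm (Pg (u n) - Pg z) @[n --> \oo] --> (0 : R).
Proof.
move=> zD ut u1 u2; have t0 := tdisc_gt0 zD.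
have uD n : disc (u n).
  by apply: disc_tdisc; apply: lt_le_trans (ut n); rewrite divr_gt0.
have e20 : - (eta + 2) <= 0.
  by rewrite oppr_le0 -lerBlDr sub0r (le_trans _ (ltW eta1))// lerN2 ler1n.
pose c := (tdisc z / 2 / 2) `^ (- (eta + 2)).
have c0 : 0 <= c by exact: powR_ge0.
have cle y w : disc y -> tdisc z / 2 <= tdisc y -> kabs eta y w <= c.
  move=> yD ty; apply: (le_trans (kabs_le w eta1 yD)).
  by apply: ler_powR_neg => //; [rewrite !divr_gt0|rewrite ler_pM2r].
have zz : tdisc z / 2 <= tdisc z by lra.
pose F n w := (hnorm (kfun eta (u n) w *: g w - kfun eta z w *: g w))%:E.
have mn : measurable_fun setT (fun w => hnorm (g w)) by exact: smeas_hnorm.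
have F0 : (\int[mu]_w F n w)%E @[n --> \oo] --> 0%E.
  have := @dominated_convergence _ _ R mu setT measurableT F (cst 0%E)
    (fun w => (2 * c * hnorm (g w))%:E).
  case.
  - move=> n; apply/measurable_EFinP; apply: smeas_hnorm.
    by apply: smeasB; exact: smeas_kfun.
  - exact: measurable_cst.
  - apply: aeW => w _; apply: cvg_EFin; first exact: nearW.
    have [kr ki] := kfun_cvg eta w zD u1 u2.
    apply: (@squeeze_cvgr _ _ _ _ (fun=> 0) (fun n =>
      (`|complex.Re (kfun eta (u n) w) - complex.Re (kfun eta z w)| +
       `|complex.Im (kfun eta (u n) w) - complex.Im (kfun eta z w)|) * hnorm (g w))).
    + apply: nearW => n; rewrite hnorm_ge0/= -scalerBl hnormZ.
      apply: ler_wpM2r; first exact: hnorm_ge0.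
      exact: le_trans (normc_le_ReIm _) _.
    + exact: cvg_cst.
    rewrite -[X in _ --> X](mul0r (hnorm (g w))); apply: cvgMl.
    rewrite -[X in _ --> X](addr0 0); apply: cvgD.
      by rewrite -(normr0 R) -(subrr (complex.Re (kfun eta z w))); apply: cvg_norm;
        apply: cvgB => //; exact: cvg_cst.
    by rewrite -(normr0 R) -(subrr (complex.Im (kfun eta z w))); apply: cvg_norm;
      apply: cvgB => //; exact: cvg_cst.
  - apply/integrableP; split.
      by apply/measurable_EFinP; apply: measurable_funM.
    rewrite (_ : (\int[mu]_(x in setT) _)%E =
       (\int[mu]_w ((2 * c)%:E * (hnorm (g w))%:E))%E); last first.
      apply: eq_integral => w _; rewrite gee0_abs ?EFinM// -!EFinM lee_fin.
      by rewrite mulr_ge0 ?hnorm_ge0// mulr_ge0.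
    rewrite ge0_integralZl//.
    + apply: lte_mul_pinfty => //; first by rewrite lee_fin mulr_ge0.
      exact: (integral_hnorm_lty p1 eta1 ha0 hb mg fin).
    + exact/measurable_EFinP.
    + by move=> w _; rewrite lee_fin hnorm_ge0.
    + by rewrite lee_fin mulr_ge0.
  - apply: aeW => w n _; rewrite gee0_abs ?lee_fin ?hnorm_ge0//.
    rewrite (le_trans (ler_hnormD _ _))// hnormN !hnormZ !normc_kfun -mulrDl.
    apply: ler_wpM2r; first exact: hnorm_ge0.
    by rewrite mulr_natl mulr2n; apply: lerD; apply: cle.
  by move=> _ _; rewrite integral0.
apply/cvgrPdist_lt => e e0; have := cvge0_lt e0 F0; apply: filterS => n Fn.
rewrite sub0r normrN ger0_norm ?hnorm_ge0// -lte_fin.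
exact: le_lt_trans (hnorm_PgB (uD n) zD) Fn.
Qed.

Lemma Pg_cvg (u : nat -> R * R) z : disc z ->
  (u n).1 @[n --> \oo] --> z.1 -> (u n).2 @[n --> \oo] --> z.2 ->
  (\forall n \near \oo, disc (u n)) /\
  hnorm (Pg (u n) - Pg z) @[n --> \oo] --> (0 : R).
Proof.
move=> zD u1 u2; have t0 := tdisc_gt0 zD.
have ut : \forall n \near \oo, tdisc z / 2 <= tdisc (u n).
  by apply: (cvgr_ge _ (tdisc_cvg u1 u2)); rewrite gtr_pMr// invf_lt1// ltr1n.
split; first by apply: filterS ut => n un; apply: disc_tdisc; apply: lt_le_trans un; rewrite divr_gt0.
(* The finitely many points too close to the boundary, or outside the disc, are replaced by [z]; the
   limit is unaffected. *)
pose v n := if tdisc z / 2 <= tdisc (u n) then u n else z.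
have vu : \forall n \near \oo, v n = u n by apply: filterS ut => n; rewrite /v => ->.
have : hnorm (Pg (v n) - Pg z) @[n --> \oo] --> (0 : R).
  apply: Pg_cvg_bounded => //.
  - by move=> n; rewrite /v; case: ifP => // _; lra.
  - by apply: cvg_trans u1; apply: near_eq_cvg; apply: filterS vu => n ->.
  - by apply: cvg_trans u2; apply: near_eq_cvg; apply: filterS vu => n ->.
by apply: cvg_trans; apply: near_eq_cvg; apply: filterS vu => n ->.
Qed.

(* On the disc [Pg] is continuous, hence a limit of its values at
   finitely-valued approximations of the identity map. *)
Lemma smeas_Pg : smeas (fun z : plane => if z \in @disc R then Pg z else 0).
Proof.
have [s1 [ss1 sv1]] := measurable_finite_simple_cvg
  (@measurable_fst _ _ (measurableTypeR R) (measurableTypeR R)).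
have [s2 [ss2 sv2]] := measurable_finite_simple_cvg
  (@measurable_snd _ _ (measurableTypeR R) (measurableTypeR R)).
exists (fun n z => if (z \in @disc R) && ((s1 n z, s2 n z) \in @disc R)
  then Pg (s1 n z, s2 n z) else 0); split => [n|z].
  apply: (finite_simple_comp (fun x : bool * (R * R) =>
    if x.1 && (x.2 \in @disc R) then Pg x.2 else 0) (s := fun z : plane => (z \in @disc R, (s1 n z, s2 n z)))).
  apply: finite_simple_pair; first exact: finite_simple_in (@measurable_disc R).
  exact: finite_simple_pair (ss1 n) (ss2 n).
have [zD|_] := boolP (z \in _); last first.
  by under eq_cvg do rewrite subrr hnorm0; exact: cvg_cst.
have [uD h] := @Pg_cvg (fun n => (s1 n z, s2 n z)) z (set_mem zD) (sv1 z) (sv2 z).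
apply: cvg_trans h; apply: near_eq_cvg; apply: filterS uD => n un.
by rewrite mem_set.
Qed.

End BergmanMeasurable.

Section BergmanBounded.
Context {R : realType} {K : hilbertType R}.
Local Open Scope complex_scope.
Local Notation plane := (measurableTypeR R * measurableTypeR R)%type.
Variables p eta a b : R.
Hypotheses (p1 : 1 < p) (eta1 : -1 < eta) (K0 : nonzero_space K).
Hypotheses (ha : - (eta + 1) < a) (ha0 : a < 0).
Hypotheses (hb0 : 0 < b) (hb : b < (p - 1) * (eta + 1)).
Implicit Types f g : plane -> K * K.
Local Notation W := (@opW R K p a b).
Local Notation mu := (mu_eta eta).

Let p0 : 0 < p. Proof. by apply: lt_trans p1. Qed.

Lemma wint_ae f g : {ae area R, forall z, f z = g z} ->
  wint p eta a b f = wint p eta a b g.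
Proof.
move=> fg; apply: ae_eq_lower_integral => [z|z|].
- by rewrite lee_fin powR_ge0.
- by rewrite lee_fin powR_ge0.
by apply: ae_area_mu_eta; apply: ae_imply fg => z ->.
Qed.

Lemma bergman_in_LpW f : in_LpW p eta W f -> in_LpW p eta W (bergman eta f).
Proof.
move=> /(in_LpW_smeas p1 K0)[g [mg fg fin]].
have [C C0 Cle] := wint_bergman p1 eta1 ha ha0 hb0 hb (K := K).
have bG : {ae area R, forall z, bergman eta f z = if z \in @disc R then Pg eta g z else 0}.
  apply: ae_imply (@area_disc R) => z zD.
  by rewrite (mem_set zD) /Pg (bochner_ae (kernel_ae eta fg zD)).
apply: (smeas_in_LpW (eta := eta) p1 K0 (smeas_Pg p1 eta1 ha0 hb mg fin) bG).
rewrite -(wint_ae bG); apply: le_lt_trans (Cle _ _ mg fin fg) _.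
by apply: lte_mul_pinfty => //; rewrite lee_fin.
Qed.

Lemma bergman_eq_ae f g z : {ae area R, forall z, f z = g z} ->
  bergman eta f z = bergman eta g z.
Proof.
by move=> fg; apply: bochner_ae; apply: ae_area_mu_eta; apply: ae_imply fg => w ->.
Qed.

Lemma bergman_is_bochner f z : in_LpW p eta W f -> disc z ->
  is_bochner mu (fun w => bergman_kernel eta z w *: f w) (bergman eta f z).
Proof.
move=> /(in_LpW_smeas p1 K0)[g [mg fg fin]] zD.
by have [] := bergmanE p1 eta1 ha0 hb mg fin fg zD.
Qed.

Lemma bergman_linear (c : R[i]) f g z : in_LpW p eta W f -> in_LpW p eta W g -> disc z ->
  bergman eta (fun w => c *: f w + g w) z = c *: bergman eta f z + bergman eta g z.
Proof.
move=> /bergman_is_bochner hf /bergman_is_bochner hg zD.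
apply: bochnerE; first exact: mu_eta_finite.
have := is_bochner_linear (mu_eta_finite eta1) c (hf _ zD) (hg _ zD).
by under eq_fun do rewrite scalerA [c * _]mulrC -scalerA -scalerDr.
Qed.

Lemma bergman_norm : exists M : R, forall f, in_LpW p eta W f ->
  (LpW_norm p eta W (bergman eta f) <= M%:E * LpW_norm p eta W f)%E.
Proof.
have [C C0 Cle] := wint_bergman p1 eta1 ha ha0 hb0 hb (K := K).
exists (C `^ p^-1) => f /(in_LpW_smeas p1 K0)[g [mg fg fin]].
have bb : {ae area R, forall z, bergman eta f z = bergman eta f z} by exact: aeW.
rewrite (LpW_normE eta a b p1 K0 fg) (LpW_normE eta a b p1 K0 bb).
have wint0 h : (0 <= wint p eta a b h :> \bar R)%E.
  by apply: integral_ge0 => z _; rewrite lee_fin powR_ge0.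
rewrite -poweR_EFin -poweRM// ?lee_fin//.
apply: gt0_ler_poweR; first by rewrite invr_ge0 ltW.
- by rewrite in_itv/= leey andbT.
- by rewrite in_itv/= leey andbT mule_ge0// lee_fin.
exact: Cle.
Qed.

(** On the disc the root of [W] cancels the inverse root in [f], so the weighted norm is the
    L^p(mu_eta) norm of the finitely valued [F]. Here [g] is the version of [f] built with
    [tpos]. *)
Lemma bergman_dom_in_LpW f : bergman_dom p W f -> in_LpW p eta W f.
Proof.
move=> [F [sF _ ->]].
pose g (z : plane) := symop (tpos z `^ (- (a / p)) + tpos z `^ (- (b / p)))
  (- tpos z `^ (- (b / p))) (tpos z `^ (- (b / p))) (F z).
have mt := measurable_tpos (R := R).
have mg : smeas g.
  apply: smeas_symop; last exact: simple_smeas.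
  - by apply: measurable_funD; exact: measurable_powR_comp.
  - by apply: measurableT_comp => //; exact: measurable_powR_comp.
  - exact: measurable_powR_comp.
have gE z : disc z -> g z = opUinv p a b z (F z).
  by move=> zD; rewrite /g /opUinv /wal /wbe (tposE zD) !powRN.
apply: (smeas_in_LpW (eta := eta) p1 K0 mg).
  apply: ae_imply (@area_disc R) => z zD.
  by rewrite (opW_root_inv a b p1 K0 zD) gE.
rewrite /wint (@ae_eq_lower_integral _ _ _ _ _ (fun z : plane => (hnorm (F z) `^ p)%:E)).
- rewrite (integral_finite_simple (mu_eta_finite eta1) (fun v => hnorm v `^ p) sF).
  exact: ltry.
- by move=> z; rewrite lee_fin powR_ge0.
- by move=> z; rewrite lee_fin powR_ge0.
apply: ae_area_mu_eta; apply: ae_imply (@area_disc R) => z zD.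
by rewrite (gE _ zD) (opUxE p a b (K := K) zD) (opUVK p a b zD).
Qed.

Lemma bergman_boundedP : bergman_bounded p eta W.
Proof.
exists (bergman eta).
  split; [exact: bergman_in_LpW| | |exact: bergman_norm].
    by move=> f g _ _ fg; apply: aeW => z; exact: bergman_eq_ae.
  move=> c f g fL gL; apply: ae_imply (@area_disc R) => z.
  exact: bergman_linear.
move=> f /bergman_dom_in_LpW fL; split => //; last exact: aeW.
by move=> z zD; exists (bergman eta f z); exact: bergman_is_bochner.
Qed.

End BergmanBounded.

(** * The weight *)

Section WeightAssumptions.
Context {R : realType} {K : hilbertType R}.
Local Open Scope complex_scope.
Local Notation plane := (measurableTypeR R * measurableTypeR R)%type.
Variables p eta a b : R.
Hypotheses (p1 : 1 < p) (eta1 : -1 < eta) (K0 : nonzero_space K).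
Hypotheses (ha : - (eta + 1) < a) (ha0 : a < 0).
Hypotheses (hb0 : 0 < b) (hb : b < (p - 1) * (eta + 1)).
Local Notation W := (@opW R K p a b).
Local Notation mu := (mu_eta eta).

Let p0 : 0 < p. Proof. by apply: lt_trans p1. Qed.
Let pm1 : 0 < p - 1. Proof. by rewrite subr_gt0. Qed.

(** Both moment conditions on the weight have this form: the norm of a root or inverse root applied
    to a fixed vector is dominated by two powers of [t]. *)
Lemma integral_two_powers (q s r u v : R) (F : plane -> R) : 0 < q -> 0 <= u -> 0 <= v ->
  -1 < eta + s * q -> -1 < eta + r * q ->
  (forall z, disc z -> 0 <= F z <= 2 * (tpos z `^ s * u) + tpos z `^ r * v) ->
  (\int[mu]_(z in @disc R) (F z `^ q)%:E < +oo)%E.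
Proof.
move=> q0 u0 v0 sq rq Fle; have mt := measurable_tpos (R := R).
pose c := 3 `^ q * u `^ q; pose d := 3 `^ q * v `^ q.
have c0 : 0 <= c by rewrite mulr_ge0 ?powR_ge0.
have d0 : 0 <= d by rewrite mulr_ge0 ?powR_ge0.
have fin1 := integral_tpos_powR eta1 sq; have fin2 := integral_tpos_powR eta1 rq.
have pos (e x : R) z : 0 <= e -> (0 <= e%:E * (tpos z `^ x)%:E)%E.
  by move=> e0; rewrite -EFinM lee_fin mulr_ge0 ?powR_ge0.
have mpow (e x : R) : measurable_fun setT (fun z : plane => (e%:E * (tpos z `^ x)%:E)%E).
  by apply: measurable_funeM; apply/measurable_EFinP; exact: measurable_powR_comp.
apply: (@le_lt_trans _ _
    (\int[mu]_z (c%:E * (tpos z `^ (s * q))%:E + d%:E * (tpos z `^ (r * q))%:E))%E).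
  rewrite integral_mkcond; apply: ae_le_lower_integral => [z|z|].
  - by rewrite /patch; case: ifP => // _; rewrite lee_fin powR_ge0.
  - by apply: adde_ge0; exact: pos.
  apply: aeW => z; rewrite /patch; case: ifP => [/set_mem zD|_]; last first.
    by apply: adde_ge0; exact: pos.
  have /andP[F0 FB] := Fle z zD.
  have A0 : 0 <= tpos z `^ s * u by rewrite mulr_ge0 ?powR_ge0.
  have B0 : 0 <= tpos z `^ r * v by rewrite mulr_ge0 ?powR_ge0.
  rewrite -!EFinM -EFinD lee_fin; apply: (@le_trans _ _ ((2 * (tpos z `^ s * u) + tpos z `^ r * v) `^ q)).
    by apply: ge0_ler_powR; rewrite ?nnegrE ?(ltW q0)// addr_ge0// mulr_ge0.
  apply: le_trans (powR_add_le q0 A0 B0) _.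
  rewrite !powRM ?powR_ge0// -!powRrM /c /d.
  by rewrite mulrDr -!mulrA ![_ * tpos z `^ _]mulrC lexx.
rewrite ge0_integralD; [|exact: measurableT|by move=> z _; exact: pos|exact: mpow
  |by move=> z _; exact: pos|exact: mpow].
have mp (x : R) : measurable_fun setT (fun z : plane => (tpos z `^ x)%:E).
  by apply/measurable_EFinP; exact: measurable_powR_comp.
have tp (x : R) (z : plane) : (0 <= (tpos z `^ x)%:E)%E by rewrite lee_fin powR_ge0.
rewrite ge0_integralZl; [|exact: measurableT|exact: mp|by move=> z _; exact: tp|by rewrite lee_fin].
rewrite ge0_integralZl; [|exact: measurableT|exact: mp|by move=> z _; exact: tp|by rewrite lee_fin].
by apply: lte_add_pinfty; apply: lte_mul_pinfty; rewrite ?lee_fin.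
Qed.

Lemma measurable_wal (e : R) : measurable_fun setT (fun z : plane => tdisc z `^ (e / p)).
Proof. by apply: measurable_powR_comp; exact: measurable_tdisc. Qed.

(** By [opW_symop], [W z e] has coefficients that are explicit measurable functions of [tdisc z], so
    the functional calculus need not be approximated. *)
Lemma strongly_measurable_opW (e : K * K) : strongly_measurable (area R) (fun z => W z e).
Proof.
have ma := measurable_wal a; have mb := measurable_wal b.
have mD : measurable_fun setT (fun z : plane => eigD (wal p a z) (wbe p b z)).
  apply: measurableT_comp; first by apply: continuous_measurable_fun; exact: sqrt_continuous.
  apply: measurable_funD; last exact: measurable_funX.
  by apply: measurable_funM => //; exact: measurable_funX.
have m2 : measurable_fun setT (fun z : plane => 2 * wal p a z + wbe p b z).
  by apply: measurable_funD => //; exact: measurable_funM.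
have ml : measurable_fun setT (fun z : plane => wl p a b z).
  by apply: measurable_funM => //; exact: measurable_funD.
have mm : measurable_fun setT (fun z : plane => wm p a b z).
  by apply: measurable_funM => //; exact: measurable_funB.
have ms : measurable_fun setT (fun z : plane => wslope p a b z).
  have -> : (fun z : plane => wslope p a b z) = (fun z : plane =>
      (wl p a b z `^ p - wm p a b z `^ p) * eigD (wal p a z) (wbe p b z) `^ (-1)).
    by apply/funext => z; rewrite powR_inv1 ?sqrtr_ge0// -eigmaxBmin.
  apply: measurable_funM; last exact: measurable_powR_comp.
  by apply: measurable_funB; exact: measurable_powR_comp.
have mc : measurable_fun setT (fun z : plane => wcst p a b z).
  by apply: measurable_funB; [exact: measurable_powR_comp|exact: measurable_funM].
apply: (smeas_strong (g := fun z : plane =>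
  symop (wslope p a b z * wal p a z + wcst p a b z) (wslope p a b z * wal p a z)
        (wslope p a b z * (wal p a z + wbe p b z) + wcst p a b z) (cst e z))).
  apply: smeas_symop; [| | |exact/simple_smeas/finite_simple_cst].
  - by apply: measurable_funD => //; exact: measurable_funM.
  - exact: measurable_funM.
  - by apply: measurable_funD => //; apply: measurable_funM => //; exact: measurable_funD.
by apply: ae_imply (@area_disc R) => z zD; rewrite (opW_symop p a b K0 zD).
Qed.

(** With [y = (x.1, x.2 - x.1)], the inverse adjoint of [C] applied to [x], the inverse of [U] is
    diagonal scaling of [y] followed by the inverse of [C]. *)
Lemma opUinv_le z (x : K * K) : disc z -> hnorm (opUinv p a b z x) <=
  2 * (tpos z `^ (- (b / p)) * hnorm (x.1 - x.2)) + tpos z `^ (- (a / p)) * hnorm x.1.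
Proof.
move=> zD; rewrite (tposE zD) !powRN -/(wal p a z) -/(wbe p b z).
have i0 : 0 <= (wal p a z)^-1 by rewrite invr_ge0 powR_ge0.
have j0 : 0 <= (wbe p b z)^-1 by rewrite invr_ge0 powR_ge0.
rewrite /opUinv; move: (wal p a z)^-1 (wbe p b z)^-1 i0 j0 => i j i0 j0.
have e1 : (symop (i + j) (- j) j x).1 = i%:C *: x.1 + j%:C *: (x.1 - x.2).
  by rewrite /symop /= rmorphD rmorphN scalerDl scalerBr scaleNr addrA.
have e2 : (symop (i + j) (- j) j x).2 = - (j%:C *: (x.1 - x.2)).
  by rewrite /symop /= rmorphN scalerBr opprB scaleNr addrC.
rewrite (le_trans (hnorm_pair_le _))// e1 e2 hnormN.
have := ler_hnormD (i%:C *: x.1) (j%:C *: (x.1 - x.2)).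
by rewrite !hnormZr !ger0_norm//; lra.
Qed.

(** The powers are [t^a], integrable because [a > -(eta + 1)], and [t^b] with [b > 0]. *)
Lemma integral_root_lty (e : K * K) :
  (\int[mu]_(z in @disc R) (hnorm (opow (W z) p^-1 e) `^ p)%:E < +oo)%E.
Proof.
apply: (@integral_two_powers p (a / p) (b / p) (hsum e) (hsnd e)) => //.
- exact: hsum_ge0.
- exact: hsnd_ge0.
- by rewrite divfK ?gt_eqF// -ltrBlDl -opprD [1 + _]addrC.
- by rewrite divfK ?gt_eqF// (lt_trans eta1)// ltrDl.
move=> z zD; rewrite hnorm_ge0 (opW_root a b p1 K0 zD) -(opUxE p a b (K := K) zD).
exact: opUx_le.
Qed.

Lemma integral_root_inv_lty (e : K * K) :
  (\int[mu]_(z in @disc R) (hnorm (opow (W z) (- p^-1) e) `^ (p / (p - 1)))%:E < +oo)%E.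
Proof.
have pn : p != 0 by rewrite gt_eqF.
have pn1 : p - 1 != 0 by rewrite gt_eqF.
(* At the dual exponent the powers are [t^(-b / (p - 1))], integrable because
   [b < (p - 1) (eta + 1)], and [t^(-a / (p - 1))] with [a < 0]. *)
have E x : - (x / p) * (p / (p - 1)) = - (x / (p - 1)) by field; rewrite pn pn1.
apply: (@integral_two_powers (p / (p - 1)) (- (b / p)) (- (a / p))
  (hnorm (e.1 - e.2)) (hnorm e.1)); rewrite ?hnorm_ge0 ?divr_gt0//.
- rewrite E -ltrBlDr opprK -ltrBrDl; rewrite ltr_pdivrMr//.
  by rewrite opprK mulrC.
- rewrite E -mulNr (lt_trans eta1)// ltrDl divr_gt0// oppr_gt0//.
move=> z zD; rewrite hnorm_ge0 (opW_root_inv a b p1 K0 zD).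
exact: opUinv_le.
Qed.

Lemma weight_assumptionsP : separable K -> weight_assumptions p eta W.
Proof.
move=> Ksep; split.
- by split; [exact: nonzero_space_pair|exact: separable_pair].
- by apply: aeW => z zD; exact: opW_regular.
- exact: strongly_measurable_opW.
- exact: integral_root_lty.
- exact: integral_root_inv_lty.
Qed.

End WeightAssumptions.

Theorem proposition5p1 (R : realType) (p eta a b : R) (K : hilbertType R)
    (hp : 1 < p) (heta : -1 < eta)
    (hK0 : nonzero_space K) (hKsep : separable K)
    (ha : - (eta + 1) < a) (ha0 : a < 0)
    (hb0 : 0 < b) (hb : b < (p - 1) * (eta + 1)) :
  let W : R * R -> K * K -> K * K := opW p a b in
  [/\ weight_assumptions p eta W,
      bergman_bounded p eta W,
      (forall z1 z2 : R * R, disc z1 -> disc z2 -> cabs z1 <> cabs z2 ->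
         W z1 \o W z2 <> W z2 \o W z1),
      ~ scalar_comparable W &
      (infinite_dim K -> infinite_dim (K * K)%type)].
Proof.
have ab : a < b := lt_trans ha0 hb0.
split.
- exact: weight_assumptionsP.
- exact: bergman_boundedP.
- by move=> z1 z2; exact: opW_noncommuting.
- exact: not_scalar_comparable.
- exact: infinite_dim_pair.
Qed.
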